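(* Let $d\ge2$ and $\lambda\in\mathbb{C}$. For each $R>0$ and $\delta\in(0,1]$, and all $g\in L^2(\mathbb{S}^{d-1})$, $$\|\rho_\delta\,\mathcal{E}_a(\lambda)g\|_{L^2(B(0,R))}\lesssim R^{\frac12}|\delta\lambda|^{-\frac{d-1}{2}}\|g\|_{L^2(\mathbb{S}^{d-1})},$$ uniformly over all $a$ with $\|a\|_{L^\infty(\mathbb{R}^d_x;C^N(\mathbb{S}^{d-1}_\xi))}\le1$.
   Context: For $a=a(x,\xi)$ on $\mathbb{R}^d\times\mathbb{S}^{d-1}$, bounded and smooth in $\xi$, define $$\mathcal{E}_a(\lambda)g(x):=\int_{\mathbb{S}^{d-1}}e^{i\lambda x\cdot\xi}a(x,\xi)g(\xi)\,dS(\xi),\quad x\in\mathbb{R}^d,\ \lambda\in\mathbb{C},$$ where $dS$ is the surface measure. $N$ is a fixed, sufficiently large integer depending only on $d$. The weight is $\rho_\delta(x,\lambda):=e^{-\sqrt{1+\delta}\,|\mathrm{Im}\lambda||x|}$. The implicit constant in $\lesssim$ depends only on $d$ (not on $\lambda,R,\delta,g,a$). For $\lambda=0$ the right-hand side is interpreted as $+\infty$ (when $g\neq0$). *)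

(* Defs.v *)
From HB Require Import structures.
From mathcomp Require Import all_boot all_order all_algebra.
From mathcomp Require Import complex.
From mathcomp Require Import all_classical all_reals all_analysis measurable_realfun ess_sup_inf.

Set Implicit Arguments.
Unset Strict Implicit.
Unset Printing Implicit Defensive.

Import Order.TTheory GRing.Theory Num.Theory.
Import numFieldNormedType.Exports.
Import ComplexField.Normc.

Local Open Scope classical_set_scope.
Local Open Scope ring_scope.

(* The product sigma-algebra on row vectors, as the library does for tuples. *)
Definition measure_rV_display : measure_display -> measure_display.
Proof. exact. Qed.

Section measurable_rV.
Context {d} {T : sigmaRingType d}.
Variable n : nat.

Let coors : 'I_n -> 'rV[T]_n -> T := fun i v => v ord0 i.

Let rV_set0 : g_sigma_preimage coors set0.
Proof. exact: sigma_algebra0. Qed.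

Let rV_setC A : g_sigma_preimage coors A -> g_sigma_preimage coors (~` A).
Proof. exact: sigma_algebraC. Qed.

Let rV_bigcup (F : _^nat) : (forall i, g_sigma_preimage coors (F i)) ->
  g_sigma_preimage coors (\bigcup_i (F i)).
Proof. exact: sigma_algebra_bigcup. Qed.

HB.instance Definition _ := @isMeasurable.Build (measure_rV_display d)
  'rV[T]_n (g_sigma_preimage coors) rV_set0 rV_setC rV_bigcup.

End measurable_rV.

Lemma measurable_coord d (T : sigmaRingType d) n (i : 'I_n) :
  measurable_fun [set: 'rV[T]_n] (fun v : 'rV[T]_n => v ord0 i).
Proof.
move=> _ Y mY; rewrite setTI; apply: sub_sigma_algebra => /=.
rewrite -bigcup_seq/=; exists i => /=; first by rewrite mem_index_enum.
by exists Y => //; rewrite setTI.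
Qed.

Lemma measurable_fun_rVP d1 d2 (T1 : measurableType d1) (T2 : measurableType d2)
    n (f : T1 -> 'rV[T2]_n) :
  (forall i, measurable_fun [set: T1] (fun x => f x ord0 i)) ->
  measurable_fun [set: T1] f.
Proof.
move=> mf.
have prefS : g_sigma_preimage (fun i x => f x ord0 i) `<=` measurable.
  apply: smallest_sub; first exact: sigma_algebra_measurable.
  case: n => [|n] in f mf *; first by rewrite big_ord0.
  rewrite -bigcup_mkord_ord; apply: bigcup_sub => i Ii.
  by move=> A [B mB <-]; exact: mf.
move=> _ A mA; apply: prefS.
have := @g_sigma_preimage_comp _ T2 n 'rV[T2]_n (fun i v => v ord0 i) _ f.
rewrite /comp => ->.
by exists A.
Qed.

Section rV_cons.
Variables (R : realType) (n : nat).

Definition rV_cons (p : measurableTypeR R * 'rV[R]_n) : 'rV[R]_n.+1 :=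
  row_mx (p.1%:M : 'rV_1) p.2.

Definition rV_uncons (v : 'rV[R]_n.+1) : measurableTypeR R * 'rV[R]_n :=
  (v ord0 ord0, \row_i v ord0 (lift ord0 i)).

Lemma rV_consE p i :
  rV_cons p ord0 i = if unlift ord0 i is Some j then p.2 ord0 j else p.1.
Proof.
case: unliftP => [j|] ->; rewrite /rV_cons.
  have -> : lift ord0 j = rshift 1 j by apply/val_inj.
  by rewrite (row_mxEr (p.1%:M : 'rV_1)).
have -> : ord0 = lshift n (ord0 : 'I_1) :> 'I_(1 + n) by apply/val_inj.
by rewrite (row_mxEl (p.1%:M : 'rV_1)) mxE eqxx.
Qed.

Lemma rV_consK : cancel rV_cons rV_uncons.
Proof.
move=> p; rewrite /rV_uncons rV_consE unlift_none; case: p => x v; congr pair.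
by apply/rowP => i; rewrite mxE rV_consE liftK.
Qed.

Lemma measurable_rV_cons : measurable_fun setT rV_cons.
Proof.
apply: measurable_fun_rVP => i; under eq_fun do rewrite rV_consE.
case: (unlift ord0 i) => [j|]; last exact: measurable_fst.
exact: (measurableT_comp (measurable_coord j) measurable_snd).
Qed.

Lemma measurable_rV_uncons : measurable_fun setT rV_uncons.
Proof.
apply: measurable_fun_pair; first exact: measurable_coord.
apply: measurable_fun_rVP => i; under eq_fun do rewrite mxE.
exact: measurable_coord.
Qed.

End rV_cons.

Section lebesgue_rV.
Variable R : realType.

Section step.
Variables (n : nat) (m : {sigma_finite_measure set 'rV[R]_n -> \bar R}).

Definition lebesgue_rV_step : set 'rV[R]_n.+1 -> \bar R :=
  pushforward (lebesgue_measure \x m)%E (@rV_cons R n).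

Let step0 : lebesgue_rV_step set0 = 0%E.
Proof. by rewrite /lebesgue_rV_step /pushforward preimage_set0 measure0. Qed.

Let step_ge0 A : (0 <= lebesgue_rV_step A)%E.
Proof. by have mc := @measurable_rV_cons R n; exact: measure_ge0. Qed.

Let step_sigma_additive : semi_sigma_additive lebesgue_rV_step.
Proof.
by have mc := @measurable_rV_cons R n; exact: measure_semi_sigma_additive.
Qed.

HB.instance Definition _ := isMeasure.Build _ _ _ lebesgue_rV_step
  step0 step_ge0 step_sigma_additive.

Let step_sigma_finite : sigma_finite setT lebesgue_rV_step.
Proof.
have /sigma_finiteP[F [TF ndF Foo]] := sigma_finiteT (@lebesgue_measure R).
have /sigma_finiteP[G [TG ndG Goo]] := sigma_finiteT m.
exists (fun k => @rV_uncons R n @^-1` (F k `*` G k)).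
  rewrite -preimage_bigcup (_ : \bigcup_k _ = setT) ?preimage_setT//.
  apply/seteqP; split => // -[x v] _.
  have [i _ Fix] : (\bigcup_i F i) x by rewrite -TF.
  have [j _ Gjv] : (\bigcup_i G i) v by rewrite -TG.
  exists (maxn i j) => //; split.
    by move: x Fix; exact/subsetPset/ndF/leq_maxl.
  by move: v Gjv; exact/subsetPset/ndG/leq_maxr.
move=> k; have [mF Fk] := Foo k; have [mG Gk] := Goo k; split.
  rewrite -[X in measurable X]setTI; apply: measurable_rV_uncons => //.
  exact: measurableX.
rewrite /lebesgue_rV_step /pushforward -comp_preimage.
rewrite (_ : _ @^-1` _ = F k `*` G k); last first.
  by rewrite (_ : _ \o _ = id)//; apply/funext => p; exact: rV_consK.
by rewrite product_measure1E// lte_mul_pinfty// ge0_fin_numE.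
Qed.

HB.instance Definition _ := Measure_isSigmaFinite.Build _ _ _ lebesgue_rV_step
  step_sigma_finite.

End step.

Fixpoint lebesgue_rV n : {sigma_finite_measure set 'rV[R]_n -> \bar R} :=
  if n is n'.+1 then lebesgue_rV_step (lebesgue_rV n') else dirac (0 : 'rV[R]_0).

End lebesgue_rV.
Arguments lebesgue_rV {R} n.

Section euclidean.
Variables (R : realType) (d : nat).
Implicit Types x y : 'rV[R]_d.

Definition dotv x y : R := \sum_(i < d) x ord0 i * y ord0 i.

(* The norm that the library puts on 'rV is the sup norm. *)
Definition enorm x : R := Num.sqrt (dotv x x).

Definition eball (r : R) : set 'rV[R]_d := [set x | enorm x < r].

Definition sphere : set 'rV[R]_d := [set x | enorm x = 1].

Definition normalize x : 'rV[R]_d := (enorm x)^-1 *: x.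

Lemma measurable_enorm : measurable_fun setT enorm.
Proof.
have eqE : enorm = (fun x => dotv x x `^ 2^-1).
  apply/funext => x; rewrite powR12_sqrt// sumr_ge0// => i _.
  by rewrite -expr2 sqr_ge0.
rewrite eqE.
apply: (measurableT_comp (f := @powR R ^~ 2^-1)); first exact: measurable_powR.
apply: measurable_sum => i.
by apply: measurable_funM; exact: measurable_coord.
Qed.

Lemma measurable_eball r : measurable (eball r).
Proof.
have := measurable_enorm measurableT (@measurable_itv R `]-oo, r[).
by rewrite setTI (_ : _ @^-1` _ = eball r).
Qed.

Lemma measurable_sphere : measurable sphere.
Proof.
have := measurable_enorm measurableT (measurable_set1 (1 : R)).
by rewrite setTI.
Qed.

Lemma measurable_normalize : measurable_fun setT normalize.
Proof.
have eqE : normalize = (fun x => (enorm x `^ (-1)) *: x).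
  by apply/funext => x; rewrite powR_inv1 ?sqrtr_ge0.
rewrite eqE; apply: measurable_fun_rVP => i; under eq_fun do rewrite mxE.
apply: measurable_funM; last exact: measurable_coord.
apply: (measurableT_comp (f := @powR R ^~ (-1))); first exact: measurable_powR.
exact: measurable_enorm.
Qed.

(* The sphere part of Lebesgue measure in polar coordinates, of total mass
   d * vol B(0,1). It is a measure on the ambient space carried by the
   sphere. *)
Definition surface (A : set 'rV[R]_d) : \bar R :=
  (d%:R%:E * lebesgue_rV d (normalize @^-1` A `&` eball 1))%E.

Let cone : {measure set 'rV[R]_d -> \bar R} :=
  mrestr (lebesgue_rV d) (measurable_eball 1).

Let surface0 : surface set0 = 0%E.
Proof. by rewrite /surface preimage_set0 set0I measure0 mule0. Qed.

Let surface_ge0 A : (0 <= surface A)%E.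
Proof. by apply: mule_ge0 => //; rewrite lee_fin. Qed.

Let surface_sigma_additive : semi_sigma_additive surface.
Proof.
have mn := measurable_normalize.
exact: (@measure_semi_sigma_additive _ _ _
  (mscale d%:R%:nng (pushforward cone normalize))).
Qed.

HB.instance Definition _ := isMeasure.Build _ _ _ surface
  surface0 surface_ge0 surface_sigma_additive.

End euclidean.
Arguments eball {R d} r.
Arguments sphere {R} d.
Arguments surface {R} d.

Section complex_valued.
Local Open Scope complex_scope.
Context (R : realType) d (T : measurableType d).
Implicit Types (f : T -> R[i]) (D : set T) (mu : {measure set T -> \bar R}).

Definition cexp (z : R[i]) : R[i] :=
  (expR (complex.Re z))%:C * (cos (complex.Im z) +i* sin (complex.Im z)).

Definition cmeasurable_fun D f :=
  measurable_fun D (fun x => complex.Re (f x)) /\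
  measurable_fun D (fun x => complex.Im (f x)).

Definition cintegral mu D f : R[i] :=
  (\int[mu]_(x in D) complex.Re (f x)) +i*
  (\int[mu]_(x in D) complex.Im (f x)).

Definition L2norm mu D f : \bar R :=
  'N[mu]_2%:E[(fun x => (normc (f x))%:E) \_ D].

Definition L2fun mu D f := cmeasurable_fun D f /\ (L2norm mu D f < +oo)%E.

End complex_valued.

Section sphere_regularity.
Local Open Scope complex_scope.
Variables (R : realType) (d : nat).
Implicit Types (f : 'rV[R]_d -> R[i]) (s : seq 'I_d).

(* [partials [:: i1; ...; ik] h] is the iterated partial derivative
   d_{i1} ... d_{ik} h. *)
Definition partials s (h : 'rV[R]_d -> R) : 'rV[R]_d -> R :=
  foldr (fun i k => 'D_(delta_mx ord0 i) k) h s.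

(* A function on the sphere is differentiated through its extension to
   R^d minus the origin that is homogeneous of degree 0; only the values of f
   on the sphere matter. *)
Definition hom0 f : 'rV[R]_d -> R[i] := fun y => f (normalize y).

Definition smooth_off0 (h : 'rV[R]_d -> R) :=
  forall s y, y != 0 ->
    {for y, continuous (partials s h)} /\
    forall i, derivable (partials s h) y (delta_mx ord0 i).

Definition smooth_sphere f :=
  smooth_off0 (fun y => complex.Re (hom0 f y)) /\
  smooth_off0 (fun y => complex.Im (hom0 f y)).

Definition CN_norm (N : nat) f : \bar R :=
  ereal_sup [set e | exists s xi, [/\ (size s <= N)%N, sphere d xi &
    e = (normc (partials s (fun y => complex.Re (hom0 f y)) xi +i*
                partials s (fun y => complex.Im (hom0 f y)) xi))%:E]].

End sphere_regularity.

Section extension_operator.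
Local Open Scope complex_scope.
Variables (R : realType) (d : nat).
Implicit Types (a : 'rV[R]_d -> 'rV[R]_d -> R[i]) (g : 'rV[R]_d -> R[i]).

(* Separability of C^N makes measurability of x |-> a x _ in C^N the same as
   measurability of every x |-> a x xi. *)
Definition amplitude a :=
  [/\ forall xi, sphere d xi -> cmeasurable_fun setT (a ^~ xi),
      exists M : R, forall x xi, sphere d xi -> normc (a x xi) <= M &
      forall x, smooth_sphere (a x)].

Definition LinfCN_norm (N : nat) a : \bar R :=
  ess_sup (lebesgue_rV d) (fun x => CN_norm N (a x)).

Definition extension a (lambda : R[i]) g (x : 'rV[R]_d) : R[i] :=
  cintegral (surface d) (sphere d) (fun xi =>
    cexp ((0 +i* 1) * lambda * (dotv x xi)%:C) * a x xi * g xi).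

Definition weight (delta : R) (lambda : R[i]) (x : 'rV[R]_d) : R :=
  expR (- (Num.sqrt (1 + delta) * `|complex.Im lambda| * enorm x)).

(* t^(-s), with the convention 0^(-s) = +oo for s > 0; recall that
   +oo * 0 = 0 in the extended reals. *)
Definition powRNy (t s : R) : \bar R :=
  if t == 0 then +oo%E else (t `^ (- s))%:E.

End extension_operator.

(* Main.v *)
(* Write [lambda = s + i t] and cut the sphere into [O(delta ^- (d - 1))] cells of
   diameter [kappa ~ delta]. By Cauchy-Schwarz this costs the factor
   [delta ^- (d - 1)] in the square of the estimate, so for [g] supported in one
   cell the bound has to be uniform in [delta].

   Let [x0] be a point of the cell. On the ball of radius [r] the square of the
   weight is at most [e ^ d W x], where
   [W x = exp (2 t x.x0 - mu sum_i |x_i|)] and [mu = 1 / r + 2 delta |t| / (3 d)].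
   For the amplitude [1], opening the square in [int W |E g|^2] produces the kernel
   [int W x exp (i lambda x.xi) conj (exp (i lambda x.eta)) dx], a product of
   one-dimensional integrals that are bounded by the Poisson kernels
   [8 mu / (mu ^ 2 + s ^ 2 (xi_i - eta_i) ^ 2)]. A cube of side [h] meets the sphere
   in measure [O(h ^ (d - 1))], so the Schur test bounds the operator norm by
   [O(mu ^- d min(mu / |s|, kappa) ^ (d - 1)) = O(r |lambda| ^- (d - 1))].

   A general amplitude is replaced by its values on a grid; summation by parts
   writes these as a combination of indicators of orthants whose coefficients are
   mixed differences, absolutely summable thanks to [d] derivatives in [xi]. The
   indicators are absorbed in [g], and the mesh tends to [0] (dominated convergence
   in [xi], Fatou in [x]). *)
Require Import Defs.
From HB Require Import structures.
From mathcomp Require Import all_boot all_order all_algebra.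
From mathcomp Require Import complex.
From mathcomp Require Import all_classical all_reals all_analysis.
From mathcomp Require Import measurable_realfun ess_sup_inf ring lra.

Set Implicit Arguments.
Unset Strict Implicit.
Unset Printing Implicit Defensive.

Import Order.TTheory GRing.Theory Num.Theory.
Import numFieldNormedType.Exports.
Import ComplexField.Normc.

Local Open Scope classical_set_scope.
Local Open Scope ring_scope.
Local Open Scope complex_scope.

(** * Products of measures and a T T* inequality *)

(** The obstacle is that the weight is radial, whereas [|exp (i lambda x.xi)| = exp (- t x.xi)]
    grows in a direction that depends on [xi], and a radial weight does not factor over the
    coordinates. Fixing one direction [x0] and trading the weight for the exponential of a linear
    form minus an l1 norm restores the product structure. The linear form cancels the growth at
    [xi = x0]; elsewhere in the cell a slope of at most [kappa |t|] per coordinate survives, and it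
    must stay below [mu / 4] for the one-dimensional integrals to converge with a uniform margin.
    The rate [mu] is limited by what the weight can pay: [sqrt (1 + delta) - 1 >= delta / 3] allows
    [mu] of order [delta |t|], which forces [kappa] of order [delta]. The term [1 / r] costs only a
    bounded factor on the ball and yields [mu ^-1 <= r], the source of the power of [r]. Decay in
    [lambda] has two origins. If [|s| >= |t|], oscillation of the kernel gives [|s| ^- (d - 1)]. If
    [|t| > |s|], no oscillation is used: [kappa / mu] is already [O(1 / |t|)]. *)

Section product_integrals.
Context d1 d2 (T1 : measurableType d1) (T2 : measurableType d2) (R : realType).
Variables (m1 : {sigma_finite_measure set T1 -> \bar R}).
Variables (m2 : {sigma_finite_measure set T2 -> \bar R}).

Lemma integrable_prodM (f : T1 -> R) (g : T2 -> R) :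
  m1.-integrable setT (EFin \o f) -> m2.-integrable setT (EFin \o g) ->
  (m1 \x m2)%E.-integrable setT (EFin \o (fun p => f p.1 * g p.2)).
Proof.
move=> fi gi.
have mf : measurable_fun setT f by apply/measurable_EFinP; case/integrableP: fi.
have mg : measurable_fun setT g by apply/measurable_EFinP; case/integrableP: gi.
apply/integrable12ltyP => /=.
  apply/measurable_EFinP/measurable_funM.
    exact: (measurableT_comp mf measurable_fst).
  exact: (measurableT_comp mg measurable_snd).
under eq_integral.
  move=> x _; under eq_integral do rewrite normrM EFinM.
  rewrite ge0_integralZl//; last first.
    by apply/measurable_EFinP; exact: measurableT_comp.
  over.
rewrite ge0_integralZr//=; last 2 first.
  - by apply/measurable_EFinP; exact: measurableT_comp.
  - by apply: integral_ge0.
case/integrableP: fi => _ foo; case/integrableP: gi => _ goo.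
by apply: lte_mul_pinfty => //; rewrite ?integral_ge0// ge0_fin_numE ?integral_ge0.
Qed.

Lemma Rintegral_prodM (f : T1 -> R) (g : T2 -> R) :
  m1.-integrable setT (EFin \o f) -> m2.-integrable setT (EFin \o g) ->
  \int[(m1 \x m2)%E]_p (f p.1 * g p.2) = \int[m1]_x f x * \int[m2]_y g y.
Proof.
move=> fi gi; rewrite /Rintegral.
rewrite -(integral12_prod_meas1 (integrable_prodM fi gi)) /fubini_F /=.
under eq_integral.
  move=> x _; under eq_integral do rewrite EFinM.
  rewrite integralZl//.
  rewrite -[X in (_ * X)%E]fineK; last exact: integrable_fin_num.
  over.
by rewrite integralZr// fineM//; exact: integrable_fin_num.
Qed.

End product_integrals.

(* The library's sigma-finite instance on [m1 \x m2] is hidden by the one for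
   probability measures, hence this alias. *)
Section product_square.
Context d (T : measurableType d) (R : realType).
Variable nu : {finite_measure set T -> \bar R}.

Definition product_square := (nu \x nu)%E.

HB.instance Definition _ := Measure.on product_square.

Let product_square_fin : fin_num_fun product_square.
Proof.
move=> A mA; rewrite ge0_fin_numE ?measure_ge0//.
apply: (@le_lt_trans _ _ (product_square (setT `*` setT))).
  by rewrite le_measure ?inE ?setXTT//; exact: measurableX.
rewrite /product_square product_measure1E// lte_mul_pinfty ?fin_num_measure//.
by rewrite -ge0_fin_numE// fin_num_measure.
Qed.

HB.instance Definition _ :=
  @Measure_isFinite.Build _ _ _ product_square product_square_fin.

End product_square.

Section TTstar.
Context d1 d2 (T1 : measurableType d1) (T2 : measurableType d2) (R : realType).
Variables (m : {sigma_finite_measure set T1 -> \bar R}).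
Variables (nu : {finite_measure set T2 -> \bar R}).
Variables (u v : T1 * T2 -> R) (p : T1 -> R) (q : T2 -> R).
Hypotheses (mu_ : measurable_fun setT u) (mv_ : measurable_fun setT v).
Hypotheses (p0 : forall x, 0 <= p x) (q0 : forall y, 0 <= q y).
Hypotheses (pi : m.-integrable setT (fun x => (p x ^+ 2)%:E))
           (qi : nu.-integrable setT (fun y => (q y)%:E)).
Hypotheses (up : forall x y, `|u (x, y)| <= p x * q y)
           (vp : forall x y, `|v (x, y)| <= p x * q y).

Let G (z : T1 * (T2 * T2)) : R :=
  u (z.1, z.2.1) * u (z.1, z.2.2) + v (z.1, z.2.1) * v (z.1, z.2.2).

Let mG : measurable_fun setT G.
Proof.
have m1 : measurable_fun setT (fun z : T1 * (T2 * T2) => (z.1, z.2.1)).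
  apply: measurable_fun_pair; first exact: measurable_fst.
  exact: (measurableT_comp measurable_fst measurable_snd).
have m2 : measurable_fun setT (fun z : T1 * (T2 * T2) => (z.1, z.2.2)).
  apply: measurable_fun_pair; first exact: measurable_fst.
  exact: (measurableT_comp measurable_snd measurable_snd).
apply: measurable_funD; apply: measurable_funM;
  by [exact: (measurableT_comp mu_ m1)|exact: (measurableT_comp mu_ m2)|
      exact: (measurableT_comp mv_ m1)|exact: (measurableT_comp mv_ m2)].
Qed.

Let Gi : (m \x product_square nu)%E.-integrable setT (EFin \o G).
Proof.
have qqi := integrable_prodM qi qi.
have := @integrable_prodM _ _ _ _ _ m (product_square nu) _ _ pi qqi.
move/(integrableZl measurableT 2); apply: le_integrable => //.
  exact/measurable_EFinP.
move=> [x [y y']] _ /=; rewrite /G /= lee_fin.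
rewrite [leRHS]ger0_norm; last by rewrite !mulr_ge0.
rewrite (le_trans (ler_normD _ _))// !normrM.
have H (w : T1 * T2 -> R) : (forall x y, `|w (x, y)| <= p x * q y) ->
    `|w (x, y)| * `|w (x, y')| <= p x ^+ 2 * (q y * q y').
  move=> wp.
  have -> : p x ^+ 2 * (q y * q y') = (p x * q y) * (p x * q y') by ring.
  by rewrite ler_pM.
have -> : 2 * (p x ^+ 2 * (q y * q y')) =
  p x ^+ 2 * (q y * q y') + p x ^+ 2 * (q y * q y') by ring.
by rewrite lerD// H.
Qed.

Let sec (w : T1 * T2 -> R) : measurable_fun setT w ->
  (forall x y, `|w (x, y)| <= p x * q y) ->
  forall x, nu.-integrable setT (fun y => (w (x, y))%:E).
Proof.
move=> mw wp x; have := integrableZl measurableT (p x) qi.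
apply: le_integrable => //.
  by apply/measurable_EFinP; exact: (measurableT_comp mw (pair1_measurable x)).
by move=> y _; rewrite lee_fin; rewrite (le_trans (wp _ _))// ler_norm.
Qed.

(* Writing [u + i v = F], the left-hand side is the integral of
   [Re (F x y * conj (F x y'))] over [(x, (y, y'))], and [k] bounds the integral
   in [x] alone. *)
Lemma TTstar_le (k : T2 -> T2 -> R) :
  measurable_fun setT (fun z : T2 * T2 => k z.1 z.2) ->
  (forall y y', `|\int[m]_x G (x, (y, y'))| <= k y y') ->
  (\int[m]_x (((\int[nu]_y u (x, y)) ^+ 2 + (\int[nu]_y v (x, y)) ^+ 2)%R)%:E
    <= \int[nu]_y \int[nu]_y' (k y y')%:E)%E.
Proof.
move=> mk Gk.
have -> : (\int[m]_x (((\int[nu]_y u (x, y)) ^+ 2 +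
   (\int[nu]_y v (x, y)) ^+ 2)%R)%:E =
   \int[m]_x \int[product_square nu]_z (G (x, z))%:E)%E.
  apply: eq_integral => x _.
  have su := sec mu_ up x; have sv := sec mv_ vp x.
  have suu := integrable_prodM su su.
  have svv := integrable_prodM sv sv.
  rewrite -[RHS]fineK.
    have := RintegralD measurableT suu svv.
    rewrite {1}/Rintegral => ->.
    by rewrite (Rintegral_prodM su su) (Rintegral_prodM sv sv) !expr2.
  apply: integrable_fin_num => //.
  exact: (integrableD measurableT suu svv).
rewrite (Fubini Gi).
rewrite -(fubini_tonelli1 (fun z : T2 * T2 => (k z.1 z.2)%:E)); last 2 first.
- exact/measurable_EFinP.
- by move=> z; rewrite lee_fin (le_trans _ (Gk z.1 z.2)).
have mE := measurable_fubini_G Gi.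
have mk' : measurable_fun setT (fun z : T2 * T2 => (k z.1 z.2)%:E).
  exact/measurable_EFinP.
apply: (@le_trans _ _ (\int[product_square nu]_z `|\int[m]_x (G (x, z))%:E|)%E).
  exact: (le_trans (lee_abs _) (le_abse_integral _ measurableT mE)).
apply: ae_ge0_le_integral => //.
- exact: measurableT_comp.
- by move=> z _; rewrite lee_fin (le_trans _ (Gk z.1 z.2)).
(* [Gk] bounds a real-valued integral, which is 0 by convention when the extended one is infinite.
   It controls the extended integral where the section of [G] is integrable, that is almost
   everywhere by Fubini. *)
have := ae_integrable2 Gi; apply: filterS => -[y y'] iG _ /=.
rewrite -[X in `|X|%E]fineK ?lee_fin; last exact: integrable_fin_num.
exact: Gk.
Qed.

End TTstar.

(** * Complex-valued integrals and Lebesgue measure on row vectors *)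

Section complex_integral.
Context d (T : measurableType d) (R : realType).
Implicit Types (mu : {measure set T -> \bar R}) (f : T -> R[i]).

Definition cintegrable mu f :=
  mu.-integrable setT (fun x => (complex.Re (f x))%:E) /\
  mu.-integrable setT (fun x => (complex.Im (f x))%:E).

End complex_integral.

Lemma ReM (R : rcfType) (x y : R[i]) : complex.Re (x * y) =
  complex.Re x * complex.Re y - complex.Im x * complex.Im y.
Proof. by case: x y => [? ?] [? ?]. Qed.

Lemma ImM (R : rcfType) (x y : R[i]) : complex.Im (x * y) =
  complex.Re x * complex.Im y + complex.Im x * complex.Re y.
Proof. by case: x y => [? ?] [? ?]. Qed.

Section complex_product.
Context d1 d2 (T1 : measurableType d1) (T2 : measurableType d2) (R : realType).
Variables (m1 : {sigma_finite_measure set T1 -> \bar R}).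
Variables (m2 : {sigma_finite_measure set T2 -> \bar R}).
Variables (f : T1 -> R[i]) (g : T2 -> R[i]).
Hypotheses (fi : cintegrable m1 f) (gi : cintegrable m2 g).

Lemma cintegrable_prodM :
  cintegrable (m1 \x m2)%E (fun p => f p.1 * g p.2).
Proof.
case: fi gi => fr fm [gr gm]; split.
  under eq_fun do rewrite ReM.
  exact: (integrableB measurableT (integrable_prodM fr gr)
    (integrable_prodM fm gm)).
under eq_fun do rewrite ImM.
exact: (integrableD measurableT (integrable_prodM fr gm)
  (integrable_prodM fm gr)).
Qed.

Lemma cintegral_prodM :
  cintegral (m1 \x m2)%E setT (fun p => f p.1 * g p.2) =
  cintegral m1 setT f * cintegral m2 setT g.
Proof.
case: fi gi => fr fm [gr gm]; apply/eqP; rewrite eq_complex ReM ImM.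
apply/andP; split; apply/eqP.
  transitivity (\int[(m1 \x m2)%E]_p (complex.Re (f p.1) * complex.Re (g p.2) -
      complex.Im (f p.1) * complex.Im (g p.2))).
    by apply: eq_Rintegral => p _; rewrite ReM.
  by rewrite (RintegralB measurableT (integrable_prodM fr gr)
    (integrable_prodM fm gm)) (Rintegral_prodM fr gr) (Rintegral_prodM fm gm).
transitivity (\int[(m1 \x m2)%E]_p (complex.Re (f p.1) * complex.Im (g p.2) +
    complex.Im (f p.1) * complex.Re (g p.2))).
  by apply: eq_Rintegral => p _; rewrite ImM.
by rewrite (RintegralD measurableT (integrable_prodM fr gm)
  (integrable_prodM fm gr)) (Rintegral_prodM fr gm) (Rintegral_prodM fm gr).
Qed.

End complex_product.

Section image_measure.
Context d1 d2 (T1 : measurableType d1) (T2 : measurableType d2) (R : realType).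
Variables (phi : T1 -> T2) (mphi : measurable_fun setT phi).
Variables (m : {measure set T1 -> \bar R}) (m' : {measure set T2 -> \bar R}).
Hypothesis m'E : forall A, measurable A -> m' A = m (phi @^-1` A).

Let eqI (f : T2 -> \bar R) :
  (\int[m']_y f y = \int[pushforward m phi]_y f y)%E.
Proof. by apply: eq_measure_integral => A mA _; rewrite /= m'E. Qed.

Lemma image_integrable (f : T2 -> \bar R) : measurable_fun setT f ->
  m.-integrable setT (f \o phi) -> m'.-integrable setT f.
Proof.
move=> mf fi; have /integrableP[_ foo] := integrable_pushforward mphi mf fi measurableT.
by apply/integrableP; split; rewrite ?eqI.
Qed.

Lemma image_integral (f : T2 -> \bar R) : measurable_fun setT f ->
  m.-integrable setT (f \o phi) -> (\int[m']_y f y = \int[m]_x f (phi x))%E.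
Proof. by move=> mf fi; rewrite eqI integral_pushforward. Qed.

Lemma image_cintegral (f : T2 -> R[i]) :
  cmeasurable_fun setT f -> cintegrable m (f \o phi) ->
  cintegrable m' f /\ cintegral m' setT f = cintegral m setT (f \o phi).
Proof.
move=> [mr mi] [ir ii].
have mr' : measurable_fun setT (fun x => (complex.Re (f x))%:E).
  exact/measurable_EFinP.
have mi' : measurable_fun setT (fun x => (complex.Im (f x))%:E).
  exact/measurable_EFinP.
split; first by split; exact: image_integrable.
by rewrite /cintegral /Rintegral !image_integral.
Qed.

End image_measure.

Section complex_measurable.
Context d (T : measurableType d) (R : realType).
Implicit Types (f g : T -> R[i]) (D : set T).

Lemma cmeasurable_funM D f g : cmeasurable_fun D f -> cmeasurable_fun D g ->
  cmeasurable_fun D (fun x => f x * g x).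
Proof.
move=> [fr fi] [gr gi]; split.
  under eq_fun do rewrite ReM.
  by apply: measurable_funB; exact: measurable_funM.
under eq_fun do rewrite ImM.
by apply: measurable_funD; exact: measurable_funM.
Qed.

Lemma cmeasurable_prod D (I : Type) (s : seq I) (f : I -> T -> R[i]) :
  (forall i, cmeasurable_fun D (f i)) ->
  cmeasurable_fun D (fun x => \prod_(i <- s) f i x).
Proof.
move=> mf; elim: s => [|i s ih].
  by under eq_fun do rewrite big_nil; split; exact: measurable_cst.
by under eq_fun do rewrite big_cons; exact: cmeasurable_funM.
Qed.

Lemma cmeasurable_comp d' (T' : measurableType d') (h : T' -> T) f :
  measurable_fun setT h -> cmeasurable_fun setT f ->
  cmeasurable_fun setT (fun x => f (h x)).
Proof.
move=> mh [fr fi]; split.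
  exact: (measurableT_comp fr mh).
exact: (measurableT_comp fi mh).
Qed.

Lemma cintegrable_cmeasurable (mu : {measure set T -> \bar R}) f :
  cintegrable mu f -> cmeasurable_fun setT f.
Proof.
by move=> [/measurable_int/measurable_EFinP ? /measurable_int/measurable_EFinP].
Qed.

End complex_measurable.

Section lebesgue_product.
Variable R : realType.

(** Induction on [n]: [lebesgue_rV n.+1] is the image of a product measure under [rV_cons], and
    [cintegral_prodM] splits off the first coordinate. This is what reduces the kernel to integrals
    over the line. *)
Lemma lebesgue_rV_prod n (f : 'I_n -> R -> R[i]) :
  (forall i, cintegrable (@lebesgue_measure R) (f i)) ->
  let F (x : 'rV[R]_n) := \prod_i f i (x ord0 i) in
  cintegrable (lebesgue_rV n) F /\
  cintegral (lebesgue_rV n) setT F =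
    \prod_i cintegral (@lebesgue_measure R) setT (f i).
Proof.
elim: n f => [|n ih] f fi F.
  have FE : F = cst 1 by apply/funext => x; rewrite /F big_ord0.
  rewrite FE big_ord0; split.
    by split; apply/integrableP; split => //=;
      rewrite integral_dirac//= ?abse1 ?normr0 ?diracT ?mule0 ?mul1e ?mule1 ltry.
  by rewrite /cintegral /Rintegral /= !integral_dirac//= indicE in_setT mul1r mulr0.
have mF : cmeasurable_fun setT F.
  apply: cmeasurable_prod => i; apply: (cmeasurable_comp (measurable_coord i)).
  exact: cintegrable_cmeasurable (fi i).
have [gi gE] := ih (fun i => f (lift ord0 i)) (fun i => fi (lift ord0 i)).
set g := (fun x => _) in gi gE.
have FE : F \o @rV_cons R n = (fun p => f ord0 p.1 * g p.2).
  apply/funext => p; rewrite /F /= big_ord_recl rV_consE unlift_none.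
  by congr (_ * _); apply: eq_bigr => i _; rewrite rV_consE liftK.
have := cintegrable_prodM (fi ord0) gi.
rewrite -FE => ci.
have [ci' cE] := image_cintegral (@measurable_rV_cons R n)
  (m' := lebesgue_rV n.+1) (fun _ _ => erefl) mF ci.
split; first exact: ci'.
by rewrite [LHS]cE FE big_ord_recl -gE -cintegral_prodM.
Qed.

Lemma lebesgue_rV_box n (c : 'rV[R]_n) (h : R) : 0 <= h ->
  lebesgue_rV n [set x | forall i, `|x ord0 i - c ord0 i| <= h] =
  ((2 * h) ^+ n)%:E.
Proof.
elim: n c => [|n ih] c h0.
  rewrite [X in lebesgue_rV 0 X](_ : _ = setT) ?expr0 /=; first by rewrite diracT.
  by apply/seteqP; split => // x _ [].
change ((lebesgue_measure \x lebesgue_rV n)%E (@rV_cons R n @^-1`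
  [set x | forall i, `|x ord0 i - c ord0 i| <= h]) = ((2 * h) ^+ n.+1)%:E).
rewrite [X in (_ \x _)%E X](_ : _ = `[c ord0 ord0 - h, c ord0 ord0 + h]%classic `*`
  [set x : 'rV[R]_n | forall i, `|x ord0 i -
     (\row_(i < n) c ord0 (lift ord0 i)) ord0 i| <= h]).
  rewrite product_measure1E//; last first.
    rewrite (_ : [set x : 'rV[R]_n | _] = \bigcap_(i in [set: 'I_n])
      ((fun x : 'rV[R]_n => x ord0 i) @^-1`
        `[c ord0 (lift ord0 i) - h, c ord0 (lift ord0 i) + h]%classic)).
      apply: fin_bigcap_measurable => // i _.
      rewrite -[X in measurable X]setTI; exact: measurable_coord.
    apply/seteqP; split => x /=.
      by move=> H i _; have := H i; rewrite mxE /= in_itv/= ler_distl.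
    by move=> H i; have := H i I; rewrite mxE /= in_itv/= ler_distl.
  rewrite ih// exprS EFinM; congr (_ * _)%E.
  rewrite [LHS]lebesgue_measure_itv/= lte_fin.
  have [hh|hh] := ltP; first by rewrite -EFinD; congr EFin; ring.
  by rewrite (_ : h = 0) ?mulr0 //; lra.
apply/seteqP; split => [p|p [p1 p2]] /=.
  move=> H; split => [|i].
    by have := H ord0; rewrite rV_consE unlift_none in_itv/= ler_distl.
  by have := H (lift ord0 i); rewrite rV_consE liftK mxE.
move=> i; rewrite rV_consE; case: unliftP => [j ->|->].
  by have := p2 j; rewrite mxE.
by move: p1; rewrite /= in_itv/= ler_distl.
Qed.

End lebesgue_product.

(** * Euclidean geometry and surface measure *)

Section euclidean_facts.
Variables (R : realType) (d : nat).
Implicit Types x y : 'rV[R]_d.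

Lemma dotv_ge0 x : 0 <= dotv x x.
Proof. by apply: sumr_ge0 => i _; rewrite -expr2 sqr_ge0. Qed.

Lemma enorm_ge0 x : 0 <= enorm x.
Proof. exact: sqrtr_ge0. Qed.

Lemma abs_coord_le_enorm x i : `|x ord0 i| <= enorm x.
Proof.
rewrite -sqrtr_sqr ler_sqrt ?dotv_ge0// /dotv (bigD1 i)//= expr2 lerDl.
by apply: sumr_ge0 => j _; rewrite -expr2 sqr_ge0.
Qed.

Lemma dotvZ a x : dotv (a *: x) (a *: x) = a ^+ 2 * dotv x x.
Proof.
by rewrite /dotv mulr_sumr; apply: eq_bigr => i _; rewrite !mxE; ring.
Qed.

Lemma enormZ a x : enorm (a *: x) = `|a| * enorm x.
Proof. by rewrite /enorm dotvZ sqrtrM ?sqr_ge0// sqrtr_sqr. Qed.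

Lemma enorm_eq0 x : (enorm x == 0) = (x == 0).
Proof.
apply/eqP/eqP => [x0|->]; last first.
  by rewrite /enorm /dotv big1 ?sqrtr0// => i _; rewrite mxE mulr0.
apply/rowP => i; rewrite mxE; apply/eqP.
by rewrite -normr_eq0 eq_le normr_ge0 andbT -x0 abs_coord_le_enorm.
Qed.

Lemma dotv_sphere x : sphere d x -> dotv x x = 1.
Proof. by move=> xS; rewrite -[LHS]sqr_sqrtr ?dotv_ge0// -/(enorm x) xS expr1n. Qed.

Lemma sphere_neq0 x : sphere d x -> x != 0.
Proof. by rewrite -enorm_eq0 /sphere/= => ->; rewrite oner_eq0. Qed.

Lemma normalize_sphere x : x != 0 -> sphere d (normalize x).
Proof.
move=> x0; rewrite /sphere/= /normalize enormZ ger0_norm ?invr_ge0 ?enorm_ge0//.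
by rewrite mulVf// enorm_eq0.
Qed.

Lemma sphere_normalize_neq0 x : sphere d (normalize x) -> x != 0.
Proof.
by apply: contraPneq => ->; rewrite /normalize scaler0 => /sphere_neq0/eqP.
Qed.

Lemma normalizeK x : x != 0 -> x = enorm x *: normalize x.
Proof. by move=> x0; rewrite scalerA divff ?scale1r// enorm_eq0. Qed.

Lemma normalize_id x : sphere d x -> normalize x = x.
Proof. by rewrite /normalize => ->; rewrite invr1 scale1r. Qed.

Definition cube (c : 'rV[R]_d) (h : R) : set 'rV[R]_d :=
  [set x | forall i, `|x ord0 i - c ord0 i| <= h].

Lemma measurable_coord_set i (A : set R) : measurable A ->
  measurable [set x : 'rV[R]_d | A (x ord0 i)].
Proof.
by move=> mA; rewrite -[X in measurable X]setTI; exact: measurable_coord.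
Qed.

Lemma measurable_cube c h : measurable (cube c h).
Proof.
rewrite (_ : cube _ _ = \bigcap_(i in [set: 'I_d])
  [set x : 'rV[R]_d | `[c ord0 i - h, c ord0 i + h]%classic (x ord0 i)]).
  by apply: fin_bigcap_measurable => // i _; exact: measurable_coord_set.
apply/seteqP; split => x /=.
  by move=> H i _ /=; rewrite in_itv/= -ler_distl.
by move=> H i; have := H i I; rewrite /= in_itv/= -ler_distl.
Qed.

End euclidean_facts.

Section surface_measure.
Variable R : realType.

Lemma lebesgue_eball n : (lebesgue_rV n (eball (1 : R)) <= (2 ^+ n)%:E)%E.
Proof.
have := lebesgue_rV_box (0 : 'rV[R]_n) (ler01 : 0 <= (1 : R)).
rewrite mulr1 => <-.
apply: le_measure; rewrite ?inE; [exact: measurable_eball|exact: measurable_cube|].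
move=> x /= x1 i; rewrite mxE subr0.
by rewrite (le_trans (abs_coord_le_enorm _ _))// ltW.
Qed.

Let surface_fin n : fin_num_fun (@surface R n).
Proof.
move=> A mA; rewrite fin_numM// ge0_fin_numE//.
apply: le_lt_trans (ltry (2 ^+ n)); apply: le_trans (lebesgue_eball n).
apply: le_measure => //; rewrite inE; last exact: measurable_eball.
apply: measurableI; last exact: measurable_eball.
by rewrite -[X in measurable X]setTI; exact: measurable_normalize.
Qed.

HB.instance Definition _ n :=
  @Measure_isFinite.Build _ _ _ (@surface R n) (@surface_fin n).

(* The cone over a piece of the sphere of diameter [h] is a thin tube around a
   segment, covered by about [1/h] cubes of side [6h]. *)
Lemma surface_cube n : exists2 C : R, 0 < C & forall (c : 'rV[R]_n.+1) (h : R),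
  0 < h -> (surface n.+1 (sphere n.+1 `&` cube c h) <= (C * h ^+ n)%:E)%E.
Proof.
exists (n.+1%:R * (2 * 6 ^+ n.+1)) => [|c h h0]; first by rewrite !mulr_gt0.
have mS : measurable (sphere n.+1 `&` cube c h).
  by apply: measurableI; [exact: measurable_sphere|exact: measurable_cube].
rewrite /surface -mulrA EFinM lee_pmul2l//.
set T := _ `&` eball 1.
have mT : measurable T.
  apply: measurableI; last exact: measurable_eball.
  by rewrite -[X in measurable X]setTI; exact: measurable_normalize.
(* For [h > 1] the volume of the unit ball suffices, since [h ^+ n >= 1]. In the other case [h <= 1]
   keeps the number [K] of cubes below [2 / h]. *)
have [h1|h1] := ltP 1 h.
  apply: (@le_trans _ _ (2 ^+ n.+1)%:E).
    apply: le_trans (lebesgue_eball n.+1); apply: le_measure => //; rewrite ?inE//.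
    exact: measurable_eball.
    by move=> x [].
  rewrite lee_fin.
  have a1 : (2 ^+ n.+1 : R) <= 6 ^+ n.+1 by apply: lerXn2r; rewrite ?nnegrE ?ler_nat.
  have a2 : 1 <= h ^+ n by rewrite exprn_ege1// ltW.
  have a3 : (0 : R) <= 6 ^+ n.+1 by [].
  nra.
(* The direction of any point of the cone can serve as the axis of the tube. *)
have [T0|/set0P[e [[es ec] _]]] := eqVneq T set0.
  by rewrite T0 measure0 lee_fin !mulr_ge0// exprn_ge0// ltW.
move: es ec; set eta := normalize e => es ec.
set K := (Num.truncn h^-1).+1.
have hV : 1 <= h^-1 by rewrite invf_ge1.
have TK : T `<=` \big[setU/set0]_(m < K) cube ((m%:R * h) *: eta) (3 * h).
  move=> y [[ys yc] y1']; have y1 : enorm y < 1 := y1'.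
  have y0 := sphere_normalize_neq0 ys.
  set m := Num.truncn (enorm y / h).
  have mK : (m < K)%N.
    rewrite ltnS le_truncn// -[leRHS]mul1r ler_pM2r ?invr_gt0//; exact: ltW.
  rewrite -bigcup_mkord_ord; exists m => // i.
  rewrite {1}(normalizeK y0) (mxE _ _ ord0 i) [X in _ - X]mxE.
  rewrite inordK//.
  have e1 : `|eta ord0 i| <= 1.
    by have := abs_coord_le_enorm eta i; rewrite es.
  have yc' := yc i; have ec' := ec i.
  have /truncn_itv : 0 <= enorm y / h by rewrite divr_ge0 ?enorm_ge0// ltW.
  rewrite -/m ler_pdivlMr// ltr_pdivrMr// => /andP[m1 m2].
  rewrite -natr1 mulrDl mul1r in m2.
  have := enorm_ge0 y.
  move: (enorm y) (m%:R * h) y1 m1 m2 => rho mh y1 m1 m2 rho0.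
  move: yc' ec' e1; move: (normalize y ord0 i) (normalize e ord0 i) => a b.
  move: (c ord0 i) => cc yc' ec' e1.
  (* The directions differ by at most [2h] per coordinate and [rho < 1], while the radii differ by
     at most [h]: together [3h]. *)
  have -> : rho * a - mh * b = rho * ((a - cc) - (b - cc)) + (rho - mh) * b by ring.
  rewrite (le_trans (ler_normD _ _))// !normrM (ger0_norm rho0).
  have := ler_normB (a - cc) (b - cc).
  rewrite (ger0_norm (_ : 0 <= rho - mh)) ?subr_ge0//.
  have := normr_ge0 b; have := normr_ge0 (a - cc - (b - cc)).
  move: e1; move: (`|b|) (`|a - cc - (b - cc)|) => B A e1 A0 B0 AB.
  have : rho * A <= A by rewrite ler_piMl// ltW.
  have : (rho - mh) * B <= h.
    by rewrite (le_trans (ler_piMr _ e1))//; lra.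
  lra.
apply: (@le_trans _ _ (\sum_(m < K) lebesgue_rV n.+1 (cube ((m%:R * h) *: eta) (3 * h)))%E).
  apply: (@content_subadditive _ _ _ (lebesgue_rV n.+1) T
    (fun m => cube ((m%:R * h) *: eta) (3 * h))) => // m _.
  exact: measurable_cube.
rewrite (eq_bigr (fun=> ((2 * (3 * h)) ^+ n.+1)%:E)); last first.
  by move=> m _; rewrite [LHS]lebesgue_rV_box// mulr_ge0// ltW.
rewrite sumEFin lee_fin sumr_const card_ord -[leLHS]mulr_natl.
have -> : (2 * (3 * h)) ^+ n.+1 = 6 ^+ n.+1 * h ^+ n * h.
  by rewrite -mulrA -exprSr -exprMn mulrA -natrM.
have : K%:R * h <= 2.
  rewrite /K -natr1 mulrDl mul1r.
  have : (Num.truncn h^-1)%:R * h <= 1.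
    by rewrite -ler_pdivlMr// mul1r truncn_le invr_ge0 ltW.
  lra.
have : 0 <= 6 ^+ n.+1 * h ^+ n by rewrite mulr_ge0// exprn_ge0// ltW.
by move=> ? ?; nra.
Qed.

End surface_measure.

(** * Poisson kernels on the sphere *)

Section poisson_kernel.
Variable R : realType.

(** The Fourier transform of [exp (- mu |t|)] at frequency [s u] has 2 in place of 8. The extra
    factor 4 absorbs the tilt in [line_exp], where the two decay rates are only known to be at least
    [mu / 2]. *)
Definition poisson (mu s u : R) : R := 8 * mu / (mu ^+ 2 + (s * u) ^+ 2).

Lemma poisson_ge0 mu s u : 0 < mu -> 0 <= poisson mu s u.
Proof.
by move=> m0; rewrite divr_ge0 ?mulr_ge0 ?addr_ge0 ?sqr_ge0// ltW.
Qed.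

Lemma poisson_le mu s u : 0 < mu -> poisson mu s u <= 8 / mu.
Proof.
move=> m0; have s0 := sqr_ge0 (s * u).
rewrite /poisson ler_pdivrMr; last by rewrite ltr_pwDl// exprn_gt0.
rewrite -mulrA ler_pM2l// mulrDr expr2 mulKf ?gt_eqF// lerDl.
by rewrite mulr_ge0// invr_ge0 ltW.
Qed.

Lemma poissonN mu s u : poisson mu s (- u) = poisson mu s u.
Proof. by rewrite /poisson mulrN sqrrN. Qed.

Lemma poisson_le_cell mu s u (q : nat) : 0 < mu -> 0 < s ->
  q%:R * (mu / s) <= `|u| -> poisson mu s u <= 8 / mu * (1 + q%:R ^+ 2)^-1.
Proof.
move=> m0 s0 qu; rewrite /poisson.
have -> : 8 * mu / (mu ^+ 2 + (s * u) ^+ 2) =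
  8 / mu * (1 + (s / mu * u) ^+ 2)^-1.
  rewrite -mulrA -[in RHS]mulrA; congr (8 * _).
  have ? : mu ^+ 2 + (s * u) ^+ 2 != 0.
    by rewrite gt_eqF// ltr_pwDl ?exprn_gt0// sqr_ge0.
  have ? : 1 + (s / mu * u) ^+ 2 != 0.
    by rewrite gt_eqF// ltr_pwDl ?sqr_ge0.
  by field; rewrite !gt_eqF ?ltr_pwDl ?exprn_gt0 ?sqr_ge0.
rewrite ler_pM2l ?divr_gt0//.
rewrite lef_pV2 ?posrE ?ltr_pwDl ?sqr_ge0// lerD2l.
rewrite -[leRHS]real_normK ?num_real// lerXn2r ?nnegrE//.
rewrite normrM gtr0_norm ?divr_gt0//.
by rewrite mulrC -invf_div ler_pdivlMr ?divr_gt0.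
Qed.

(** Telescoping: [1 / (1 + q ^ 2) <= 4 (1 / (q + 1) - 1 / (q + 2))], because [4 (1 + q ^ 2) - (q +
    1) (q + 2) = 3 q ^ 2 - 3 q + 2] is positive. *)
Lemma sum_inv_sqr (K : nat) : \sum_(q < K) (1 + q%:R ^+ 2)^-1 <= 4 :> R.
Proof.
suff : \sum_(q < K) (1 + q%:R ^+ 2)^-1 <= 4 * (1 - K.+1%:R^-1) :> R.
  by move/le_trans; apply; rewrite ler_piMr// gerBl.
elim: K => [|K ih]; first by rewrite big_ord0 invr1 subrr mulr0.
rewrite big_ord_recr/=; apply: le_trans (lerD ih (lexx _)) _.
have K0 : (0 : R) <= K%:R by [].
rewrite -[in K.+2%:R]natr1 -[in K.+1%:R]natr1; move: (K%:R) K0 => x x0.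
rewrite -subr_ge0.
have -> : 4 * (1 - (x + 1 + 1)^-1) - (4 * (1 - (x + 1)^-1) + (1 + x ^+ 2)^-1) =
  (3 * x ^+ 2 - 3 * x + 2) / ((x + 1 + 1) * (x + 1) * (1 + x ^+ 2)).
  by field; rewrite !gt_eqF//; nra.
by rewrite divr_ge0//; [nra|rewrite !mulr_ge0//; nra].
Qed.

Variable n : nat.
Local Notation V := 'rV[R]_n.+1.
Local Notation S := (sphere n.+1).

Definition prod_poisson mu s (x y : V) :=
  \prod_i poisson mu s (x ord0 i - y ord0 i).

Lemma prod_poisson_ge0 mu s x y : 0 < mu -> 0 <= prod_poisson mu s x y.
Proof. by move=> m0; apply: prodr_ge0 => i _; exact: poisson_ge0. Qed.

Lemma prod_poissonC mu s x y : prod_poisson mu s x y = prod_poisson mu s y x.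
Proof. by apply: eq_bigr => i _; rewrite -poissonN opprB. Qed.

Lemma measurable_poisson mu s : measurable_fun setT (poisson mu s).
Proof.
have -> : poisson mu s = fun u => 8 * mu * (mu ^+ 2 + (s * u) ^+ 2) `^ (-1).
  by apply/funext => u; rewrite powR_inv1// addr_ge0 ?sqr_ge0.
apply: measurable_funM => //.
apply: (measurableT_comp (f := @powR R ^~ (-1))); first exact: measurable_powR.
by apply: measurable_funD => //; apply: measurable_funX; exact: measurable_funM.
Qed.

Lemma measurable_prod_poisson mu s :
  measurable_fun setT (fun z : V * V => prod_poisson mu s z.1 z.2).
Proof.
apply: measurable_prod => i _; apply: measurableT_comp.
  exact: measurable_poisson.
by apply: measurable_funB; apply: (measurableT_comp (measurable_coord i)).
Qed.

(** Every factor of the kernel is replaced by its maximum [8 / mu], and [surface_cube] measures the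
    cell. For [xi] in a cell of size below [mu / |s|] this loses only a constant. *)
Lemma schur_near : exists2 C : R, 0 < C & forall (mu s k : R) (c xi : V)
    (D : set V), measurable D -> 0 < mu -> 0 < k -> D `<=` S `&` cube c k ->
  (\int[surface n.+1]_(y in D) (prod_poisson mu s xi y)%:E <=
    (C * (k ^+ n / mu ^+ n.+1))%:E)%E.
Proof.
have [C C0 HC] := @surface_cube R n.
exists (8 ^+ n.+1 * C) => [|mu s k c xi D mD m0 k0 DS]; first by rewrite mulr_gt0.
apply: (@le_trans _ _ (\int[surface n.+1]_(y in D) ((8 / mu) ^+ n.+1)%:E)%E).
  apply: ge0_le_integral => //.
  - by move=> y _; rewrite lee_fin prod_poisson_ge0.
  - apply/measurable_EFinP; apply: measurable_funTS.
    exact: (measurableT_comp (measurable_prod_poisson mu s) (pair1_measurable xi)).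
  move=> y _; rewrite lee_fin -[X in _ ^+ X]card_ord -prodr_const.
  by apply: ler_prod => i _; rewrite poisson_ge0// poisson_le.
rewrite integral_cst//.
apply: (@le_trans _ _ (((8 / mu) ^+ n.+1)%:E * (C * k ^+ n)%:E)%E).
  rewrite lee_pmul2l// ?lte_fin ?exprn_gt0 ?divr_gt0//.
  apply: (le_trans _ (HC c _ k0)); apply: le_measure; rewrite ?inE//.
  by apply: measurableI; [exact: measurable_sphere|exact: measurable_cube].
rewrite -EFinM lee_fin expr_div_n.
by rewrite le_eqVlt; apply/orP; left; apply/eqP; ring.
Qed.

(* Lattice cubes of side [mu / s]: each carries surface measure
   [O((mu / s) ^+ n)], and the kernel is summable over the lattice. *)
Lemma schur_far : exists2 C : R, 0 < C & forall (mu s : R) (xi : V)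
    (D : set V), measurable D -> 0 < mu -> 0 < s -> D `<=` S -> S xi ->
  (\int[surface n.+1]_(y in D) (prod_poisson mu s xi y)%:E <=
    (C * (s ^- n / mu))%:E)%E.
Proof.
have [C C0 HC] := @surface_cube R n.
exists (64 ^+ n.+1 * C) => [|mu s xi D mD m0 s0 DS Sxi]; first by rewrite mulr_gt0.
set h := mu / s; have h0 : 0 < h by rewrite divr_gt0.
(* Coordinates on the sphere lie in [[-1, 1]], so differences are at most 2 and their integer parts
   in units of [h] are below [K]. The boolean in the index of [w] records the sign of the
   difference. *)
set K := (Num.truncn (2 / h)).+1.
pose w (j : bool * 'I_K) : R := 8 / mu * (1 + (j.2 : nat)%:R ^+ 2)^-1.
have w0 j : 0 <= w j.
  by rewrite mulr_ge0 ?invr_ge0 ?addr_ge0 ?sqr_ge0 ?divr_ge0// ltW.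
pose J := {ffun 'I_n.+1 -> bool * 'I_K}.
pose ctr (f : J) : V := \row_i (xi ord0 i +
  (if (f i).1 then - 1 else 1) * ((f i).2 : nat)%:R * h).
pose A (f : J) : set V := S `&` cube (ctr f) h.
have mA f : measurable (A f).
  by apply: measurableI; [exact: measurable_sphere|exact: measurable_cube].
apply: (@le_trans _ _ (\int[surface n.+1]_(y in D)
    (\sum_(f : J) (\prod_i w (f i) * \1_(A f) y))%:E)%E).
  apply: ge0_le_integral => //.
  - by move=> y _; rewrite lee_fin prod_poisson_ge0.
  - apply/measurable_EFinP; apply: measurable_funTS.
    exact: (measurableT_comp (measurable_prod_poisson mu s) (pair1_measurable xi)).
  - apply/measurable_EFinP; apply: measurable_funTS.
    apply: measurable_sum => f; apply: measurable_funM => //.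
  move=> y Dy; rewrite lee_fin.
  pose f : J := [ffun i => (0 <= xi ord0 i - y ord0 i,
    inord (Num.truncn (`|xi ord0 i - y ord0 i| / h)))].
  have fE i : ((f i).2 : nat) = Num.truncn (`|xi ord0 i - y ord0 i| / h).
    rewrite ffunE/= inordK// ltnS le_truncn// ler_pM2r ?invr_gt0//.
    have := ler_normB (xi ord0 i) (y ord0 i).
    have := abs_coord_le_enorm xi i; have := abs_coord_le_enorm y i.
    have -> : enorm xi = 1 by []; have -> : enorm y = 1 by exact: DS.
    lra.
  have fI i : ((f i).2 : nat)%:R * h <= `|xi ord0 i - y ord0 i| <=
      ((f i).2 : nat)%:R * h + h.
    have /truncn_itv : 0 <= `|xi ord0 i - y ord0 i| / h by rewrite divr_ge0// ltW.
    rewrite -fE ler_pdivlMr// ltr_pdivrMr// -natr1 mulrDl mul1r.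
    by move=> /andP[-> /ltW].
  rewrite (bigD1 f)//=; apply: ler_wpDr.
    by apply: sumr_ge0 => g _; rewrite mulr_ge0// prodr_ge0.
  have Afy : A f y.
    split; first exact: DS.
    move=> i; rewrite mxE; have := fI i.
    have -> : (f i).1 = (0 <= xi ord0 i - y ord0 i) by rewrite ffunE.
    rewrite -mulrA; move: (((f i).2 : nat)%:R * h) => q.
    have [z0|z0] := leP 0 (xi ord0 i - y ord0 i).
      rewrite (ger0_norm z0) => /andP[q1 q2].
      by rewrite ler_norml; apply/andP; split; lra.
    rewrite (ltr0_norm z0) => /andP[q1 q2].
    by rewrite ler_norml; apply/andP; split; lra.
  rewrite indicE mem_set// mulr1.
  apply: ler_prod => i _; rewrite poisson_ge0//=.
  by apply: poisson_le_cell => //; case/andP: (fI i).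
under eq_integral do rewrite -sumEFin.
rewrite ge0_integral_sum//; last 2 first.
- move=> f; apply/measurable_EFinP; apply: measurable_funTS.
  by apply: measurable_funM.
- by move=> f y _; rewrite lee_fin mulr_ge0// prodr_ge0.
apply: (@le_trans _ _ (\sum_(f : J) (\prod_i w (f i) * (C * h ^+ n))%:E)%E).
  apply: lee_sum => f _.
  under eq_integral do rewrite EFinM.
  rewrite ge0_integralZl_EFin//; last 2 first.
  - by apply/measurable_EFinP; apply: measurable_funTS.
  - exact: prodr_ge0.
  rewrite EFinM; apply: lee_pmul => //.
  - by rewrite lee_fin prodr_ge0.
  - exact: integral_ge0.
  rewrite integral_indic//; apply: (le_trans _ (HC (ctr f) _ h0)).
  by apply: le_measure; rewrite ?inE; [exact: measurableI|exact: mA|move=> y []].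
(* The sum over the lattice is a product of one-dimensional sums, each at most [64 / mu]: 8 from the
   height of the kernel, 2 from the signs, 4 from [sum_inv_sqr]. *)
rewrite sumEFin lee_fin -mulr_suml -(bigA_distr_bigA (fun _ : 'I_n.+1 => w)).
rewrite prodr_const card_ord.
have -> : \sum_j w j = 8 / mu * (2 * \sum_(q < K) (1 + q%:R ^+ 2)^-1).
  rewrite (eq_bigr (fun j => (fun (b : bool) (q : 'I_K) => w (b, q)) j.1 j.2)).
    rewrite -(pair_bigA _ (fun (b : bool) (q : 'I_K) => w (b, q)))/= big_bool/=.
    by rewrite -mulr_sumr; ring.
  by case.
have Sg0 : 0 <= \sum_(q < K) (1 + q%:R ^+ 2)^-1 :> R.
  by apply: sumr_ge0 => q _; rewrite invr_ge0 addr_ge0 ?sqr_ge0.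
rewrite (@le_trans _ _ ((8 / mu * 8) ^+ n.+1 * (C * h ^+ n)))//.
  have d0 : 0 < 8 / mu by rewrite divr_gt0.
  rewrite ler_pM2r ?mulr_gt0 ?exprn_gt0//.
  apply: lerXn2r; rewrite ?nnegrE.
  - by apply: mulr_ge0; [exact: ltW|exact: mulr_ge0].
  - by apply: mulr_ge0; [exact: ltW|].
  by rewrite ler_pM2l//; have := sum_inv_sqr K; lra.
rewrite le_eqVlt; apply/orP; left; apply/eqP.
have -> : 8 / mu * 8 = 64 / mu by rewrite mulrAC -natrM.
have mu0 : mu != 0 by rewrite gt_eqF.
rewrite /h !expr_div_n !exprS.
by field; rewrite mu0 !expf_neq0// gt_eqF.
Qed.


End poisson_kernel.

(** * Fourier transform of a tilted two-sided exponential *)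

Section oscillating_exponential.
Variable R : realType.
Implicit Types (k t u a b : R).

Let is_derive_lin k t : is_derive t 1 (fun x : R => k * x) k.
Proof.
have h := is_deriveZ k (is_derive_id t (1 : R)).
by apply: (is_derive_eq h); rewrite [LHS]mulr1.
Qed.

Let is_derive_expM k t :
  is_derive t 1 (fun x : R => expR (k * x)) (k * expR (k * t)).
Proof.
have h := is_derive1_comp (is_derive_expR (k * t)) (is_derive_lin k t).
by apply: (is_derive_eq h); rewrite mulrC.
Qed.

Let is_derive_cosM k t :
  is_derive t 1 (fun x : R => cos (k * x)) (- k * sin (k * t)).
Proof.
have h := is_derive1_comp (is_derive_cos (k * t)) (is_derive_lin k t).
by apply: (is_derive_eq h); ring.
Qed.

Let is_derive_sinM k t :
  is_derive t 1 (fun x : R => sin (k * x)) (k * cos (k * t)).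
Proof.
have h := is_derive1_comp (is_derive_sin (k * t)) (is_derive_lin k t).
by apply: (is_derive_eq h); ring.
Qed.

(** For [|a| + |b| <= 1] this is nonnegative, so the fundamental theorem of calculus on a half-line
    gives integrability and value at once. Cosine and sine integrals are then differences of two
    such integrals. *)
Definition wave u a b t := 1 + a * cos (u * t) + b * sin (u * t).

Lemma is_derive_wave u c a b t :
  is_derive t 1 (fun x : R => c + a * cos (u * x) + b * sin (u * x))
    (a * (- u * sin (u * t)) + b * (u * cos (u * t))).
Proof.
have h := is_deriveD (is_deriveD (is_derive_cst c t (1 : R))
  (is_deriveZ a (is_derive_cosM u t))) (is_deriveZ b (is_derive_sinM u t)).
by apply: (is_derive_eq h); rewrite add0r.
Qed.

Lemma wave_ge0 u a b t : `|a| + `|b| <= 1 -> 0 <= wave u a b t.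
Proof.
move=> ab; rewrite /wave.
have c1 : `|a * cos (u * t)| <= `|a|.
  by rewrite normrM ler_piMr// ler_norml cos_geN1 cos_le1.
have s1 : `|b * sin (u * t)| <= `|b|.
  by rewrite normrM ler_piMr// ler_norml sin_geN1 sin_le1.
have := ler_norm (- (a * cos (u * t))); have := ler_norm (- (b * sin (u * t))).
rewrite !normrN; lra.
Qed.

Lemma continuous_wave u a b : continuous (wave u a b).
Proof.
move=> t; apply: differentiable_continuous; apply/derivable1_diffP.
by have [] := is_derive_wave u 1 a b t.
Qed.

Lemma half_line_wave al u a b : 0 < al -> `|a| + `|b| <= 1 ->
  (\int[@lebesgue_measure R]_(t in `[0%R, +oo[) (expR (- al * t) * wave u a b t)%:E =
   (al^-1 + (a * al + b * u) / (al ^+ 2 + u ^+ 2))%:E)%E.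
Proof.
move=> al0 ab.
set q := (al ^+ 2 + u ^+ 2)^-1.
have q0 : al ^+ 2 + u ^+ 2 != 0 by rewrite gt_eqF// ltr_pwDl ?exprn_gt0// sqr_ge0.
(* The coefficients solve the linear system that makes [expR (- al * t) * W t] an antiderivative of
   the integrand; the stated value is [- W 0]. *)
pose W t := - al^-1 + ((- a * al - b * u) * q) * cos (u * t) +
  ((a * u - b * al) * q) * sin (u * t).
pose F t := expR (- al * t) * W t.
have dF t : is_derive t 1 F (expR (- al * t) * wave u a b t).
  have h := is_deriveM (is_derive_expM (- al) t) (is_derive_wave u (- al^-1)
    ((- a * al - b * u) * q) ((a * u - b * al) * q) t).
  apply: (is_derive_eq h); rewrite /wave /GRing.scale/= /q.
  by field; rewrite q0 gt_eqF.
rewrite (@ge0_continuous_FTC2y _ _ F 0 0).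
- rewrite -EFinB sub0r; congr EFin.
  rewrite /F /W !mulr0 expR0 cos0 sin0 /q; ring.
- by move=> x _; rewrite mulr_ge0 ?expR_ge0 ?wave_ge0.
- apply: continuous_subspaceT => x.
  apply: cvgM; last exact: continuous_wave.
  apply: continuous_comp; last exact: continuous_expR.
  by apply: cvgM => //; exact: cvg_cst.
- pose M := `|al^-1| + `|(- a * al - b * u) * q| + `|(a * u - b * al) * q|.
  have WM t : `|W t| <= M.
    rewrite /W /M (le_trans (ler_normD _ _))// lerD//.
      rewrite (le_trans (ler_normD _ _))// normrN lerD//.
      by rewrite normrM ler_piMr// ler_norml cos_geN1 cos_le1.
    by rewrite normrM ler_piMr// ler_norml sin_geN1 sin_le1.
  have e0 : expR (- al * x) @[x --> +oo] --> (0 : R).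
    have -> : (fun x => expR (- al * x)) = (fun y => expR (- y)) \o (fun x => al * x).
      by apply/funext => x /=; rewrite mulNr.
    apply: cvg_comp; last exact: cvgr_expR.
    exact: gt0_cvgMry.
  have e1 : expR (- al * x) * M @[x --> +oo] --> (0 : R).
    by rewrite -[X in _ --> X](mul0r M); exact: cvgMl.
  have e2 : - (expR (- al * x) * M) @[x --> +oo] --> (0 : R).
    by rewrite -oppr0; exact: cvgN.
  apply: (squeeze_cvgr _ e2 e1); near=> x.
  by rewrite -ler_norml /F normrM ger0_norm ?expR_ge0// ler_wpM2l ?expR_ge0.
- by move=> x _; have [] := dF x.
- apply: cvg_at_right_filter; apply: differentiable_continuous.
  by apply/derivable1_diffP; have [] := dF 0.
- by move=> x _; rewrite derive1E; have [_ ->] := dF x.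
Unshelve. all: by end_near. Qed.

(** The line is split at 0. Reflecting the negative half turns the rate [mu - v] into [mu + v] and,
    the sine being odd, [b] into [- b]. *)
Lemma line_wave mu v u a b : 0 < mu -> `|v| < mu -> `|a| + `|b| <= 1 ->
  (\int[@lebesgue_measure R]_t (expR (- mu * `|t| + v * t) * wave u a b t)%:E =
   ((mu - v)^-1 + (a * (mu - v) + b * u) / ((mu - v) ^+ 2 + u ^+ 2) +
    ((mu + v)^-1 + (a * (mu + v) - b * u) / ((mu + v) ^+ 2 + u ^+ 2)))%:E)%E.
Proof.
move=> mu0 vmu ab.
have [v1 v2] : 0 < mu - v /\ 0 < mu + v.
  by move: vmu; rewrite ltr_norml => /andP[? ?]; split; lra.
pose f t := expR (- mu * `|t| + v * t) * wave u a b t.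
have fc : continuous f.
  move=> t; apply: cvgM; last exact: continuous_wave.
  apply: continuous_comp; last exact: continuous_expR.
  apply: cvgD; last by apply: cvgM => //; exact: cvg_cst.
  apply: cvgM; first exact: cvg_cst.
  exact: norm_continuous.
have f0 t : 0 <= f t by rewrite mulr_ge0 ?expR_ge0 ?wave_ge0.
have mf : measurable_fun setT (fun t => (f t)%:E).
  by apply/measurable_EFinP; exact: continuous_measurable_fun.
have -> : [set: R] = `]-oo, 0]%classic `|` `]0, +oo[%classic.
  by rewrite -setCitvl setUv.
rewrite ge0_integral_setU//; last 3 first.
- exact: measurable_funTS.
- by move=> t _; rewrite lee_fin; exact: f0.
- by rewrite -setCitvl; apply/disj_setPS; rewrite setICr.
rewrite addeC EFinD; congr (_ + _)%E.
  rewrite integral_itv_obnd_cbnd; last exact: measurable_funTS.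
  rewrite -half_line_wave//; apply: eq_integral => t.
  rewrite inE/= in_itv/= andbT => t0; rewrite ger0_norm//; congr (expR _ * _)%:E.
  ring.
rewrite -[X in `]-oo, X]]oppr0 ge0_integration_by_substitutionNy//; last 2 first.
- by apply: continuous_subspaceT; exact: fc.
- by move=> t _; exact: f0.
have := @half_line_wave (mu + v) u a (- b) v2.
rewrite normrN mulNr => /(_ ab) <-; apply: eq_integral => t.
rewrite inE/= in_itv/= andbT => t0; rewrite normrN ger0_norm// /wave.
rewrite !mulrN cosN sinN; congr EFin.
have -> : - mu * t - v * t = - (mu + v) * t by ring.
by ring.
Qed.

(* The integral is [1 / (mu - v - i u) + 1 / (mu + v + i u)]. *)
Lemma line_exp mu v s u : 0 < mu -> `|v| <= mu / 2 ->
  let f (t : R) := cexp ((- mu * `|t| + v * t) +i* (s * u * t)) in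
  cintegrable (@lebesgue_measure R) f /\
  normc (cintegral (@lebesgue_measure R) setT f) <= poisson mu s u.
Proof.
move=> mu0 vmu f; set w := s * u.
have vmu' : `|v| < mu by lra.
have [v1 v2] : mu / 2 <= mu - v /\ mu / 2 <= mu + v.
  by move: vmu; rewrite ler_norml => /andP[? ?]; split; lra.
pose g a b t := expR (- mu * `|t| + v * t) * wave w a b t.
pose J a b := (mu - v)^-1 + (a * (mu - v) + b * w) / ((mu - v) ^+ 2 + w ^+ 2) +
    ((mu + v)^-1 + (a * (mu + v) - b * w) / ((mu + v) ^+ 2 + w ^+ 2)).
have gi a b : `|a| + `|b| <= 1 ->
    (@lebesgue_measure R).-integrable setT (EFin \o g a b) /\
    \int[@lebesgue_measure R]_t g a b t = J a b.
  move=> ab; have JE := line_wave w mu0 vmu' ab.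
  split; last by rewrite /Rintegral JE.
  apply/integrableP; split.
    apply/measurable_EFinP; apply: measurable_funM.
      apply: measurableT_comp; first exact: measurable_expR.
      apply: measurable_funD; last exact: measurable_funM.
      by apply: measurable_funM => //; exact: normr_measurable.
    apply: continuous_measurable_fun; exact: continuous_wave.
  under eq_integral => t _.
    rewrite gee0_abs ?lee_fin; last by rewrite mulr_ge0 ?expR_ge0 ?wave_ge0.
    over.
  by rewrite JE ltry.
have [i00 J00] := gi 0 0 (ltac:(by rewrite !normr0 addr0)).
have [i10 J10] := gi 1 0 (ltac:(by rewrite normr0 normr1 addr0)).
have [i01 J01] := gi 0 1 (ltac:(by rewrite normr0 normr1 add0r)).
have frE t : complex.Re (f t) = g 1 0 t - g 0 0 t.
  by rewrite /f /g /wave ReM /= -/w; ring.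
have fmE t : complex.Im (f t) = g 0 1 t - g 0 0 t.
  by rewrite /f /g /wave ImM /= -/w; ring.
split.
  split.
    under eq_fun do rewrite frE; exact: (integrableB measurableT i10 i00).
  under eq_fun do rewrite fmE; exact: (integrableB measurableT i01 i00).
have -> : cintegral (@lebesgue_measure R) setT f = (J 1 0 - J 0 0) +i* (J 0 1 - J 0 0).
  rewrite -J00 -J10 -J01 -!RintegralB//; congr Complex.
    by apply: eq_Rintegral => t _; exact: frE.
  by apply: eq_Rintegral => t _; exact: fmE.
rewrite /= /J.
have -> : w = s * u by [].
set A := mu - v in v1 *; set B := mu + v in v2 *.
have ABE : A + B = 2 * mu by rewrite /A /B; ring.
have A0 : 0 < A by lra.
have B0 : 0 < B by lra.
rewrite /poisson; move: (s * u) => z.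
have zz := sqr_ge0 z.
have A2 : 0 < A ^+ 2 + z ^+ 2 by rewrite ltr_pwDl ?exprn_gt0.
have B2 : 0 < B ^+ 2 + z ^+ 2 by rewrite ltr_pwDl ?exprn_gt0.
have M2 : 0 < mu ^+ 2 + z ^+ 2 by rewrite ltr_pwDl ?exprn_gt0.
rewrite -[leRHS]ger0_norm; last first.
  by apply: divr_ge0; [rewrite mulr_ge0// ltW|exact: ltW].
rewrite -sqrtr_sqr ler_sqrt ?sqr_ge0//.
(* The modulus of [1 / (A - i z) + 1 / (B + i z)], squared. As [A] and [B] are at least [mu / 2],
   each denominator is at least [(mu ^ 2 + z ^ 2) / 4]; with [A + B = 2 mu] this gives the constant
   8. *)
rewrite [leLHS](_ : _ = (A + B) ^+ 2 / ((A ^+ 2 + z ^+ 2) * (B ^+ 2 + z ^+ 2))); last first.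
  by field; rewrite !gt_eqF.
rewrite ABE expr_div_n ler_pdivrMr ?mulr_gt0//.
rewrite mulrAC ler_pdivlMr ?exprn_gt0//.
have hA : mu ^+ 2 + z ^+ 2 <= 4 * (A ^+ 2 + z ^+ 2) by nra.
have hB : mu ^+ 2 + z ^+ 2 <= 4 * (B ^+ 2 + z ^+ 2) by nra.
have -> : (8 * mu) ^+ 2 * ((A ^+ 2 + z ^+ 2) * (B ^+ 2 + z ^+ 2)) =
  (2 * mu) ^+ 2 * ((4 * (A ^+ 2 + z ^+ 2)) * (4 * (B ^+ 2 + z ^+ 2))) by ring.
rewrite ler_wpM2l ?sqr_ge0// expr2.
by apply: ler_pM => //; exact: ltW.
Qed.

End oscillating_exponential.

(** * The extension operator with constant amplitude *)

Section schur_test.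
Context d (T : measurableType d) (R : realType).
Variables (nu : {sigma_finite_measure set T -> \bar R}).

(** [a x * a y] is at most the mean of the two squares. By Tonelli and the symmetry of [k] both
    halves have the same integral, and the row bound makes each at most [B / 2] times the squared
    norm of [a]. *)
Lemma schur_test (D : set T) (k : T -> T -> R) (a : T -> R) (B : R) :
  measurable D ->
  measurable_fun setT (fun z : T * T => k z.1 z.2) ->
  (forall x y, 0 <= k x y) -> (forall x y, k x y = k y x) ->
  measurable_fun setT a -> (forall x, 0 <= a x) -> (forall x, ~ D x -> a x = 0) ->
  0 <= B -> (forall x, D x -> (\int[nu]_(y in D) (k x y)%:E <= B%:E)%E) ->
  (\int[nu]_x \int[nu]_y (a x * a y * k x y)%:E <=
   B%:E * \int[nu]_x (a x ^+ 2)%:E)%E.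
Proof.
move=> mD mk k0 kC ma a0 aD B0 kB.
pose f (z : T * T) := a z.1 ^+ 2 * \1_D z.2 * k z.1 z.2 / 2.
have f0 z : 0 <= f z by rewrite /f !mulr_ge0 ?sqr_ge0.
have mf : measurable_fun setT f.
  apply: measurable_funM => //; apply: measurable_funM => //.
  apply: measurable_funM.
    by apply: measurable_funX; exact: (measurableT_comp ma measurable_fst).
  have mi : measurable_fun setT (\1_D : T -> R) by exact: measurable_indic.
  exact: (measurableT_comp mi measurable_snd).
have mk' : measurable_fun setT (fun z : T * T => (a z.1 * a z.2 * k z.1 z.2)%:E).
  apply/measurable_EFinP; apply: measurable_funM => //.
  by apply: measurable_funM; [exact: (measurableT_comp ma measurable_fst)|
    exact: (measurableT_comp ma measurable_snd)].
have msw : measurable_fun setT (fun z : T * T => f (z.2, z.1)).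
  apply: (measurableT_comp mf); apply: measurable_fun_pair.
    exact: measurable_snd.
  exact: measurable_fst.
have mfE : measurable_fun setT (fun z => (f z)%:E) by exact/measurable_EFinP.
have mswE : measurable_fun setT (fun z : T * T => (f (z.2, z.1))%:E).
  exact/measurable_EFinP.
have sw : (\int[nu]_x \int[nu]_y (f (y, x))%:E = \int[nu]_x \int[nu]_y (f (x, y))%:E)%E.
  rewrite [LHS](fubini_tonelli (fun z : T * T => (f (z.2, z.1))%:E))// => z.
  by rewrite lee_fin.
apply: (@le_trans _ _ (\int[nu]_x \int[nu]_y ((f (x, y))%:E + (f (y, x))%:E))%E).
  rewrite -(fubini_tonelli1 (fun z : T * T => (a z.1 * a z.2 * k z.1 z.2)%:E))//; last first.
    by move=> z; rewrite lee_fin !mulr_ge0.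
  rewrite -(fubini_tonelli1 (fun z : T * T => (f z)%:E + (f (z.2, z.1))%:E)%E)//; last 2 first.
  - exact: emeasurable_funD.
  - by move=> z; rewrite adde_ge0// lee_fin.
  apply: ge0_le_integral => //.
  - by move=> z _; rewrite lee_fin !mulr_ge0.
  - exact: emeasurable_funD.
  move=> [x y] _ /=; rewrite -EFinD lee_fin /f/=.
  have [xD|xD] := pselect (D x); last first.
    by rewrite (aD x xD) !mul0r addr_ge0// !mulr_ge0 ?sqr_ge0.
  have [yD|yD] := pselect (D y); last first.
    by rewrite (aD y yD) mulr0 !mul0r addr_ge0// !mulr_ge0 ?sqr_ge0.
  rewrite !indicE !mem_set// !mulr1 (kC y x).
  have := mulr_ge0 (k0 x y) (sqr_ge0 (a x - a y)).
  move: (a x) (a y) (k x y) => r s t; nra.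
under eq_integral => x _.
  rewrite ge0_integralD//; last 4 first.
  - by move=> y _; rewrite lee_fin.
  - by apply/measurable_EFinP; exact: (measurableT_comp mf (pair1_measurable x)).
  - by move=> y _; rewrite lee_fin.
  - by apply/measurable_EFinP; exact: (measurableT_comp mf (pair2_measurable x)).
  over.
rewrite ge0_integralD//; last 4 first.
- by move=> x _; apply: integral_ge0 => y _; rewrite lee_fin.
- by apply: (measurable_fun_fubini_tonelli_F (fun z => (f z)%:E)) => // z; rewrite lee_fin.
- by move=> x _; apply: integral_ge0 => y _; rewrite lee_fin.
- apply: (measurable_fun_fubini_tonelli_F (fun z : T * T => (f (z.2, z.1))%:E)) => //.
  by move=> z; rewrite lee_fin.
rewrite sw.
have H : (\int[nu]_x \int[nu]_y (f (x, y))%:E <= \int[nu]_x (B / 2 * a x ^+ 2)%:E)%E.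
  apply: ge0_le_integral => //.
  - by move=> x _; apply: integral_ge0 => y _; rewrite lee_fin.
  - by apply: (measurable_fun_fubini_tonelli_F (fun z => (f z)%:E)) => // z; rewrite lee_fin.
  - by apply/measurable_EFinP; apply: measurable_funM => //; exact: measurable_funX.
  move=> x _.
  have [xD|xD] := pselect (D x); last first.
    rewrite aD// expr0n/= mulr0 integral0_eq// => y _.
    by rewrite /f/= aD// expr0n/= !mul0r.
  under eq_integral => y _.
    rewrite (_ : f (x, y) = a x ^+ 2 / 2 * (k x y * \1_D y)); last first.
      by rewrite /f/=; ring.
    rewrite EFinM; over.
  rewrite ge0_integralZl_EFin//; last 3 first.
  - by move=> y _; rewrite lee_fin mulr_ge0.
  - apply/measurable_EFinP; apply: measurable_funM => //.
    exact: (measurableT_comp mk (pair1_measurable x)).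
  - by rewrite divr_ge0 ?sqr_ge0.
  rewrite (_ : B / 2 * _ = a x ^+ 2 / 2 * B); last by ring.
  rewrite [leRHS]EFinM; apply: lee_pmul => //.
  - by rewrite lee_fin divr_ge0 ?sqr_ge0.
  - by apply: integral_ge0 => y _; rewrite lee_fin mulr_ge0.
  apply: le_trans (kB x xD); rewrite [leRHS]integral_mkcond.
  rewrite le_eqVlt; apply/orP; left; apply/eqP; apply: eq_integral => y _.
  by rewrite patchE indicE; case: ifP => _; rewrite ?mulr1 ?mulr0.
apply: (le_trans (leeD H H)).
under eq_integral do rewrite EFinM.
rewrite ge0_integralZl_EFin ?divr_ge0//; last 2 first.
- by move=> x _; rewrite lee_fin sqr_ge0.
- by apply/measurable_EFinP; exact: measurable_funX.
rewrite -ge0_muleDl ?lee_fin ?divr_ge0//.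
by rewrite -EFinD -splitr.
Qed.

End schur_test.

(** * The complex exponential and integrability of complex-valued functions *)

Section complex_exponential.
Variable R : realType.
Implicit Types z w : R[i].

Lemma cexpD z w : cexp (z + w) = cexp z * cexp w.
Proof.
case: z w => [x y] [x' y']; apply/eqP; rewrite eq_complex /= expRD cosD sinD.
by apply/andP; split; apply/eqP; ring.
Qed.

Lemma cexp0 : cexp (0 : R[i]) = 1.
Proof.
by apply/eqP; rewrite eq_complex /= expR0 cos0 sin0; apply/andP; split; apply/eqP; ring.
Qed.

Lemma cexp_sum I (s : seq I) (f : I -> R[i]) :
  cexp (\sum_(i <- s) f i) = \prod_(i <- s) cexp (f i).
Proof. exact: (big_morph _ cexpD cexp0). Qed.

Lemma normc_cexp z : normc (cexp z) = expR (complex.Re z).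
Proof.
rewrite normcM /= expr0n/= addr0 sqrtr_sqr ger0_norm ?expR_ge0//.
by rewrite cos2Dsin2 sqrtr1 mulr1.
Qed.

Lemma conjc_cexp z : conjc (cexp z) = cexp (conjc z).
Proof.
case: z => x y; apply/eqP; rewrite eq_complex /= cosN sinN.
by apply/andP; split; apply/eqP; ring.
Qed.

Lemma conjc_mul z w : conjc (z * w) = conjc z * conjc w.
Proof.
by case: z w => [? ?] [? ?]; apply/eqP; rewrite eq_complex /=; apply/andP; split;
  apply/eqP; ring.
Qed.

Lemma Re_le_normc z : `|complex.Re z| <= normc z.
Proof.
by case: z => x y /=; rewrite -sqrtr_sqr ler_sqrt ?addr_ge0 ?sqr_ge0// lerDl sqr_ge0.
Qed.

Lemma Im_le_normc z : `|complex.Im z| <= normc z.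
Proof.
by case: z => x y /=; rewrite -sqrtr_sqr ler_sqrt ?addr_ge0 ?sqr_ge0// lerDr sqr_ge0.
Qed.

Lemma normc_le_ReIm z : normc z <= `|complex.Re z| + `|complex.Im z|.
Proof.
case: z => u v /=; rewrite -[leRHS]ger0_norm ?addr_ge0// -[leRHS]sqrtr_sqr.
rewrite ler_sqrt ?sqr_ge0// -[u ^+ 2]real_normK ?num_real//.
rewrite -[v ^+ 2]real_normK ?num_real//.
by have := normr_ge0 u; have := normr_ge0 v; nra.
Qed.

Lemma normc_ge0 z : 0 <= normc z.
Proof. by case: z => x y; exact: sqrtr_ge0. Qed.

Lemma sqr_normc z : normc z ^+ 2 = complex.Re z ^+ 2 + complex.Im z ^+ 2.
Proof. by case: z => x y; rewrite sqr_sqrtr// addr_ge0 ?sqr_ge0. Qed.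

Lemma normc_conjc z : normc (conjc z) = normc z.
Proof. by case: z => x y /=; rewrite sqrrN. Qed.

Lemma normc_prod I (s : seq I) (f : I -> R[i]) :
  normc (\prod_(i <- s) f i) = \prod_(i <- s) normc (f i).
Proof. exact: (big_morph _ (@normcM _) (@normc1 _)). Qed.

Lemma ReD z w : complex.Re (z + w) = complex.Re z + complex.Re w.
Proof. by case: z w => [? ?] []. Qed.

Lemma ImD z w : complex.Im (z + w) = complex.Im z + complex.Im w.
Proof. by case: z w => [? ?] []. Qed.

Lemma Re_sum I (s : seq I) (f : I -> R[i]) :
  complex.Re (\sum_(i <- s) f i) = \sum_(i <- s) complex.Re (f i).
Proof. exact: (big_morph _ ReD). Qed.

Lemma Im_sum I (s : seq I) (f : I -> R[i]) :
  complex.Im (\sum_(i <- s) f i) = \sum_(i <- s) complex.Im (f i).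
Proof. exact: (big_morph _ ImD). Qed.

End complex_exponential.

Section complex_functions.
Context d (T : measurableType d) (R : realType).
Implicit Types (mu : {measure set T -> \bar R}) (f g : T -> R[i]).

Lemma cmeasurable_normc (D : set T) f : measurable D ->
  cmeasurable_fun D f -> measurable_fun D (fun x => normc (f x)).
Proof.
move=> mD [fr fi].
rewrite (_ : (fun x => _) =
    fun x => (complex.Re (f x) ^+ 2 + complex.Im (f x) ^+ 2) `^ 2^-1).
  apply: (@measurableT_comp _ _ _ _ _ _ (@powR R ^~ 2^-1)); first exact: measurable_powR.
  by apply: measurable_funD; exact: measurable_funX.
by apply/funext => x; rewrite powR12_sqrt ?addr_ge0 ?sqr_ge0//; case: (f x).
Qed.

Lemma cmeasurable_cexp (D : set T) f :
  cmeasurable_fun D f -> cmeasurable_fun D (fun x => cexp (f x)).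
Proof.
move=> [fr fi].
have mc : measurable_fun setT (@cos R).
  by apply: continuous_measurable_fun; exact: continuous_cos.
have ms : measurable_fun setT (@sin R).
  by apply: continuous_measurable_fun; exact: continuous_sin.
apply: cmeasurable_funM.
  split => /=; last exact: measurable_cst.
  exact: (measurableT_comp (@measurable_expR R) fr).
by split => /=; [exact: (measurableT_comp mc fi)|exact: (measurableT_comp ms fi)].
Qed.

Lemma cintegrable_dominated mu f (g : T -> R) : cmeasurable_fun setT f ->
  mu.-integrable setT (EFin \o g) -> (forall x, normc (f x) <= g x) ->
  cintegrable mu f.
Proof.
move=> [fr fi] gi fg; split; apply: le_integrable gi => //;
  rewrite ?measurable_EFinP//; move=> x _ /=; rewrite lee_fin.
  by rewrite (le_trans (Re_le_normc _))// (le_trans (fg x))// ler_norm.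
by rewrite (le_trans (Im_le_normc _))// (le_trans (fg x))// ler_norm.
Qed.

Lemma cintegralZ mu (c : R[i]) f : cintegrable mu f ->
  cintegrable mu (fun x => c * f x) /\
  cintegral mu setT (fun x => c * f x) = c * cintegral mu setT f.
Proof.
move=> [fr fi].
have cr (a : R) := integrableZl measurableT a fr.
have ci (a : R) := integrableZl measurableT a fi.
split.
  split.
    under eq_fun do rewrite ReM.
    exact: (integrableB measurableT (cr (complex.Re c)) (ci (complex.Im c))).
  under eq_fun do rewrite ImM.
  exact: (integrableD measurableT (ci (complex.Re c)) (cr (complex.Im c))).
apply/eqP; rewrite eq_complex ReM ImM; apply/andP; split; apply/eqP.
  transitivity (\int[mu]_x (complex.Re c * complex.Re (f x) -
      complex.Im c * complex.Im (f x))).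
    by apply: eq_Rintegral => x _; rewrite ReM.
  rewrite (RintegralB measurableT (cr (complex.Re c)) (ci (complex.Im c))).
  by rewrite !RintegralZl.
transitivity (\int[mu]_x (complex.Re c * complex.Im (f x) +
    complex.Im c * complex.Re (f x))).
  by apply: eq_Rintegral => x _; rewrite ImM.
rewrite (RintegralD measurableT (ci (complex.Re c)) (cr (complex.Im c))).
by rewrite !RintegralZl.
Qed.

End complex_functions.

Section square_integrable.
Context d (T : measurableType d) (R : realType).
Variable nu : {finite_measure set T -> \bar R}.

(** From [t <= 1 + t ^ 2], constants being integrable for a finite measure. *)
Lemma integrable_normc (g : T -> R[i]) : cmeasurable_fun setT g ->
  nu.-integrable setT (fun x => (normc (g x) ^+ 2)%:E) ->
  nu.-integrable setT (EFin \o (fun x => normc (g x))).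
Proof.
move=> mg gi.
have i1 : nu.-integrable setT (fun x => (1 + normc (g x) ^+ 2)%:E).
  have := integrableD measurableT
    (finite_measure_integrable_cst nu 1 measurableT) gi.
  by apply: eq_integrable.
apply: le_integrable i1 => //.
  by apply/measurable_EFinP; exact: cmeasurable_normc.
move=> x _ /=; rewrite lee_fin [leRHS]ger0_norm ?addr_ge0 ?sqr_ge0//.
by rewrite ger0_norm ?normc_ge0//; have := sqr_ge0 (normc (g x) - 1); nra.
Qed.

End square_integrable.

Section constant_amplitude.
Variables (R : realType) (n : nat) (lambda : R[i]).
Local Notation V := 'rV[R]_n.+1.
Local Notation nu := (@surface R n.+1).
Local Notation leb := (@lebesgue_rV R n.+1).
Implicit Types (x y xi eta : V).

Definition phase x xi : R[i] := (0 +i* 1) * lambda * (dotv x xi)%:C.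

Definition planar (h : V -> R[i]) x : R[i] :=
  cintegral nu setT (fun xi => cexp (phase x xi) * h xi).

(* [expR (tilt mu x0 x)] is the weight on the [x] side. It dominates the square of
   the weight of the theorem on a ball, and its product with plane waves whose
   frequencies are close to [x0] factors over the coordinates of [x]. *)
Definition tilt (mu : R) (x0 x : V) : R :=
  2 * complex.Im lambda * dotv x x0 - mu * \sum_i `|x ord0 i|.

Lemma Re_phase x xi : complex.Re (phase x xi) = - complex.Im lambda * dotv x xi.
Proof. by rewrite /phase !ReM !ImM /=; ring. Qed.

Lemma Im_phase x xi : complex.Im (phase x xi) = complex.Re lambda * dotv x xi.
Proof. by rewrite /phase !ImM !ReM /=; ring. Qed.

Lemma measurable_dotv : measurable_fun setT (fun z : V * V => dotv z.1 z.2).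
Proof.
apply: measurable_sum => i; apply: measurable_funM.
  exact: (measurableT_comp (measurable_coord i) measurable_fst).
exact: (measurableT_comp (measurable_coord i) measurable_snd).
Qed.

Lemma cmeasurable_phase : cmeasurable_fun setT (fun z : V * V => phase z.1 z.2).
Proof.
split.
  under eq_fun do rewrite Re_phase.
  by apply: measurable_funM => //; exact: measurable_dotv.
under eq_fun do rewrite Im_phase.
by apply: measurable_funM => //; exact: measurable_dotv.
Qed.

Lemma measurable_tilt mu x0 : measurable_fun setT (tilt mu x0).
Proof.
apply: measurable_funB; apply: measurable_funM => //.
  exact: (measurableT_comp measurable_dotv (pair2_measurable x0)).
apply: measurable_sum => i; apply: measurableT_comp; last exact: measurable_coord.
exact: normr_measurable.
Qed.

Lemma integrable_exp_norm1 (c : R) : 0 < c ->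
  leb.-integrable setT (fun x => (expR (- c * \sum_i `|x ord0 i|))%:E).
Proof.
move=> c0.
(* The case of [line_exp] without tilt and oscillation; the zeros are kept to match its form. *)
pose f (i : 'I_n.+1) (t : R) := cexp ((- c * `|t| + 0 * t) +i* (0 * 0 * t)).
have fi i : cintegrable (@lebesgue_measure R) (f i).
  have h : `|0 : R| <= c / 2 by rewrite normr0 divr_ge0// ltW.
  by have [] := line_exp 0 0 c0 h.
have [[fr _] _] := lebesgue_rV_prod fi.
apply: eq_integrable fr => // x _; congr EFin.
rewrite /f -cexp_sum /cexp ReM /= Re_sum Im_sum /=.
rewrite [X in cos X]big1; last by move=> i _; rewrite mulr0 mul0r.
rewrite cos0 mulr1 mul0r subr0 mulr_sumr; congr expR.
by apply: eq_bigr => i _; rewrite mul0r addr0.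
Qed.

Variables (mu kap B : R) (x0 : V) (D : set V) (h : V -> R[i]).
Hypotheses (mD : measurable D) (mu0 : 0 < mu) (B0 : 0 <= B).
Hypotheses (Dk : forall xi, D xi -> forall i, `|xi ord0 i - x0 ord0 i| <= kap).
Hypothesis kmu : kap * `|complex.Im lambda| <= mu / 4.
Hypothesis schurB : forall xi, D xi ->
  (\int[nu]_(eta in D) (prod_poisson mu (complex.Re lambda) xi eta)%:E <= B%:E)%E.
Hypotheses (mh : cmeasurable_fun setT h) (hD : forall xi, ~ D xi -> h xi = 0).
Hypothesis hi : nu.-integrable setT (fun xi => (normc (h xi) ^+ 2)%:E).

(** Half of the tilt goes into each of the two factors of the square, so that the weighted square of
    [planar h x] is the plain square of the integral of [F x]. *)
Let Z x xi := (tilt mu x0 x / 2)%:C + phase x xi.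
Let F x xi := cexp (Z x xi) * h xi.
Let p x := expR (- (mu / 4) * \sum_i `|x ord0 i|).
Let q xi := normc (h xi).

Let mF : cmeasurable_fun setT (fun z : V * V => F z.1 z.2).
Proof.
apply: cmeasurable_funM; last first.
  by apply: (cmeasurable_comp _ mh); exact: measurable_snd.
apply: cmeasurable_cexp; split.
  under eq_fun do rewrite ReD.
  apply: measurable_funD; last exact: cmeasurable_phase.1.
  apply: measurable_funM => //.
  exact: (measurableT_comp (measurable_tilt mu x0) measurable_fst).
under eq_fun do rewrite ImD.
by apply: measurable_funD => //; exact: cmeasurable_phase.2.
Qed.

Let mq : measurable_fun setT q.
Proof. exact: cmeasurable_normc. Qed.

Let qi : nu.-integrable setT (fun xi => (q xi)%:E).
Proof. exact: integrable_normc. Qed.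

Let ReZ x xi : complex.Re (Z x xi) =
  \sum_i (complex.Im lambda * x ord0 i * (x0 ord0 i - xi ord0 i) - mu / 2 * `|x ord0 i|).
Proof.
rewrite ReD Re_phase /= /tilt.
transitivity (complex.Im lambda * dotv x x0 - mu / 2 * (\sum_i `|x ord0 i|) -
  complex.Im lambda * dotv x xi); first by field.
rewrite /dotv !mulr_sumr -!sumrB; apply: eq_bigr => i _; ring.
Qed.

(** In [ReZ] the surviving growth in coordinate [i] is at most [kap |t| |x_i| <= mu / 4 |x_i|],
    against a decay [mu / 2 |x_i|]. This is the domination under which [TTstar_le] may exchange
    integrals. *)
Let F_le x xi : normc (F x xi) <= p x * q xi.
Proof.
have [xD|xD] := pselect (D xi); last first.
  by rewrite /F /q hD// mulr0 normc0 mulr0.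
rewrite normcM normc_cexp ler_wpM2r ?normc_ge0// ler_expR ReZ mulr_sumr.
apply: ler_sum => i _.
have := ler_norm (complex.Im lambda * x ord0 i * (x0 ord0 i - xi ord0 i)).
rewrite !normrM distrC => H; rewrite (le_trans (lerB H (lexx _)))//.
have := Dk xD i; have := normr_ge0 (x ord0 i); have := normr_ge0 (complex.Im lambda).
move: kmu; move: `|complex.Im lambda| `|x ord0 i| `|xi ord0 i - x0 ord0 i| => t y e.
move=> k1 t0 y0 ek.
have : t * e * y <= kap * t * y by rewrite ler_wpM2r// mulrC ler_wpM2r.
have : kap * t * y <= mu / 4 * y by rewrite ler_wpM2r.
lra.
Qed.

Let kernel xi eta := q xi * q eta * prod_poisson mu (complex.Re lambda) xi eta.

(** The integrand is the real part of [F x xi * conjc (F x eta)], a constant times a product over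
    the coordinates of [x]. The residual slopes [v i] are at most [2 kap |t| <= mu / 2], exactly the
    margin in [line_exp]. *)
Let kernel_bound xi eta :
  `|\int[leb]_x (complex.Re (F x xi) * complex.Re (F x eta) +
    complex.Im (F x xi) * complex.Im (F x eta))| <= kernel xi eta.
Proof.
have [xD|xD] := pselect (D xi); last first.
  rewrite /kernel /q hD// normc0 !mul0r.
  under eq_Rintegral do rewrite /F (hD xD) mulr0 /= !mul0r addr0.
  by rewrite Rintegral_cst// mul0r normr0.
have [yD|yD] := pselect (D eta); last first.
  rewrite /kernel /q (hD yD) normc0 mulr0 !mul0r.
  under eq_Rintegral do rewrite /F (hD yD) mulr0 /= !mulr0 addr0.
  by rewrite Rintegral_cst// mul0r normr0.
pose v i := complex.Im lambda * (2 * x0 ord0 i - xi ord0 i - eta ord0 i).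
pose f (i : 'I_n.+1) (t : R) := cexp ((- mu * `|t| + v i * t) +i*
  (complex.Re lambda * (xi ord0 i - eta ord0 i) * t)).
have vmu i : `|v i| <= mu / 2.
  rewrite /v normrM.
  have -> : 2 * x0 ord0 i - xi ord0 i - eta ord0 i =
    - (xi ord0 i - x0 ord0 i) - (eta ord0 i - x0 ord0 i) by ring.
  have := ler_normB (- (xi ord0 i - x0 ord0 i)) (eta ord0 i - x0 ord0 i).
  rewrite normrN; have := Dk xD i; have := Dk yD i.
  move: kmu (normr_ge0 (complex.Im lambda)).
  move: `|- (xi ord0 i - x0 ord0 i) - (eta ord0 i - x0 ord0 i)|.
  move: `|complex.Im lambda| `|xi ord0 i - x0 ord0 i| `|eta ord0 i - x0 ord0 i|.
  move=> t b c a k t0 c1 b1 ab.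
  have : t * a <= t * (kap + kap) by rewrite ler_wpM2l//; lra.
  lra.
have fi i := (line_exp (complex.Re lambda) (xi ord0 i - eta ord0 i) mu0 (vmu i)).1.
have [Pi PE] := lebesgue_rV_prod fi.
set P := (fun x => _) in Pi PE.
pose c := h xi * conjc (h eta).
have GE x : complex.Re (F x xi) * complex.Re (F x eta) +
    complex.Im (F x xi) * complex.Im (F x eta) = complex.Re (c * P x).
  rewrite (_ : _ + _ = complex.Re (F x xi * conjc (F x eta))); last first.
    by case: (F x xi) (F x eta) => [? ?] [? ?] /=; ring.
  rewrite /F conjc_mul conjc_cexp mulrACA mulrC -cexpD /P /f -cexp_sum.
  congr (complex.Re (_ * cexp _)); apply/eqP; rewrite eq_complex; apply/andP; split.
    rewrite ReD Re_sum; have -> : complex.Re (conjc (Z x eta)) = complex.Re (Z x eta).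
      by case: (Z x eta).
    rewrite !ReZ -big_split/=; apply/eqP; apply: eq_bigr => i _.
    by rewrite /v; field.
  rewrite ImD Im_sum; have -> : complex.Im (conjc (Z x eta)) = - complex.Im (Z x eta).
    by case: (Z x eta).
  rewrite /Z !ImD !Im_phase /= !add0r /dotv -mulrBr -sumrB mulr_sumr.
  by apply/eqP; apply: eq_bigr => i _; ring.
have [ci cE] := cintegralZ c Pi.
under eq_Rintegral do rewrite GE.
rewrite [X in `|X|](_ : _ = complex.Re (cintegral leb setT (fun x => c * P x)))//.
rewrite (le_trans (Re_le_normc _))// cE normcM normcM normc_conjc PE normc_prod.
rewrite ler_wpM2l ?mulr_ge0 ?normc_ge0//.
apply: ler_prod => i _; rewrite normc_ge0/=.
exact: (line_exp (complex.Re lambda) (xi ord0 i - eta ord0 i) mu0 (vmu i)).2.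
Qed.

Lemma planar_estimate :
  (\int[leb]_x (expR (tilt mu x0 x) * normc (planar h x) ^+ 2)%:E <=
   B%:E * \int[nu]_xi (normc (h xi) ^+ 2)%:E)%E.
Proof.
have Fi x : cintegrable nu (F x).
  apply: (@cintegrable_dominated _ _ _ _ _ (fun xi => p x * q xi)).
  - exact: (cmeasurable_comp (pair1_measurable x) mF).
  - exact: (integrableZl measurableT (p x) qi).
  exact: F_le.
have planarE x : expR (tilt mu x0 x) * normc (planar h x) ^+ 2 =
    (\int[nu]_xi complex.Re (F x xi)) ^+ 2 + (\int[nu]_xi complex.Im (F x xi)) ^+ 2.
  have [_ E] := cintegralZ (cexp (- (tilt mu x0 x / 2))%:C) (Fi x).
  have -> : planar h x = cexp (- (tilt mu x0 x / 2))%:C * cintegral nu setT (F x).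
    rewrite -E /planar; congr cintegral; apply/funext => xi.
    rewrite /F mulrA -cexpD; congr (cexp _ * _).
    by rewrite /Z addrA -rmorphD/= addNr rmorph0 add0r.
  rewrite normcM exprMn normc_cexp [complex.Re _%:C]/= -expRM_natl mulrN mulrA -expRD.
  rewrite (_ : _ + _ = 0) ?expR0 ?mul1r; last by field.
  by rewrite sqr_normc.
under eq_integral do rewrite planarE.
have pp : leb.-integrable setT (fun x => (p x ^+ 2)%:E).
  have : 0 < mu / 2 by rewrite divr_gt0.
  move/integrable_exp_norm1; apply: eq_integrable => // x _.
  by rewrite /p -expRM_natl; congr (expR _)%:E; field.
have mr : measurable_fun setT (fun z : V * V => complex.Re (F z.1 z.2)) := mF.1.
have mi : measurable_fun setT (fun z : V * V => complex.Im (F z.1 z.2)) := mF.2.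
have mk : measurable_fun setT (fun z : V * V => kernel z.1 z.2).
  apply: measurable_funM; last exact: measurable_prod_poisson.
  by apply: measurable_funM; [exact: (measurableT_comp mq measurable_fst)|
    exact: (measurableT_comp mq measurable_snd)].
apply: le_trans (TTstar_le mr mi _ _ pp qi _ _ mk _) _.
- by move=> x; exact: expR_ge0.
- by move=> xi; exact: normc_ge0.
- by move=> x xi /=; rewrite (le_trans (Re_le_normc _))// F_le.
- by move=> x xi /=; rewrite (le_trans (Im_le_normc _))// F_le.
- exact: kernel_bound.
apply: (schur_test mD (measurable_prod_poisson _ _)) => //.
- by move=> xi eta; exact: prod_poisson_ge0.
- by move=> xi eta; exact: prod_poissonC.
- by move=> xi; exact: normc_ge0.
- by move=> xi /hD; rewrite /q => ->; rewrite normc0.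
Qed.

End constant_amplitude.

(** * Summation by parts on a grid *)

Section grid_summation.
Variables (A : comNzRingType) (d N : nat).
Local Notation J := {ffun 'I_d -> 'I_N.+1}.
Implicit Types (f : J -> A) (m t k : J).

(** As a matrix, the inverse of the summation matrix [(t <= k)%N%:R]: summing over [t <= k] gives
    [[m <= k] - [m + 1 <= k] = [m = k]]. *)
Definition step_delta (m t : nat) : A := (m == t)%:R - (m.+1 == t)%:R.

Definition grid_diff f t := \sum_m f m * \prod_j step_delta (m j) (t j).

Lemma sum_step_delta (m k : 'I_N.+1) :
  \sum_(t < N.+1) (t <= k)%N%:R * step_delta m t = (m == k)%:R.
Proof.
have H (l : nat) : (l <= N.+1)%N ->
    \sum_(t < N.+1) (t <= k)%N%:R * (l == t :> nat)%:R = (l <= k)%N%:R :> A.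
  (* The value [N.+1] occurs as [m.+1] for the last [m]. No index [t] equals it, and the right-hand
     side vanishes too because [k < N.+1]. *)
  rewrite leq_eqVlt => /predU1P[->|lN].
    rewrite big1 ?(gtn_eqF (ltn_ord k)); last first.
      by move=> t _; rewrite gtn_eqF ?mulr0// ltn_ord.
    by rewrite leqNgt ltn_ord.
  rewrite (bigD1 (Ordinal lN))//= eqxx mulr1 big1 ?addr0// => t tl.
  by rewrite (_ : (l == t :> nat) = false) ?mulr0//; apply/negbTE; rewrite eq_sym.
rewrite /step_delta; under eq_bigr do rewrite mulrBr.
rewrite sumrB H; last exact/ltnW/ltn_ord.
rewrite H//.
rewrite (_ : (m == k) = (m == k :> nat))//.
by case: (ltngtP m k); rewrite ?subrr ?subr0.
Qed.

(* Every function on the grid is a combination of indicators of upper orthants,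
   whose coefficients are its mixed differences (with value [f] on the faces
   [t j = 0]). *)
Lemma grid_summation f k :
  f k = \sum_(t : J) (\prod_j (t j <= k j)%N%:R) * grid_diff f t.
Proof.
have pE m : \prod_j (m j == k j)%:R = (m == k)%:R :> A.
  have [->|/eqP mk] := eqVneq m k; first by rewrite big1// => j _; rewrite eqxx.
  have [j mkj] : exists j, m j != k j.
    by apply/existsP; rewrite -negb_forall; apply/negP => /forallP H;
      apply: mk; apply/ffunP => j; apply/eqP.
  by rewrite (bigD1 j)//= (negbTE mkj) mul0r.
transitivity (\sum_m f m * \prod_j (m j == k j)%:R).
  rewrite (bigD1 k)//= pE eqxx mulr1 big1 ?addr0// => m mk.
  by rewrite pE (negbTE mk) mulr0.
under [RHS]eq_bigr do rewrite mulr_sumr.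
rewrite exchange_big/=; apply: eq_bigr => m _.
under eq_bigr do rewrite -sum_step_delta.
rewrite bigA_distr_bigA mulr_sumr; apply: eq_bigr => t _.
by rewrite big_split/= mulrCA mulrA.
Qed.

(** Differences in the directions of [s] only. This interpolates between [f] and [grid_diff f], so
    that a mixed difference can be peeled off one coordinate at a time. *)
Definition grid_pdiff (s : seq 'I_d) f t := \sum_m f m *
  \prod_j (if j \in s then step_delta (m j) (t j) else (m j == t j)%:R).

Definition grid_pred (i : 'I_d) t : J :=
  [ffun j => if j == i then inord (t j).-1 else t j].

Lemma grid_pdiff_cons i s f t : i \notin s -> grid_pdiff (i :: s) f t =
  grid_pdiff s f t - if (0 < t i)%N then grid_pdiff s f (grid_pred i t) else 0.
Proof.
move=> si; rewrite /grid_pdiff.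
have P m (r : seq 'I_d) t' : (forall j, j != i -> (j \in r) = (j \in s)) ->
    (forall j, j != i -> t' j = t j) ->
    \prod_(j | j != i) (if j \in r then step_delta (m j) (t' j) else (m j == t' j)%:R) =
    \prod_(j | j != i) (if j \in s then step_delta (m j) (t j) else (m j == t j)%:R).
  by move=> rs tt; apply: eq_bigr => j ji; rewrite rs// tt.
pose X m := \prod_(j | j != i)
  (if j \in s then step_delta (m j) (t j) else (m j == t j)%:R).
have E1 : \sum_m f m * \prod_j (if j \in i :: s then step_delta (m j) (t j)
    else (m j == t j)%:R) = \sum_m f m * (step_delta (m i) (t i) * X m).
  apply: eq_bigr => m _; rewrite (bigD1 i)//= mem_head P// => j ji.
  by rewrite inE (negbTE ji).
have E2 : \sum_m f m * \prod_j (if j \in s then step_delta (m j) (t j)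
    else (m j == t j)%:R) = \sum_m f m * ((m i == t i)%:R * X m).
  by apply: eq_bigr => m _; rewrite (bigD1 i)//= (negbTE si).
rewrite E1 E2 /step_delta.
case: ifPn => [t0|]; last first.
  rewrite -leqNgt leqn0 => /eqP t0; rewrite subr0; apply: eq_bigr => m _.
  by rewrite t0/= subr0 -[m i == t i]/(m i == t i :> nat) t0.
have E3 : \sum_m f m * \prod_j (if j \in s then step_delta (m j) (grid_pred i t j)
    else (m j == grid_pred i t j)%:R) = \sum_m f m * (((m i).+1 == t i)%:R * X m).
  apply: eq_bigr => m _; rewrite (bigD1 i)//= (negbTE si) P//; last first.
    by move=> j ji; rewrite ffunE (negbTE ji).
  congr (_ * (_%:R * _)).
  rewrite -[m i == _]/(m i == grid_pred i t i :> nat) ffunE eqxx inordK.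
    by case: (val (t i)) t0 => // u _; rewrite eqSS.
  by rewrite (leq_ltn_trans (leq_pred _)).
rewrite E3 -sumrB; apply: eq_bigr => m _.
by rewrite -mulrBr -mulrBl.
Qed.

Lemma grid_pdiff_nil f t : grid_pdiff [::] f t = f t.
Proof.
rewrite /grid_pdiff (bigD1 t)//= big1 ?mulr1; last by move=> j _; rewrite eqxx.
rewrite big1 ?addr0// => m mt.
have [j mtj] : exists j, m j != t j.
  by apply/existsP; rewrite -negb_forall; apply/negP => /forallP H;
    move/eqP: mt; apply; apply/ffunP => j; apply/eqP.
by rewrite (bigD1 j)//= (negbTE mtj) mul0r mulr0.
Qed.

Lemma grid_pdiff_enum f t : grid_pdiff (enum 'I_d) f t = grid_diff f t.
Proof.
by apply: eq_bigr => m _; congr (_ * _); apply: eq_bigr => j _; rewrite mem_enum.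
Qed.

End grid_summation.

(** * Iterated backward differences and the mean value theorem *)

Section backward_differences.
Variables (R : realType) (d : nat) (eta : R).
Local Notation V := 'rV[R]_d.
Implicit Types (h : V -> R) (y z : V) (s : seq 'I_d).
Local Notation e_ i := (delta_mx ord0 i : V).

Fixpoint backdiff s h : V -> R :=
  if s is i :: s' then fun y => backdiff s' h y - backdiff s' h (y - eta *: e_ i)
  else h.

(** Directions with [t i = 0] are filtered out because there is no predecessor to subtract.
    Coefficients on the faces of the grid therefore carry fewer powers of the mesh. *)
Lemma grid_pdiff_backdiff (N : nat) (c : V) h s (t : {ffun 'I_d -> 'I_N.+1}) :
  uniq s ->
  let pt (m : {ffun 'I_d -> 'I_N.+1}) : V := c + eta *: \row_j (m j : nat)%:R in
  grid_pdiff s (fun m => h (pt m)) t =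
  backdiff [seq i <- s | (0 < t i)%N] h (pt t).
Proof.
move=> us pt; elim: s us t => [|i s ih] /=; first by move=> _ t; rewrite grid_pdiff_nil.
move=> /andP[si us] t; rewrite grid_pdiff_cons// !ih//.
case: ifPn => [t0|t0]; last by rewrite subr0.
rewrite /=; congr (_ - backdiff _ _ _).
  apply: eq_in_filter => j js; rewrite ffunE; case: eqP => // ji.
  by rewrite ji (negbTE si) in js.
rewrite /pt -addrA -scalerBr; congr (_ + _ *: _); apply/rowP => j.
rewrite !mxE ffunE eqxx/=; case: eqP => [->|_]; last by rewrite subr0.
rewrite inordK; last by rewrite (leq_ltn_trans (leq_pred _)).
by case: (val (t i)) t0 => // u _; rewrite -natr1 addrK.
Qed.

Lemma is_derive_line h y v r df :
  is_derive (y + r *: v) v h df -> is_derive r 1 (fun r => h (y + r *: v)) df.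
Proof.
move=> [dh <-].
have E : (fun e : R => e^-1 *: (h (e *: v + (y + r *: v)) - h (y + r *: v))) =
   (fun e : R => e^-1 *: (h (y + (e *: 1 + r) *: v) - h (y + r *: v))).
  apply/funext => e; congr (_ *: (h _ - _)).
  by rewrite scalerDl addrCA [e *: 1]mulr1.
split; first by move: dh; rewrite /derivable E.
by rewrite /derive -E.
Qed.

Lemma is_derive_shift h y v w df :
  is_derive (y - w) v h df -> is_derive y v (fun y => h (y - w)) df.
Proof.
move=> [dh <-].
have E : (fun e : R => e^-1 *: (h (e *: v + (y - w)) - h (y - w))) =
   (fun e : R => e^-1 *: (h (e *: v + y - w) - h (y - w))).
  by apply/funext => e; rewrite addrA.
split; first by move: dh; rewrite /derivable E.
by rewrite /derive -E.
Qed.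

Variables (lo hi : V).
Hypothesis eta0 : 0 < eta.

Definition box : set V := [set y | forall i, lo ord0 i <= y ord0 i <= hi ord0 i].

(** This ensures that all points at which [backdiff s h y] evaluates [h], and the segments joining
    them along the directions of [s], lie in [box]. *)
Definition room s y := box y /\ forall i, i \in s -> lo ord0 i <= y ord0 i - eta.

Lemma room_cons i s y : i \notin s -> room (i :: s) y ->
  room s y /\ room s (y - eta *: e_ i).
Proof.
move=> si [yb ys]; split.
  by split => // j js; apply: ys; rewrite inE js orbT.
have yi := ys i (mem_head _ _).
split => j; last first.
  move=> js; rewrite !mxE; have [ji|_] := eqVneq j i; first by rewrite ji (negbTE si) in js.
  by rewrite mulr0 subr0; apply: ys; rewrite inE js orbT.
rewrite !mxE; have /andP[b1 b2] := yb j.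
have [ji|_] := eqVneq j i; last by rewrite mulr0 subr0 b1 b2.
rewrite eqxx mulr1; move: b1 b2; rewrite ji => b1 b2; apply/andP; split => //.
by rewrite (le_trans _ b2)// gerBl ltW.
Qed.

Lemma is_derive_backdiff s h i y : uniq s -> room s y ->
  (forall z, box z -> derivable h z (e_ i)) ->
  is_derive y (e_ i) (backdiff s h) (backdiff s ('D_(e_ i) h) y).
Proof.
move=> + + dh; elim: s y => [|j s ih] y /=.
  by move=> _ [yb _]; split => //; exact: dh.
move=> /andP[sj us] /(room_cons sj)[r1 r2].
exact: (is_deriveB (ih _ us r1) (is_derive_shift (ih _ us r2))).
Qed.

(** The mean value theorem is applied once per direction. The derivative passes through the
    remaining differences by [is_derive_backdiff], so the induction continues with ['D_(e_ i) h] and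
    gains a factor [eta] each time. *)
Lemma backdiff_bound s h M y : uniq s -> room s y ->
  (forall s' z, (size s' <= size s)%N -> box z ->
    `|partials s' h z| <= M /\ forall i, derivable (partials s' h) z (e_ i)) ->
  `|backdiff s h y| <= eta ^+ size s * M.
Proof.
elim: s h y => [|i s ih] h y /=.
  by move=> _ [yb _] H; rewrite expr0 mul1r; have [] := H [::] y isT yb.
move=> /andP[si us] rm H.
have [r1 r2] := room_cons si rm.
have rr r : 0 <= r <= eta -> room s (y - eta *: e_ i + r *: e_ i).
  move=> /andP[r0 re]; case: r1 => yb ys; case: r2 => yb' ys'; split => j; last first.
    move=> js; have := ys' j js; rewrite !mxE.
    have [ji|_] := eqVneq j i; first by rewrite ji (negbTE si) in js.
    by rewrite !mulr0 addr0.
  have /andP[b1 b2] := yb j; have /andP[b3 b4] := yb' j.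
  move: b3 b4; rewrite !mxE; have [ji|_] := eqVneq j i; rewrite ?eqxx ?mulr1 ?mulr0; last first.
    by rewrite !addr0 => -> ->.
  move: b1 b2; rewrite ji => b1 b2 b3 b4; apply/andP; split.
    by rewrite (le_trans b3)// lerDl.
  by rewrite (le_trans _ b2)// -addrA gerDl addrC subr_le0.
have dh z : box z -> derivable h z (e_ i).
  by move=> zb; have [_] := H [::] z isT zb; apply.
pose phi r := backdiff s h (y - eta *: e_ i + r *: e_ i).
have dphi r : 0 <= r <= eta -> is_derive r 1 phi
    (backdiff s ('D_(e_ i) h) (y - eta *: e_ i + r *: e_ i)).
  by move=> /rr rrr; apply: is_derive_line; exact: is_derive_backdiff.
have -> : backdiff s h y - backdiff s h (y - eta *: e_ i) = phi eta - phi 0.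
  by rewrite /phi scale0r addr0 subrK.
have [r rin ->] : exists2 r, r \in `[0, eta] & phi eta - phi 0 =
    backdiff s ('D_(e_ i) h) (y - eta *: e_ i + r *: e_ i) * (eta - 0).
  apply: MVT_segment; first exact: ltW.
    move=> r; rewrite in_itv/= => /andP[r0 re]; apply: dphi; by rewrite !ltW.
  apply: derivable_within_continuous => r; rewrite in_itv/= => rin.
  by have [] := dphi r rin.
rewrite subr0 normrM (gtr0_norm eta0) mulrC exprS -mulrA ler_pM2l//.
apply: ih => //; first by apply: rr; move: rin; rewrite in_itv.
(* The derivative in direction [i] acts on [h] first, hence is innermost in [partials] and last in
   the list. *)
move=> s' z ss zb; have := H (rcons s' i) z.
rewrite size_rcons ltnS => /(_ ss zb).
by rewrite /partials -cats1 foldr_cat.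
Qed.

End backward_differences.

(** * Degree-zero extensions off the sphere *)

Section homogeneous_partials.
Variables (R : realType) (d : nat).
Local Notation V := 'rV[R]_d.
Implicit Types (h : V -> R) (y z v : V) (s : seq 'I_d).
Local Notation e_ i := (delta_mx ord0 i : V).

Lemma line_is_derive h y v (r df : R) :
  is_derive r 1 (fun r : R => h (y + r *: v)) df -> is_derive (y + r *: v) v h df.
Proof.
move=> [dh <-].
have E : (fun e : R => e^-1 *: (h (e *: v + (y + r *: v)) - h (y + r *: v))) =
   (fun e : R => e^-1 *: (h (y + (e *: 1 + r) *: v) - h (y + r *: v))).
  apply/funext => e; congr (_ *: (h _ - _)).
  by rewrite scalerDl addrCA [e *: 1]mulr1.
split; first by rewrite /derivable E.
by rewrite /derive E.
Qed.

Lemma homogeneous_derive h v y (t c : R) : y != 0 -> 0 < t ->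
  (forall z, z != 0 -> h (t *: z) = c * h z) ->
  derivable h y v -> 'D_v h (t *: y) = c / t * 'D_v h y.
Proof.
move=> y0 t0 hh dh.
have d1 : is_derive (0 : R) 1 (fun r => h (y + r *: v)) ('D_v h y).
  by apply: is_derive_line; rewrite scale0r addr0; split.
have d2 : is_derive (0 : R) 1 (fun r : R => t^-1 * r) t^-1.
  have H := is_deriveZ t^-1 (is_derive_id (0 : R) (1 : R)).
  by apply: (is_derive_eq H); rewrite [LHS]mulr1.
have d3 : is_derive (0 : R) 1 (fun r => c * h (y + (t^-1 * r) *: v))
    (c / t * 'D_v h y).
  have d1' : is_derive (t^-1 * 0) 1 (fun r => h (y + r *: v)) ('D_v h y).
    by rewrite mulr0.
  have H := is_deriveZ c (is_derive1_comp d1' d2).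
  by apply: (is_derive_eq H); rewrite /GRing.scale/=; ring.
have d4 : is_derive (0 : R) 1 (fun r => h (t *: y + r *: v)) (c / t * 'D_v h y).
  apply: (near_eq_is_derive _ d3).
  (* Homogeneity is assumed off the origin only: a nonzero coordinate of [y] stays nonzero along the
     line for small [r]. *)
  have [j yj] : exists j, y ord0 j != 0.
    apply/existsP; rewrite -negb_forall; apply: contra y0 => /forallP H.
    by apply/eqP/rowP => j; rewrite mxE; apply/eqP.
  have cc : (y ord0 j + (t^-1 * r) * v ord0 j) @[r --> (0 : R)] --> y ord0 j.
    rewrite -[X in _ --> X]addr0 -[X in _ + X](mul0r (v ord0 j)) -[X in X * v _ _](mulr0 t^-1).
    apply: cvgD; first exact: cvg_cst.
    by apply: cvgM; [apply: cvgM => //; exact: cvg_cst|exact: cvg_cst].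
  near=> r.
  rewrite -hh; first by rewrite scalerDr scalerA mulrA divff ?mul1r// gt_eqF.
  have : y ord0 j + (t^-1 * r) * v ord0 j != 0 by near: r; exact: (cvgr_neq0 _ cc).
  by apply: contraNneq => /rowP/(_ j); rewrite !mxE => ->.
have := line_is_derive d4; rewrite scale0r addr0 => -[_ ->//].
Unshelve. all: by end_near. Qed.

Lemma partials_homogeneous h s y (t : R) : smooth_off0 h ->
  (forall t z, 0 < t -> h (t *: z) = h z) -> y != 0 -> 0 < t ->
  partials s h (t *: y) = t ^- (size s) * partials s h y.
Proof.
move=> sh hh + t0; elim: s y => [|i s ih] y y0 /=.
  by rewrite hh// expr0 invr1 mul1r.
rewrite (@homogeneous_derive _ _ _ t (t ^- size s))//.
  by rewrite exprSr invfM.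
by have [_] := sh s y y0; apply.
Qed.

(** [CN_norm] sees derivatives on the sphere only, whereas grid points lie near it. A partial
    derivative of order [k] of a function homogeneous of degree 0 is homogeneous of degree [- k],
    which transports the bound radially. *)
Lemma partials_off_sphere h s y (M del : R) : smooth_off0 h ->
  (forall t z, 0 < t -> h (t *: z) = h z) -> 0 < del -> del <= enorm y ->
  (forall xi, sphere d xi -> `|partials s h xi| <= M) ->
  `|partials s h y| <= del ^- (size s) * M.
Proof.
move=> sh hh d0 dy hM.
have y0 : y != 0 by rewrite -enorm_eq0 gt_eqF// (lt_le_trans d0).
have ye : 0 < enorm y by rewrite (lt_le_trans d0).
have ns := normalize_sphere y0.
rewrite {1}(normalizeK y0) partials_homogeneous//; last exact: sphere_neq0.
rewrite normrM ger0_norm ?invr_ge0 ?exprn_ge0 ?enorm_ge0//.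
apply: ler_pM => //; [by rewrite invr_ge0 exprn_ge0 ?enorm_ge0| |exact: hM].
by rewrite lef_pV2 ?posrE ?exprn_gt0// lerXn2r// nnegrE ltW.
Qed.

Lemma hom0_homogeneous (f : V -> R[i]) (t : R) z : 0 < t -> hom0 f (t *: z) = hom0 f z.
Proof.
move=> t0; rewrite /hom0 /normalize enormZ gtr0_norm// scalerA invfM.
by rewrite -mulrA [X in _ * X]mulrC mulrA mulVf ?mul1r// gt_eqF.
Qed.

Lemma CN_norm_partials (N : nat) (f : V -> R[i]) s xi : (CN_norm N f <= 1)%E ->
  (size s <= N)%N -> sphere d xi ->
  `|partials s (fun y => complex.Re (hom0 f y)) xi| <= 1 /\
  `|partials s (fun y => complex.Im (hom0 f y)) xi| <= 1.
Proof.
move=> f1 sN Sxi.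
set z := partials s (fun y => complex.Re (hom0 f y)) xi +i*
  partials s (fun y => complex.Im (hom0 f y)) xi.
have : ((normc z)%:E <= 1)%E.
  apply: le_trans f1; apply: ereal_sup_ubound; exists s, xi; split => //.
rewrite lee_fin => z1.
split; first exact: (le_trans (Re_le_normc z)).
exact: (le_trans (Im_le_normc z)).
Qed.

End homogeneous_partials.

(** * Parameter integrals and finite sums of complex-valued functions *)

Section parameter_integral.
Context d1 d2 (T1 : measurableType d1) (T2 : measurableType d2) (R : realType).
Variable nu : {sigma_finite_measure set T2 -> \bar R}.

Lemma measurable_param_Rintegral (f : T1 * T2 -> R) : measurable_fun setT f ->
  measurable_fun setT (fun x => \int[nu]_y f (x, y)).
Proof.
move=> mf.
have mfE : measurable_fun setT (EFin \o f) by exact/measurable_EFinP.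
rewrite (_ : (fun x => _) = fun x => fine (fubini_F nu (EFin \o f)^\+%E x -
    fubini_F nu (EFin \o f)^\-%E x)%E); last first.
  apply/funext => x; rewrite /Rintegral integralE /fubini_F.
  congr (fine (_ - _)%E); apply: eq_integral => y _;
    by rewrite ?funepos.unlock ?funeneg.unlock.
apply: (measurableT_comp (fine_measurable measurableT)).
apply: emeasurable_funB; apply: measurable_fun_fubini_tonelli_F => //.
  exact: measurable_funepos.
exact: measurable_funeneg.
Qed.

Lemma cmeasurable_param_cintegral (f : T1 * T2 -> R[i]) : cmeasurable_fun setT f ->
  cmeasurable_fun setT (fun x => cintegral nu setT (fun y => f (x, y))).
Proof.
move=> [fr fi]; split.
  exact: (measurable_param_Rintegral fr).
exact: (measurable_param_Rintegral fi).
Qed.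

End parameter_integral.

Section complex_sums.
Context d (T : measurableType d) (R : realType).
Implicit Types (mu : {measure set T -> \bar R}) (f g : T -> R[i]).

Lemma cintegralD mu f g : cintegrable mu f -> cintegrable mu g ->
  cintegrable mu (fun x => f x + g x) /\
  cintegral mu setT (fun x => f x + g x) = cintegral mu setT f + cintegral mu setT g.
Proof.
move=> [fr fi] [gr gi]; split.
  split.
    under eq_fun do rewrite ReD; exact: (integrableD measurableT fr gr).
  under eq_fun do rewrite ImD; exact: (integrableD measurableT fi gi).
apply/eqP; rewrite eq_complex ReD ImD; apply/andP; split; apply/eqP.
  transitivity (\int[mu]_x (complex.Re (f x) + complex.Re (g x))).
    by apply: eq_Rintegral => x _; rewrite ReD.
  exact: (RintegralD measurableT fr gr).
transitivity (\int[mu]_x (complex.Im (f x) + complex.Im (g x))).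
  by apply: eq_Rintegral => x _; rewrite ImD.
exact: (RintegralD measurableT fi gi).
Qed.

Lemma cintegral_sum mu I (s : seq I) (f : I -> T -> R[i]) :
  (forall i, cintegrable mu (f i)) ->
  cintegrable mu (fun x => \sum_(i <- s) f i x) /\
  cintegral mu setT (fun x => \sum_(i <- s) f i x) =
    \sum_(i <- s) cintegral mu setT (f i).
Proof.
move=> fi; elim: s => [|i s [ih1 ih2]].
  under eq_fun do rewrite big_nil; rewrite big_nil; split.
    by split; exact: integrable0.
  by rewrite /cintegral /= /Rintegral integral0.
rewrite big_cons -ih2.
under eq_fun do rewrite big_cons; exact: cintegralD.
Qed.

Lemma cmeasurable_sum (D : set T) I (s : seq I) (f : I -> T -> R[i]) :
  (forall i, cmeasurable_fun D (f i)) ->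
  cmeasurable_fun D (fun x => \sum_(i <- s) f i x).
Proof.
move=> mf; split.
  by under eq_fun do rewrite Re_sum; apply: measurable_sum => i; exact: (mf i).1.
by under eq_fun do rewrite Im_sum; apply: measurable_sum => i; exact: (mf i).2.
Qed.

End complex_sums.

(** With [S], [P], [Q] the sums of [b], [b u] and [b u ^ 2], the nonnegative sum of
    [b (S u - P) ^ 2] equals [S (S Q - P ^ 2)]. *)
Lemma weighted_cauchy_schwarz (R : realFieldType) (I : finType) (b u : I -> R) :
  (forall i, 0 <= b i) ->
  (\sum_i b i * u i) ^+ 2 <= (\sum_i b i) * \sum_i b i * u i ^+ 2.
Proof.
move=> b0; set S := \sum_i b i; set P := \sum_i _; set Q := \sum_i _.
have S0 : 0 <= S by exact: sumr_ge0.
have [SE|SN] := eqVneq S 0.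
  have bE i : b i = 0.
    apply/eqP; move/eqP: SE; rewrite psumr_eq0// => /allP/(_ i); apply.
    by rewrite mem_index_enum.
  by rewrite SE mul0r /P big1 ?expr0n// => i _; rewrite bE mul0r.
have : 0 <= \sum_i b i * (S * u i - P) ^+ 2.
  by apply: sumr_ge0 => i _; rewrite mulr_ge0 ?sqr_ge0.
have -> : \sum_i b i * (S * u i - P) ^+ 2 = S * (S * Q - P ^+ 2).
  transitivity (\sum_i (S ^+ 2 * (b i * u i ^+ 2) - 2 * S * P * (b i * u i) + P ^+ 2 * b i)).
    by apply: eq_bigr => i _; ring.
  by rewrite big_split sumrB/= -!mulr_sumr -/P -/Q -/S; ring.
by rewrite pmulr_rge0 ?subr_ge0// lt_def SN.
Qed.

Lemma normc_sum (R : rcfType) I (s : seq I) (f : I -> R[i]) :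
  normc (\sum_(i <- s) f i) <= \sum_(i <- s) normc (f i).
Proof.
elim: s => [|i s ih]; first by rewrite !big_nil normc0.
by rewrite !big_cons (le_trans (le_normcD _ _))// lerD2l.
Qed.

Section boolean_factor.
Context d (T : measurableType d) (R : realType).

Lemma cmeasurable_bool (P : T -> bool) : measurable [set x | P x] ->
  cmeasurable_fun setT (fun x => (P x)%:R : R[i]).
Proof.
move=> mP; split; last first.
  rewrite (_ : (fun x => _) = cst 0)//; apply/funext => x.
  by case: (P x).
rewrite (_ : (fun x => _) = \1_[set x | P x] :> (T -> R)); first exact: measurable_indic.
apply/funext => x; rewrite indicE; case: (boolP (P x)) => Px.
  by rewrite mem_set.
by rewrite memNset//; exact/negP.
Qed.

End boolean_factor.

Section planar_facts.
Variables (R : realType) (n : nat) (lambda : R[i]).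
Local Notation V := 'rV[R]_n.+1.
Local Notation nu := (@surface R n.+1).

Lemma normc_cexp_phase x (xi : V) : sphere n.+1 xi ->
  normc (cexp (phase lambda x xi)) <=
    expR (`|complex.Im lambda| * \sum_i `|x ord0 i|).
Proof.
move=> Sxi; rewrite normc_cexp ler_expR Re_phase.
rewrite (le_trans (ler_norm _))// normrM normrN ler_wpM2l//.
rewrite /dotv (le_trans (ler_norm_sum _ _ _))//; apply: ler_sum => i _.
by rewrite normrM ler_piMr// (le_trans (abs_coord_le_enorm _ _))// Sxi.
Qed.

Lemma cintegrable_planar (h : V -> R[i]) (q : V -> R) x :
  cmeasurable_fun setT h -> (forall xi, ~ sphere n.+1 xi -> h xi = 0) ->
  nu.-integrable setT (EFin \o q) -> (forall xi, normc (h xi) <= q xi) ->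
  cintegrable nu (fun xi => cexp (phase lambda x xi) * h xi).
Proof.
move=> mh hS qi hq.
apply: (@cintegrable_dominated _ _ _ _ _
  (fun xi => expR (`|complex.Im lambda| * \sum_i `|x ord0 i|) * q xi)).
- apply: cmeasurable_funM => //; apply: cmeasurable_cexp.
  have := cmeasurable_comp (pair1_measurable x) (@cmeasurable_phase R n lambda).
  exact.
- exact: (integrableZl measurableT _ qi).
move=> xi; have [Sxi|Sxi] := pselect (sphere n.+1 xi).
  by rewrite normcM ler_pM ?normc_ge0// normc_cexp_phase.
rewrite hS// mulr0 normc0 mulr_ge0 ?expR_ge0//.
exact: le_trans (normc_ge0 _) (hq xi).
Qed.

Lemma cmeasurable_planar (h : V -> R[i]) : cmeasurable_fun setT h ->
  cmeasurable_fun setT (planar lambda h).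
Proof.
move=> mh.
apply: (@cmeasurable_param_cintegral _ _ _ _ _ nu
  (fun z => cexp (phase lambda z.1 z.2) * h z.2)).
apply: cmeasurable_funM.
  by apply: cmeasurable_cexp; exact: cmeasurable_phase.
by apply: (cmeasurable_comp _ mh); exact: measurable_snd.
Qed.

End planar_facts.

(** * General amplitudes on a small piece of the sphere *)

(** All coordinates have modulus at most 1, so the sum of the [|x_i|] is at least the sum of the
    squares, which is 1. *)
Lemma sphere_big_coord (R : realType) n (x : 'rV[R]_n.+1) : sphere n.+1 x ->
  exists j, n.+1%:R^-1 <= `|x ord0 j|.
Proof.
move=> xS.
apply: contrapT => /forallNP H.
have : \sum_(i < n.+1) `|x ord0 i| < \sum_(i < n.+1) n.+1%:R^-1.
  apply: ltr_sum; first by apply/hasP; exists ord0; rewrite ?mem_index_enum.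
  by move=> i _; rewrite ltNge; apply/negP; exact: H.
rewrite sumr_const card_ord -[X in _ < X]mulr_natl divff//.
apply/negP; rewrite -leNgt.
rewrite -(dotv_sphere xS); apply: ler_sum => i _.
rewrite -expr2 -real_normK ?num_real// expr2 ler_piMr//.
by rewrite (le_trans (abs_coord_le_enorm _ _))// xS.
Qed.

Section cell_estimate.
Variables (R : realType) (n : nat) (lambda : R[i]).
Local Notation V := 'rV[R]_n.+1.
Local Notation S := (sphere n.+1).
Local Notation nu := (@surface R n.+1).
Local Notation leb := (@lebesgue_rV R n.+1).

Variables (mu kap B : R) (x0 : V) (D : set V).
Hypotheses (mD : measurable D) (mu0 : 0 < mu) (B0 : 0 <= B).
Hypotheses (Dk : forall xi, D xi -> forall i, `|xi ord0 i - x0 ord0 i| <= kap).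
Hypothesis kmu : kap * `|complex.Im lambda| <= mu / 4.
Hypothesis schurB : forall xi, D xi ->
  (\int[nu]_(eta in D) (prod_poisson mu (complex.Re lambda) xi eta)%:E <= B%:E)%E.
Hypotheses (DS : D `<=` S) (x0S : S x0).
Hypotheses (kap0 : 0 < kap) (kap1 : kap <= (4 * n.+1%:R)^-1).

Variables (a : V -> V -> R[i]) (N : nat).
Hypotheses (amp : amplitude a) (nN : (n.+1 <= N)%N).
Hypothesis aN : \forall x \ae leb, (CN_norm N (a x) <= 1)%E.

Variable g : V -> R[i].
Hypotheses (mg : cmeasurable_fun setT g) (gD : forall xi, ~ D xi -> g xi = 0).
Hypothesis gi : nu.-integrable setT (fun xi => (normc (g xi) ^+ 2)%:E).

Section grid.
Variable p : nat.
Local Notation J := {ffun 'I_n.+1 -> 'I_p.+2}.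

(** The cube of half-side [kap] around [x0] is cut into [p.+1] intervals per coordinate; with both
    endpoints there are [p.+2] nodes. *)
Let eta : R := 2 * kap / p.+1%:R.
Let lo : V := \row_i (x0 ord0 i - kap).
Let hi : V := \row_i (x0 ord0 i + kap).
Let pt (m : J) : V := lo + eta *: \row_j (m j : nat)%:R.
Let ix (xi : V) : J := [ffun j => inord (Num.truncn ((xi ord0 j - lo ord0 j) / eta))].

Let p0 : (0 : R) < p.+1%:R. Proof. by []. Qed.

Let eta0 : 0 < eta. Proof. by rewrite divr_gt0// mulr_gt0. Qed.

Let etap : eta * p.+1%:R = 2 * kap. Proof. by rewrite mulfVK// gt_eqF. Qed.

Let pt_box m : box lo hi (pt m).
Proof.
move=> i; rewrite !mxE lerDl mulr_ge0 ?(ltW eta0)//=.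
have : eta * (m i : nat)%:R <= eta * p.+1%:R.
  by rewrite ler_pM2l// ler_nat -ltnS ltn_ord.
rewrite etap; lra.
Qed.

(** Some coordinate of [x0] is at least [1 / d] in modulus with [d = n.+1], and moving by
    [kap <= 1 / (4 d)] leaves at least [3 / (4 d)]. The degree-zero extension is thus smooth on the
    whole box. *)
Let box_enorm z : box lo hi z -> (2 * n.+1%:R)^-1 <= enorm z.
Proof.
move=> zb.
have [j xj] := sphere_big_coord x0S.
apply: le_trans (abs_coord_le_enorm z j).
have := zb j; rewrite !mxE => /andP[z1 z2].
have zx : `|x0 ord0 j - z ord0 j| <= kap by rewrite ler_norml; apply/andP; split; lra.
have := ler_normD (x0 ord0 j - z ord0 j) (z ord0 j); rewrite subrK.
have d0 : (0 : R) < n.+1%:R by [].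
move: kap1; rewrite !invfM; move: xj.
move: (n.+1%:R^-1 : R) => q; lra.
Qed.

Let box_neq0 z : box lo hi z -> z != 0.
Proof.
move/box_enorm => H; rewrite -enorm_eq0 gt_eqF//; apply: lt_le_trans H.
by rewrite invr_gt0 mulr_gt0.
Qed.

(** The bound from [partials_off_sphere] for orders up to [n.+1] at distance [1 / (2 n.+1)] from the
    origin. In [wt], the factor 2 covers real and imaginary parts, and [be] gives one [eta] for each
    direction actually differenced. *)
Let M : R := (2 * n.+1%:R) ^+ n.+1.
Let be (t : 'I_p.+2) : R := if (t == 0 :> nat) then 1 else eta.
Let wt (t : J) : R := 2 * M * \prod_j be (t j).

Let M0 : 0 < M. Proof. by rewrite exprn_gt0// mulr_gt0. Qed.

Let be_ge0 t : 0 <= be t. Proof. by rewrite /be; case: ifP => // _; exact: ltW. Qed.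

Let wt_ge0 t : 0 <= wt t.
Proof. by rewrite mulr_ge0 ?prodr_ge0// mulr_ge0// ltW. Qed.

(** The sum of [be] over one coordinate is [1 + p.+1 * eta = 1 + 2 * kap <= 2], whatever [p].
    Independence of the mesh is what lets the estimate survive the limit. *)
Let sum_wt : \sum_t wt t <= 2 * M * 2 ^+ n.+1.
Proof.
rewrite -mulr_sumr ler_pM2l ?mulr_gt0// -(bigA_distr_bigA (fun _ : 'I_n.+1 => be)).
rewrite prodr_const card_ord; apply: lerXn2r; rewrite ?nnegrE ?sumr_ge0//.
rewrite big_ord_recl /be/= sumr_const card_ord -[eta *+ _]mulr_natr etap.
have : kap <= 4^-1.
  by apply: (le_trans kap1); rewrite lef_pV2 ?posrE ?mulr_gt0// ler_peMr// ler1n.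
lra.
Qed.

Let A x m := hom0 (a x) (pt m).
Let c x (t : J) : R[i] := grid_diff (A x) t.

Let real_part (h : V -> R) (t : J) : smooth_off0 h ->
  (forall t z, 0 < t -> h (t *: z) = h z) ->
  (forall s xi, (size s <= N)%N -> S xi -> `|partials s h xi| <= 1) ->
  `|grid_diff (fun m => h (pt m)) t| <= M * \prod_j be (t j).
Proof.
move=> sh hh h1.
rewrite -grid_pdiff_enum grid_pdiff_backdiff ?enum_uniq//.
set s := [seq i <- _ | _].
have su : uniq s by rewrite filter_uniq// enum_uniq.
have ss : (size s <= n.+1)%N by rewrite size_filter -[n.+1 in leqRHS]size_enum_ord count_size.
have rm : room eta lo hi s (pt t).
  split; first exact: pt_box.
  move=> i; rewrite mem_filter => /andP[ti _]; rewrite !mxE.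
  case: (val (t i)) ti => // u _; rewrite -natr1 mulrDr mulr1 addrA addrK.
  by rewrite lerDl mulr_ge0// ltW.
apply: (le_trans (@backdiff_bound _ _ eta lo hi eta0 s h M _ su rm _)); last first.
  rewrite mulrC ler_pM2l// le_eqVlt; apply/orP; left; apply/eqP.
  rewrite (bigID (fun j => (0 < t j)%N))/= [X in _ * X]big1 ?mulr1; last first.
    by move=> j; rewrite -leqNgt leqn0 /be => ->.
  rewrite (eq_bigr (fun=> eta)); last by move=> j; rewrite /be lt0n => /negbTE ->.
  by rewrite prodr_const -sum1_size big_filter big_enum_cond sum1_card.
move=> s' z ss' zb; split; last first.
  by move=> i; have [_] := sh s' z (box_neq0 zb); apply.
have s'N : (size s' <= n.+1)%N by exact: leq_trans ss.
have q0 : (0 : R) < (2 * n.+1%:R)^-1 by rewrite invr_gt0 mulr_gt0.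
apply: (le_trans (@partials_off_sphere _ _ h s' z 1 _ sh hh q0 (box_enorm zb) _)).
  by move=> xi Sxi; apply: h1 => //; exact: leq_trans nN.
rewrite mulr1 exprVn invrK /M.
by rewrite ler_weXn2l// mulr_ege1// ?ler1n.
Qed.

Let step_le (t : J) (xi : V) j := (lo ord0 j + eta * (t j : nat)%:R <= xi ord0 j).
Let h (t : J) (xi : V) : R[i] := (\prod_j (step_le t xi j)%:R) * g xi.

Let ix_itv xi j : D xi -> ((ix xi j : nat)%:R * eta <= xi ord0 j - lo ord0 j <=
  (ix xi j : nat)%:R * eta + eta) /\
  forall t : J, (t j <= ix xi j)%N = step_le t xi j.
Proof.
move=> Dxi; have := Dk Dxi j; rewrite ler_distl => /andP[d1 d2].
have u0 : 0 <= (xi ord0 j - lo ord0 j) / eta.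
  by rewrite divr_ge0 ?(ltW eta0)// mxE; lra.
(* The quotient is at most [p.+1], a value reached on the upper face of the cube, so [inord] does
   not truncate. *)
have ixE : ix xi j = Num.truncn ((xi ord0 j - lo ord0 j) / eta) :> nat.
  rewrite ffunE inordK// ltnS truncn_le_nat ltr_pdivrMr// -natr1 mulrDl mul1r.
  by rewrite [_ * eta]mulrC etap mxE; move: eta0 d1 d2; lra.
split; last first.
  by move=> t; rewrite ixE truncn_ge_nat// ler_pdivlMr// lerBrDl mulrC.
have := truncn_itv u0; rewrite -ixE ler_pdivlMr// ltr_pdivrMr// -natr1 mulrDl mul1r.
by move=> /andP[-> /ltW].
Qed.

Let mh t : cmeasurable_fun setT (h t).
Proof.
apply: cmeasurable_funM => //; apply: cmeasurable_prod => j.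
apply: cmeasurable_bool.
rewrite (_ : [set x | _] =
    [set x : V | `[lo ord0 j + eta * (t j : nat)%:R, +oo[%classic (x ord0 j)]).
  exact: measurable_coord_set.
by apply/seteqP; split => x /=; rewrite in_itv/= andbT.
Qed.

Let h_le t xi : normc (h t xi) <= normc (g xi).
Proof.
rewrite normcM ler_piMl ?normc_ge0// normc_prod.
apply: (@le_trans _ _ (\prod_(j < n.+1) 1)); last by rewrite big1.
apply: ler_prod => j _; rewrite normc_ge0/=.
by case: (step_le t xi j); rewrite ?normc1 ?normc0.
Qed.

Let hD t xi : ~ D xi -> h t xi = 0.
Proof. by move/gD => gx; rewrite /h gx mulr0. Qed.

Let amp_sum x xi : A x (ix xi) * g xi = \sum_t c x t * h t xi.
Proof.
have [Dxi|/gD gx] := pselect (D xi); last first.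
  by rewrite gx mulr0 big1// => t _; rewrite /h gx !mulr0.
rewrite (grid_summation (A x) (ix xi)) mulr_suml; apply: eq_bigr => t _.
rewrite /h mulrA [_ * grid_diff _ _]mulrC; congr (_ * _ * _).
by apply: eq_bigr => j _; have [_ ->] := ix_itv j Dxi.
Qed.

Definition approx x :=
  cintegral nu setT (fun xi => cexp (phase lambda x xi) * (A x (ix xi) * g xi)).

Let hS t xi : ~ S xi -> h t xi = 0.
Proof. by move=> Sxi; apply: hD => /DS. Qed.

Let gq : nu.-integrable setT (EFin \o (fun xi => normc (g xi))).
Proof. exact: integrable_normc. Qed.

Let approx_sum x : approx x = \sum_t c x t * planar lambda (h t) x.
Proof.
have hi' t := cintegrable_planar lambda x (mh t) (@hS t) gq (h_le t).
rewrite /planar; under eq_bigr do rewrite -(cintegralZ _ (hi' _)).2.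
rewrite -(cintegral_sum _ (fun t => (cintegralZ (c x t) (hi' t)).1)).2.
congr cintegral; apply/funext => xi.
by rewrite amp_sum mulr_sumr; apply: eq_bigr => t _; rewrite mulrCA.
Qed.

Let mc t : cmeasurable_fun setT (c ^~ t).
Proof.
apply: cmeasurable_sum => m; apply: cmeasurable_funM; last by split; exact: measurable_cst.
by case: amp => ma _ _; apply: ma; apply: normalize_sphere; apply: box_neq0; exact: pt_box.
Qed.

Lemma cmeasurable_approx : cmeasurable_fun setT approx.
Proof.
rewrite (_ : approx = fun x => \sum_t c x t * planar lambda (h t) x); last first.
  by apply/funext => x; exact: approx_sum.
by apply: cmeasurable_sum => t; apply: cmeasurable_funM => //; exact: cmeasurable_planar.
Qed.

Let c_le : \forall x \ae leb, forall t, normc (c x t) <= wt t.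
Proof.
apply: filterS aN => x ax t.
have [_ _ sm] := amp.
have RE : complex.Re (c x t) = grid_diff (fun m => complex.Re (A x m)) t.
  rewrite /c /grid_diff Re_sum; apply: eq_bigr => m _; rewrite ReM.
  have -> : \prod_j step_delta R[i] (m j) (t j) = (\prod_j step_delta R (m j) (t j))%:C.
    by rewrite rmorph_prod; apply: eq_bigr => j _; rewrite /step_delta rmorphB !rmorph_nat.
  by rewrite /= mulr0 subr0.
have IE : complex.Im (c x t) = grid_diff (fun m => complex.Im (A x m)) t.
  rewrite /c /grid_diff Im_sum; apply: eq_bigr => m _; rewrite ImM.
  have -> : \prod_j step_delta R[i] (m j) (t j) = (\prod_j step_delta R (m j) (t j))%:C.
    by rewrite rmorph_prod; apply: eq_bigr => j _; rewrite /step_delta rmorphB !rmorph_nat.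
  by rewrite /= mulr0 add0r.
have hr := @real_part (fun y => complex.Re (hom0 (a x) y)) t (sm x).1.
have hm := @real_part (fun y => complex.Im (hom0 (a x) y)) t (sm x).2.
rewrite (le_trans (normc_le_ReIm _))// RE IE /wt -mulrA mulr_natl mulr2n; apply: lerD.
  apply: hr => [t' z t0|s xi ss Sxi]; first by rewrite hom0_homogeneous.
  by have [] := CN_norm_partials ax ss Sxi.
apply: hm => [t' z t0|s xi ss Sxi]; first by rewrite hom0_homogeneous.
by have [] := CN_norm_partials ax ss Sxi.
Qed.

Lemma approx_estimate :
  (\int[leb]_x (expR (tilt lambda mu x0 x) * normc (approx x) ^+ 2)%:E <=
   ((2 * (2 * n.+1%:R) ^+ n.+1 * 2 ^+ n.+1) ^+ 2 * B)%:E *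
   \int[nu]_xi (normc (g xi) ^+ 2)%:E)%E.
Proof.
set G := (\int[nu]_xi _)%E.
pose W x := expR (tilt lambda mu x0 x).
pose P t x := normc (planar lambda (h t) x) ^+ 2.
have mW : measurable_fun setT W.
  by apply: measurableT_comp; [exact: measurable_expR|exact: measurable_tilt].
have mP t : measurable_fun setT (P t).
  by apply: measurable_funX; apply: cmeasurable_normc => //; exact: cmeasurable_planar.
have mE : measurable_fun setT (fun x => normc (approx x)).
  by apply: cmeasurable_normc => //; exact: cmeasurable_approx.
set Sw := \sum_t wt t.
have Sw0 : 0 <= Sw by exact: sumr_ge0.
have Pest t : (\int[leb]_x (W x * P t x)%:E <= B%:E * G)%E.
  have hi2 : nu.-integrable setT (fun xi => (normc (h t xi) ^+ 2)%:E).
    apply: le_integrable gi => //.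
      by apply/measurable_EFinP; apply: measurable_funX; exact: cmeasurable_normc.
    move=> xi _ /=; rewrite lee_fin !ger0_norm ?sqr_ge0//.
    by apply: lerXn2r; rewrite ?nnegrE ?normc_ge0.
  apply: (le_trans (planar_estimate mD mu0 B0 Dk kmu schurB (mh t) (@hD t) hi2)).
  apply: lee_wpmul2l; first by rewrite lee_fin.
  apply: ge0_le_integral => //.
  - by move=> xi _; rewrite lee_fin sqr_ge0.
  - by apply/measurable_EFinP; apply: measurable_funX; exact: cmeasurable_normc.
  - by apply/measurable_EFinP; apply: measurable_funX; exact: cmeasurable_normc.
  by move=> xi _; rewrite lee_fin; apply: lerXn2r; rewrite ?nnegrE ?normc_ge0.
(* Cauchy-Schwarz with weights [wt]. It produces one factor [Sw]; summing the estimates [Pest]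
   produces the second, hence the square in the constant. *)
apply: (@le_trans _ _ (\int[leb]_x (Sw%:E * \sum_t (wt t)%:E * (W x * P t x)%:E))%E).
  apply: ae_ge0_le_integral => //.
  - by move=> x _; rewrite lee_fin mulr_ge0 ?expR_ge0 ?sqr_ge0.
  - by apply/measurable_EFinP; apply: measurable_funM => //; exact: measurable_funX.
  - move=> x _; rewrite mule_ge0 ?lee_fin// sume_ge0// => t _.
    by rewrite -EFinM lee_fin mulr_ge0// mulr_ge0 ?expR_ge0 ?sqr_ge0.
  - apply: measurable_funeM; apply: emeasurable_sum => t; apply: measurable_funeM.
    by apply/measurable_EFinP; exact: measurable_funM.
  apply: filterS c_le => x cx _.
  under eq_bigr do rewrite -EFinM.
  rewrite sumEFin -EFinM lee_fin.
  under eq_bigr do rewrite mulrCA.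
  rewrite -mulr_sumr [leRHS]mulrCA -/(W x) ler_pM2l ?expR_gt0//.
  apply: le_trans (weighted_cauchy_schwarz _ wt_ge0).
  have s0 : 0 <= \sum_t wt t * normc (planar lambda (h t) x).
    by apply: sumr_ge0 => t _; rewrite mulr_ge0 ?normc_ge0.
  apply: lerXn2r; rewrite ?nnegrE ?normc_ge0//.
  rewrite approx_sum (le_trans (normc_sum _ _))//; apply: ler_sum => t _.
  by rewrite normcM ler_wpM2r ?normc_ge0.
rewrite ge0_integralZl_EFin//; last 2 first.
- move=> x _; rewrite sume_ge0// => t _.
  by rewrite -EFinM lee_fin mulr_ge0// mulr_ge0 ?expR_ge0 ?sqr_ge0.
- apply: emeasurable_sum => t; apply: measurable_funeM.
  by apply/measurable_EFinP; exact: measurable_funM.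
rewrite ge0_integral_sum//; last 2 first.
- by move=> t; apply: measurable_funeM; apply/measurable_EFinP; exact: measurable_funM.
- by move=> t x _; rewrite -EFinM lee_fin mulr_ge0// mulr_ge0 ?expR_ge0 ?sqr_ge0.
have G0 : (0 <= G)%E by apply: integral_ge0 => xi _; rewrite lee_fin sqr_ge0.
apply: (@le_trans _ _ (Sw%:E * \sum_t (wt t)%:E * (B%:E * G))%E).
  apply: lee_wpmul2l; first by rewrite lee_fin.
  apply: lee_sum => t _; rewrite ge0_integralZl_EFin//; last 2 first.
  - by move=> x _; rewrite lee_fin mulr_ge0 ?expR_ge0 ?sqr_ge0.
  - by apply/measurable_EFinP; exact: measurable_funM.
  by apply: lee_wpmul2l; rewrite ?lee_fin.
rewrite -ge0_sume_distrl; last by move=> t _; rewrite lee_fin.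
rewrite sumEFin !muleA -!EFinM; apply: lee_wpmul2r => //.
rewrite lee_fin; apply: ler_wpM2r => //.
have := sum_wt; rewrite -/Sw => Sle.
by rewrite -expr2; apply: lerXn2r; rewrite ?nnegrE// (le_trans _ Sle).
Qed.

Definition grid_point xi := pt (ix xi).

Lemma grid_point_neq0 xi : grid_point xi != 0.
Proof. by apply: box_neq0; exact: pt_box. Qed.

Lemma grid_point_close xi j : D xi ->
  `|xi ord0 j - grid_point xi ord0 j| <= 2 * kap / p.+1%:R.
Proof.
move=> Dxi; have [/andP[i1 i2] _] := ix_itv j Dxi; rewrite -/eta.
have -> : grid_point xi ord0 j = lo ord0 j + eta * (ix xi j : nat)%:R by rewrite !mxE.
by rewrite ler_norml; apply/andP; split; move: eta0 i1 i2; lra.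
Qed.

Lemma cmeasurable_grid_amplitude x :
  cmeasurable_fun setT (fun xi => hom0 (a x) (grid_point xi) * g xi).
Proof.
rewrite (_ : (fun xi => _) = fun xi => \sum_t c x t * h t xi); last first.
  by apply/funext => xi; exact: amp_sum.
by apply: cmeasurable_sum => t; exact: cmeasurable_funM.
Qed.

End grid.

Definition cell_operator x :=
  cintegral nu setT (fun xi => cexp (phase lambda x xi) * (a x xi * g xi)).

Let cvg_grid_point xi : D xi -> grid_point p xi @[p --> \oo] --> xi.
Proof.
move=> Dxi; apply/cvgrPdist_le => e e0.
have : (2 * kap / p.+1%:R) @[p --> \oo] --> (0 : R).
  rewrite -[X in _ --> X](mulr0 (2 * kap)); apply: cvgM; first exact: cvg_cst.
  exact: cvg_harmonic.
move=> /cvgrPdist_le /(_ e e0); apply: filterS => p.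
rewrite sub0r normrN ger0_norm; last first.
  by rewrite divr_ge0// mulr_ge0// ltW.
move=> pe; change (mx_norm (xi - grid_point p xi) <= e).
rewrite mx_normrE; apply: bigmax_le; first exact: ltW.
move=> [i j] _ /=; rewrite (ord1 i) mxE [X in _ + X]mxE.
exact: le_trans (grid_point_close p j Dxi) pe.
Qed.

Let cvg_amplitude (k : R[i] -> R) x xi : (k = @complex.Re R \/ k = @complex.Im R) ->
  D xi -> k (hom0 (a x) (grid_point p xi)) @[p --> \oo] --> k (a x xi).
Proof.
move=> kE Dxi; have Sxi := DS Dxi; have xi0 := sphere_neq0 Sxi.
have [_ _ sm] := amp.
have kc : {for xi, continuous (fun y => k (hom0 (a x) y))}.
  case: kE => ->.
    by have [+ _] := (sm x).1 [::] xi xi0.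
  by have [+ _] := (sm x).2 [::] xi xi0.
have -> : k (a x xi) = k (hom0 (a x) xi) by rewrite /hom0 normalize_id.
exact: (cvg_comp _ (fun y => k (hom0 (a x) y)) (cvg_grid_point Dxi) kc).
Qed.

Let gS xi : ~ S xi -> g xi = 0. Proof. by move=> Sxi; apply: gD => /DS. Qed.

Let amp_bound : {K : R | forall x xi, S xi -> normc (a x xi) <= K}.
Proof. by apply: cid; have [_ [K HK] _] := amp; exists K. Qed.

Lemma approx_cvg x :
  cintegrable nu (fun xi => cexp (phase lambda x xi) * (a x xi * g xi)) /\
  complex.Re (approx p x) @[p --> \oo] --> complex.Re (cell_operator x) /\
  complex.Im (approx p x) @[p --> \oo] --> complex.Im (cell_operator x).
Proof.
have [K HK] := amp_bound.
pose f p xi := cexp (phase lambda x xi) * (hom0 (a x) (grid_point p xi) * g xi).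
pose l xi := cexp (phase lambda x xi) * (a x xi * g xi).
(* A dominating function independent of [p]. The bound [K] from [amplitude] holds at every [x],
   whereas the bound on [CN_norm] is known only almost everywhere. *)
pose q xi := expR (`|complex.Im lambda| * \sum_i `|x ord0 i|) * (K * normc (g xi)).
have qi : nu.-integrable setT (EFin \o q).
  have := integrableZl measurableT K (integrable_normc mg gi).
  exact: (integrableZl measurableT).
have fq p xi : normc (f p xi) <= q xi.
  have [Sxi|/gS gx] := pselect (S xi); last first.
    by rewrite /f /q gx !mulr0 normc0 !mulr0.
  rewrite normcM; apply: ler_pM; rewrite ?normc_ge0//; first exact: normc_cexp_phase.
  rewrite normcM ler_wpM2r ?normc_ge0//; apply: HK.
  by apply: normalize_sphere; exact: grid_point_neq0.
have mf p : cmeasurable_fun setT (f p).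
  apply: cmeasurable_funM; last exact: cmeasurable_grid_amplitude.
  apply: cmeasurable_cexp.
  by have := cmeasurable_comp (pair1_measurable x) (@cmeasurable_phase R n lambda); exact.
have fl xi : complex.Re (f p xi) @[p --> \oo] --> complex.Re (l xi) /\
    complex.Im (f p xi) @[p --> \oo] --> complex.Im (l xi).
  have [Dxi|/gD gx] := pselect (D xi); last first.
    rewrite /f /l gx !mulr0; split.
      by under eq_cvg do rewrite !mulr0; exact: cvg_cst.
    by under eq_cvg do rewrite !mulr0; exact: cvg_cst.
  have cR := @cvg_amplitude _ x xi (or_introl erefl) Dxi.
  have cI := @cvg_amplitude _ x xi (or_intror erefl) Dxi.
  set w := cexp (phase lambda x xi) * g xi.
  have fE p : f p xi = w * hom0 (a x) (grid_point p xi).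
    by rewrite /f /w mulrA mulrAC.
  have lE : l xi = w * a x xi by rewrite /l /w mulrA mulrAC.
  rewrite lE (ReM w) (ImM w); split.
    under eq_cvg do rewrite fE (ReM w).
    exact: (cvgB (cvgM (cvg_cst _) cR) (cvgM (cvg_cst _) cI)).
  under eq_cvg do rewrite fE (ImM w).
  exact: (cvgD (cvgM (cvg_cst _) cI) (cvgM (cvg_cst _) cR)).
have key (k : R[i] -> R) : (forall z, `|k z| <= normc z) ->
    (forall p, measurable_fun setT (fun xi => k (f p xi))) ->
    (forall xi, k (f p xi) @[p --> \oo] --> k (l xi)) ->
    nu.-integrable setT (fun xi => (k (l xi))%:E) /\
    \int[nu]_xi k (f p xi) @[p --> \oo] --> \int[nu]_xi k (l xi).
  move=> kn mk kl.
  have mkl : measurable_fun setT (fun xi => k (l xi)).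
    by apply: (measurable_fun_cvg mk) => xi _; exact: kl.
  have mkE p : measurable_fun setT (fun xi => (k (f p xi))%:E).
    exact/measurable_EFinP.
  have mklE : measurable_fun setT (fun xi => (k (l xi))%:E) by exact/measurable_EFinP.
  have klE : \forall xi \ae nu, setT xi ->
      (k (f p xi))%:E @[p --> \oo] --> (k (l xi))%:E.
    by apply: aeW => xi _; apply: cvg_EFin; [exact: nearW|exact: kl].
  have fqE : \forall xi \ae nu, forall p, setT xi ->
      (`|(k (f p xi))%:E| <= (EFin \o q) xi)%E.
    by apply: aeW => xi p _; rewrite lee_fin (le_trans (kn _)).
  have [il _ H] := dominated_convergence measurableT mkE mklE klE qi fqE.
  by split => //; apply: fine_cvg; rewrite fineK//; exact: integrable_fin_num.
have [|p|xi|ir cr] := key (@complex.Re R); first exact: Re_le_normc.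
- exact: (mf p).1.
- exact: (fl xi).1.
have [|p|xi|ii ci] := key (@complex.Im R); first exact: Im_le_normc.
- exact: (mf p).2.
- exact: (fl xi).2.
by split.
Qed.

(** [amplitude] states measurability in [x] for each fixed [xi]. Measurability of the integral in
    [x] is inherited from the approximations, which involve finitely many values of [xi] each. *)
Lemma cmeasurable_cell_operator : cmeasurable_fun setT cell_operator.
Proof.
split.
  apply: (measurable_fun_cvg (h := fun p x => complex.Re (approx p x))).
    by move=> p; exact: (cmeasurable_approx p).1.
  by move=> x _; have [_ []] := approx_cvg x.
apply: (measurable_fun_cvg (h := fun p x => complex.Im (approx p x))).
  by move=> p; exact: (cmeasurable_approx p).2.
by move=> x _; have [_ []] := approx_cvg x.
Qed.

Lemma cell_estimate :
  (\int[leb]_x (expR (tilt lambda mu x0 x) * normc (cell_operator x) ^+ 2)%:E <=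
   ((2 * (2 * n.+1%:R) ^+ n.+1 * 2 ^+ n.+1) ^+ 2 * B)%:E *
   \int[nu]_xi (normc (g xi) ^+ 2)%:E)%E.
Proof.
set RHS := (_ * _)%E.
pose u p x := (expR (tilt lambda mu x0 x) * normc (approx p x) ^+ 2)%:E.
have mu_ p : measurable_fun setT (u p).
  apply/measurable_EFinP; apply: measurable_funM.
    by apply: measurableT_comp; [exact: measurable_expR|exact: measurable_tilt].
  by apply: measurable_funX; apply: cmeasurable_normc => //; exact: cmeasurable_approx.
have u0 p x : (0 <= u p x)%E by rewrite lee_fin mulr_ge0 ?expR_ge0 ?sqr_ge0.
have ul x : limn_einf (u ^~ x) =
    (expR (tilt lambda mu x0 x) * normc (cell_operator x) ^+ 2)%:E.
  apply: (cvg_limn_einf_sup _).1.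
  apply: cvg_EFin; first exact: nearW.
  apply: cvgM; first exact: cvg_cst.
  rewrite sqr_normc; under eq_cvg do rewrite sqr_normc.
  have [_ [cr ci]] := approx_cvg x.
  by apply: cvgD; rewrite expr2; under eq_cvg do rewrite expr2; exact: cvgM.
have := fatou leb measurableT mu_ (fun p x _ => u0 p x).
under eq_integral do rewrite ul.
move=> /le_trans; apply.
rewrite limn_einf_lim; apply: lime_le; first exact: is_cvg_einfs.
apply: nearW => p; apply: le_trans (approx_estimate p).
by apply: ereal_inf_lbound; exists p => /=.
Qed.

End cell_estimate.

(** * Cutting the sphere into cells *)

Section sphere_cells.
Variables (R : realType) (n : nat).
Local Notation V := 'rV[R]_n.+1.
Local Notation S := (sphere n.+1).

Lemma measurable_truncn_preimage (P : set nat) :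
  measurable [set x : R | P (Num.truncn x)].
Proof.
rewrite (_ : [set _ | _] = \bigcup_(m in P) [set x : R | Num.truncn x = m]); last first.
  apply/seteqP; split => [x Px|x [m Pm /= xm]]; first by exists (Num.truncn x).
  by rewrite /= xm.
apply: bigcup_measurable => m _.
have mgt (k : nat) : measurable [set x : R | (k < Num.truncn x)%N].
  rewrite (_ : [set _ | _] = `[k.+1%:R, +oo[%classic)//.
  by apply/seteqP; split => x /=; rewrite in_itv/= andbT truncn_gt_nat.
case: m => [|m].
  rewrite (_ : [set _ | _] = ~` [set x : R | (0 < Num.truncn x)%N]).
    exact: measurableC.
  apply/seteqP; split => x /=; first by move=> ->.
  by rewrite lt0n => /negP; rewrite negbK => /eqP.
rewrite (_ : [set _ | _] = [set x : R | (m < Num.truncn x)%N] `\`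
  [set x : R | (m.+1 < Num.truncn x)%N]); first exact: measurableD.
apply/seteqP; split => x /=; first by move=> ->; rewrite ltnn.
by move=> [h1 /negP]; rewrite -leqNgt => h2; apply/eqP; rewrite eqn_leq h1 h2.
Qed.

Variables (l : R) (K : nat).

(* A cell collects the points whose first coordinate of modulus at least [1 / d] is
   the [j]-th one, with a given sign, and whose other coordinates lie in a given
   lattice cell of side [l]. The [j]-th coordinate is then a Lipschitz function of
   the others, so that cells have diameter [O(l)], and there are [O(l ^- n)] of
   them. *)
Definition coord_data (t : R) : bool * bool * 'I_K.+1 :=
  (n.+1%:R^-1 <= `|t|, 0 <= t, inord (Num.truncn ((t + 1) / l))).

Definition cell_index := ('I_n.+1 * bool * {ffun 'I_n -> 'I_K.+1})%type.

Definition cell_of_data (b : {ffun 'I_n.+1 -> bool * bool * 'I_K.+1}) : cell_index :=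
  let j := odflt ord0 [pick j | (b j).1.1] in
  (j, (b j).1.2, [ffun i => (b (lift j i)).2]).

Definition cell_of (x : V) : cell_index :=
  cell_of_data [ffun j => coord_data (x ord0 j)].

Definition cell (c : cell_index) : set V := [set x | S x /\ cell_of x = c].

(** [cell_of] factors through finitely many coordinate data, each depending on one coordinate, so up
    to intersection with the sphere a cell is a finite union of finite intersections of
    one-coordinate sets. *)
Lemma measurable_cell c : measurable (cell c).
Proof.
apply: measurableI; first exact: measurable_sphere.
rewrite [X in measurable X](_ : _ = \bigcup_(b in [set b | cell_of_data b = c])
    \bigcap_(j in [set: 'I_n.+1]) [set x : V | coord_data (x ord0 j) = b j]); last first.
  apply/seteqP; split => x.
    by move=> /= xc; exists [ffun j => coord_data (x ord0 j)] => // j _ /=; rewrite ffunE.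
  move=> [b /= <- bx]; congr cell_of_data; apply/ffunP => j.
  by rewrite ffunE; exact: bx.
apply: fin_bigcup_measurable; first exact: finite_finset.
move=> b _; apply: fin_bigcap_measurable; first exact: finite_finset.
move=> j _; apply: (measurable_coord_set j (A := [set t | coord_data t = b j])).
case: (b j) => [[b1 b2] k].
rewrite (_ : [set t | _] = [set t : R | (n.+1%:R^-1 <= `|t|) = b1] `&`
   [set t : R | (0 <= t) = b2] `&`
   [set t : R | [set m | inord m = k] (Num.truncn ((t + 1) / l))]); last first.
  by apply/seteqP; split => t /=; [move=> [-> -> ->]|move=> [[<- <-] <-]].
have mle (f : R -> R) (u : R) b0 : measurable_fun setT f ->
    measurable [set t | (u <= f t) = b0].
  move=> mf; have m1 : measurable [set t | u <= f t].
    rewrite -[X in measurable X]setTI (_ : [set t | _] = f @^-1` `[u, +oo[%classic).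
      exact: mf.
    by apply/seteqP; split => t /=; rewrite in_itv/= andbT.
  case: b0 => //.
  rewrite (_ : [set t | _] = ~` [set t | u <= f t]); first exact: measurableC.
  by apply/seteqP; split => t /= => [->//|/negP/negbTE].
apply: measurableI; first apply: measurableI.
- by apply: mle; exact: normr_measurable.
- exact: mle.
have mf : measurable_fun setT (fun t : R => (t + 1) / l).
  by apply: measurable_funM => //; exact: measurable_funD.
rewrite -[X in measurable X]setTI.
exact: mf (measurable_truncn_preimage [set m | inord m = k]).
Qed.

Hypotheses (l0 : 0 < l) (lK : 2 / l < K.+1%:R).

Lemma cell_diam c x y i : cell c x -> cell c y ->
  `|x ord0 i - y ord0 i| <= n.+1%:R ^+ 2 * l.
Proof.
move=> [xS xc] [yS yc].
have d0 : (0 : R) < n.+1%:R by [].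
pose j := c.1.1.
have big (z : V) : S z -> cell_of z = c -> n.+1%:R^-1 <= `|z ord0 j|.
  move=> zS zc; rewrite /j -zc /cell_of /cell_of_data/=.
  case: pickP => [k|H]; first by rewrite ffunE.
  by have [k zk] := sphere_big_coord zS; have := H k; rewrite ffunE/= zk.
have sgnE (z : V) : cell_of z = c -> (0 <= z ord0 j) = c.1.2.
  by move=> zc; rewrite /j -zc /cell_of /cell_of_data/= ffunE.
have levE (z : V) k : cell_of z = c ->
    inord (Num.truncn ((z ord0 (lift j k) + 1) / l)) = c.2 k :> 'I_K.+1.
  by move=> zc; rewrite /j -zc /cell_of /cell_of_data/= !ffunE.
have le1 (z : V) k : S z -> `|z ord0 k| <= 1.
  by move=> zS; rewrite -[leRHS](zS : enorm z = 1) abs_coord_le_enorm.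
have lev (z : V) k : S z -> cell_of z = c ->
    (c.2 k : nat)%:R * l <= z ord0 (lift j k) + 1 <= (c.2 k : nat)%:R * l + l.
  move=> zS zc; have := le1 z (lift j k) zS; rewrite ler_norml => /andP[z1 z2].
  have u0 : 0 <= (z ord0 (lift j k) + 1) / l by rewrite divr_ge0 ?(ltW l0)//; lra.
  have cE : c.2 k = Num.truncn ((z ord0 (lift j k) + 1) / l) :> nat.
    rewrite -(levE z k zc) inordK// truncn_lt_nat//; apply: le_lt_trans lK.
    by rewrite ler_pM2r ?invr_gt0//; lra.
  have := truncn_itv u0; rewrite -cE ler_pdivlMr// ltr_pdivrMr//.
  by rewrite -natr1 mulrDl mul1r => /andP[-> /ltW].
have off k : `|x ord0 (lift j k) - y ord0 (lift j k)| <= l.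
  have /andP[x1 x2] := lev x k xS xc; have /andP[y1 y2] := lev y k yS yc.
  by rewrite ler_norml; apply/andP; split; lra.
have d1 : (1 : R) <= n.+1%:R by rewrite ler1n.
have [->|] := eqVneq i j; last first.
  rewrite eq_sym => /unlift_some[k -> _]; apply: (le_trans (off k)).
  by rewrite ler_peMl ?(ltW l0)// exprn_ege1.
have sq (z : V) : S z -> z ord0 j ^+ 2 + \sum_(k < n) z ord0 (lift j k) ^+ 2 = 1.
  by move=> /dotv_sphere; rewrite /dotv (bigD1_ord j)//= => <-.
(* Difference of the two equations of the sphere. The second factor is at least [2 / n.+1] in
   modulus because both coordinates are large and of the same sign; the right-hand side is at most
   [2 n l]. *)
have E : (x ord0 j - y ord0 j) * (x ord0 j + y ord0 j) =
    \sum_(k < n) (y ord0 (lift j k) - x ord0 (lift j k)) *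
                 (y ord0 (lift j k) + x ord0 (lift j k)).
  transitivity (\sum_(k < n) (y ord0 (lift j k) ^+ 2 - x ord0 (lift j k) ^+ 2)).
    by rewrite sumrB; have := sq x xS; have := sq y yS; lra.
  by apply: eq_bigr => k _; ring.
have sum_le : `|x ord0 j - y ord0 j| * `|x ord0 j + y ord0 j| <= n%:R * (2 * l).
  rewrite -normrM E (le_trans (ler_norm_sum _ _ _))//.
  apply: (@le_trans _ _ (\sum_(k < n) 2 * l)); last first.
    by rewrite sumr_const card_ord -[leLHS]mulr_natl.
  apply: ler_sum => k _; rewrite normrM mulrC; apply: ler_pM => //.
    apply: (le_trans (ler_normD _ _)).
    by have := le1 x (lift j k) xS; have := le1 y (lift j k) yS; lra.
  by rewrite distrC.
have big2 : 2 / n.+1%:R <= `|x ord0 j + y ord0 j|.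
  have := big x xS xc; have := big y yS yc.
  have := sgnE x xc; have := sgnE y yc; case: (c.1.2) => ys xs.
    rewrite !ger0_norm ?addr_ge0 ?ys ?xs//; move: (n.+1%:R^-1 : R) => q; lra.
  have y0 : y ord0 j < 0 by rewrite ltNge ys.
  have x0 : x ord0 j < 0 by rewrite ltNge xs.
  have s0 : x ord0 j + y ord0 j < 0 by lra.
  rewrite !ltr0_norm//; move: (n.+1%:R^-1 : R) => q; lra.
have nn : n%:R <= n.+1%:R :> R by rewrite ler_nat.
have : `|x ord0 j - y ord0 j| * (2 / n.+1%:R) <= n%:R * (2 * l).
  by apply: le_trans sum_le; rewrite ler_wpM2l.
rewrite [leLHS]mulrA ler_pdivrMr// => H.
have : n%:R * (2 * l) * n.+1%:R <= 2 * (n.+1%:R ^+ 2 * l).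
  have -> : 2 * (n.+1%:R ^+ 2 * l) = n.+1%:R * (2 * l) * n.+1%:R by ring.
  by rewrite ler_pM2r// ler_pM2r// mulr_gt0.
lra.
Qed.

Lemma card_cell_index : #|{: cell_index}| = (n.+1 * 2 * K.+1 ^ n)%N.
Proof. by rewrite !card_prod card_bool card_ffun !card_ord. Qed.

End sphere_cells.

(** * Assembling the estimate *)

(** Expanding the square of [z - |z| y] with [|y| = 1] gives [z.y <= |z|], used for [x] and
    [- x]. *)
Lemma abs_dotv_le (R : realType) d (x y : 'rV[R]_d) : sphere d y ->
  `|dotv x y| <= enorm x.
Proof.
move=> yS.
have H (z : 'rV[R]_d) : dotv z y <= enorm z.
  have [z0|z0] := eqVneq (enorm z) 0.
    move/eqP: z0; rewrite enorm_eq0 => /eqP ->.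
    by rewrite /dotv big1 ?enorm_ge0// => i _; rewrite mxE mul0r.
  have zp : 0 < enorm z by rewrite lt_def z0 enorm_ge0.
  have := dotv_ge0 (z - enorm z *: y).
  have -> : dotv (z - enorm z *: y) (z - enorm z *: y) =
      dotv z z - 2 * enorm z * dotv z y + enorm z ^+ 2 * dotv y y.
    rewrite /dotv !mulr_sumr -sumrB -big_split/=; apply: eq_bigr => i _.
    by rewrite !mxE; ring.
  rewrite (dotv_sphere yS).
  have -> : dotv z z = enorm z ^+ 2 by rewrite sqr_sqrtr ?dotv_ge0.
  move=> h; rewrite -(ler_pM2l zp); move: h; nra.
rewrite ler_norml H andbT lerNl.
have := H (- x); rewrite -scaleN1r enormZ normrN1 mul1r.
by rewrite /dotv -sumrN; under eq_bigr do rewrite !mxE mulN1r mulNr.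
Qed.

Lemma sum_abs_le_enorm (R : realType) d (x : 'rV[R]_d) :
  \sum_i `|x ord0 i| <= d%:R * enorm x.
Proof.
rewrite mulr_natl -[X in _ *+ X]card_ord -sumr_const.
by apply: ler_sum => i _; exact: abs_coord_le_enorm.
Qed.

Section weights.
Variables (R : realType) (n : nat) (lambda : R[i]) (r delta : R).
Hypotheses (r0 : 0 < r) (delta01 : 0 < delta <= 1).

(** Since the l1 norm is at most [n.+1] times the Euclidean one, the first term costs at most [n.+1]
    in the exponent on the ball, and the second at most [2 (delta / 3) |t| |x|]. The latter is what
    [1 + delta / 3 <= sqrt (1 + delta)] provides in the squared weight. *)
Definition decay : R := r^-1 + 2 * delta * `|complex.Im lambda| / (3 * n.+1%:R).

Lemma decay_gt0 : 0 < decay.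
Proof.
case/andP: delta01 => d0 _; apply: ltr_pwDl; first by rewrite invr_gt0.
by rewrite divr_ge0// !mulr_ge0// ltW.
Qed.

Lemma weight_le_tilt (x x0 : 'rV[R]_n.+1) : sphere n.+1 x0 -> eball r x ->
  weight delta lambda x ^+ 2 <= expR n.+1%:R * expR (tilt lambda decay x0 x).
Proof.
move=> x0S xr; case/andP: delta01 => d0 d1.
rewrite -expRD /weight -expRM_natl ler_expR /tilt /decay.
have := abs_dotv_le x x0S; have := sum_abs_le_enorm x.
have xr' : enorm x < r := xr.
move: xr' (enorm_ge0 x); move: (enorm x) => X Xr X0 sX.
have s0 : 0 <= \sum_i `|x ord0 i| by exact: sumr_ge0.
move: sX s0; move: (\sum_i _) (dotv x x0) => Y Z YX Y0 ZX.
set T := complex.Im lambda.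
have sq : 1 + delta / 3 <= Num.sqrt (1 + delta).
  rewrite -[leLHS]ger0_norm; last by rewrite addr_ge0// divr_ge0// ltW.
  by rewrite -sqrtr_sqr ler_sqrt; nra.
have TZ : - (`|T| * X) <= T * Z.
  have := ler_norm (- (T * Z)); rewrite normrN normrM.
  have : `|T| * `|Z| <= `|T| * X by rewrite ler_wpM2l.
  lra.
have Yr : r^-1 * Y <= n.+1%:R.
  rewrite mulrC ler_pdivrMr//; apply: (le_trans YX).
  by rewrite ler_wpM2l// ltW.
have TX : 0 <= `|T| * X by rewrite mulr_ge0.
have sTX : (1 + delta / 3) * (`|T| * X) <= Num.sqrt (1 + delta) * (`|T| * X).
  by rewrite ler_wpM2r.
have YT : 2 * delta * `|T| / (3 * n.+1%:R) * Y <= 2 * (delta / 3) * (`|T| * X).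
  have -> : 2 * (delta / 3) * (`|T| * X) =
    2 * delta * `|T| / (3 * n.+1%:R) * (n.+1%:R * X) by field.
  by rewrite ler_wpM2l// divr_ge0// !mulr_ge0// ltW.
rewrite [(_ + _) * Y]mulrDl -[_ * `|T| * X]mulrA -[2 * T * Z]mulrA.
move: Yr YT TZ sTX; rewrite [(1 + _) * _]mulrDl mul1r -[2 * (delta / 3) * _]mulrA.
move: (r^-1 * Y) (2 * delta * `|T| / (3 * n.+1%:R) * Y) (T * Z).
move: (Num.sqrt (1 + delta) * (`|T| * X)) (delta / 3 * (`|T| * X)) (`|T| * X).
move=> *; lra.
Qed.

End weights.

(** * Splitting a function on the sphere over the cells *)

Section cell_decomposition.
Variables (R : realType) (n : nat).
Local Notation V := 'rV[R]_n.+1.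
Local Notation S := (sphere n.+1).
Local Notation nu := (@surface R n.+1).
Local Notation leb := (@lebesgue_rV R n.+1).

Variables (l : R) (K : nat) (g : V -> R[i]).
Hypothesis mg : cmeasurable_fun S g.
Hypothesis gi : (\int[nu]_(xi in S) (normc (g xi) ^+ 2)%:E < +oo)%E.

(** [g] is arbitrary off the sphere; extension by zero makes it measurable everywhere and lets
    integrals run over the whole space. *)
Definition on_sphere xi : R[i] := if xi \in S then g xi else 0.

Definition on_cell (c : cell_index n K) xi : R[i] :=
  (xi \in cell l c)%:R * on_sphere xi.

Lemma cmeasurable_on_sphere : cmeasurable_fun setT on_sphere.
Proof.
case: mg => gr gm; split.
  rewrite (_ : (fun x => _) = (fun x => complex.Re (g x)) \_ S).
    exact: (measurable_restrictT _ (@measurable_sphere _ _)).1 gr.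
  by apply/funext => x; rewrite patchE /on_sphere; case: ifP.
rewrite (_ : (fun x => _) = (fun x => complex.Im (g x)) \_ S).
  exact: (measurable_restrictT _ (@measurable_sphere _ _)).1 gm.
by apply/funext => x; rewrite patchE /on_sphere; case: ifP.
Qed.

Lemma cmeasurable_on_cell c : cmeasurable_fun setT (on_cell c).
Proof.
apply: cmeasurable_funM; last exact: cmeasurable_on_sphere.
apply: cmeasurable_bool; rewrite (_ : [set x | _] = cell l c).
  exact: measurable_cell.
by apply/seteqP; split => x /=; rewrite inE.
Qed.

Lemma on_cell_out c xi : ~ cell l c xi -> on_cell c xi = 0.
Proof. by move=> H; rewrite /on_cell memNset// mul0r. Qed.

Lemma sum_on_cell (k : R[i] -> R[i]) xi : k 0 = 0 ->
  \sum_c k (on_cell c xi) = k (on_sphere xi).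
Proof.
move=> k0; have [xS|xS] := pselect (S xi); last first.
  rewrite /on_sphere memNset// big1 ?k0// => c _.
  by rewrite /on_cell /on_sphere [xi \in S]memNset// mulr0 k0.
rewrite (bigD1 (cell_of l K xi))//= big1 => [|c cx].
  by rewrite addr0 /on_cell mem_set// mul1r.
by rewrite on_cell_out// => -[_ /esym/eqP]; apply/negP.
Qed.

Lemma integral_on_sphere : (\int[nu]_xi (normc (on_sphere xi) ^+ 2)%:E =
  \int[nu]_(xi in S) (normc (g xi) ^+ 2)%:E)%E.
Proof.
rewrite [RHS]integral_mkcond; apply: eq_integral => xi _.
by rewrite patchE /on_sphere; case: ifP => // _; rewrite normc0 expr0n.
Qed.

Lemma integrable_on_cell c : nu.-integrable setT (fun xi => (normc (on_cell c xi) ^+ 2)%:E).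
Proof.
have mc h : cmeasurable_fun setT h ->
    measurable_fun setT (fun xi : V => (normc (h xi) ^+ 2)%:E).
  by move=> mh; apply/measurable_EFinP; apply: measurable_funX; exact: cmeasurable_normc.
have : nu.-integrable setT (fun xi => (normc (on_sphere xi) ^+ 2)%:E).
  apply/integrableP; split; first by apply: mc; exact: cmeasurable_on_sphere.
  under eq_integral do rewrite gee0_abs ?lee_fin ?sqr_ge0//.
  by rewrite integral_on_sphere.
apply: le_integrable => //; first by apply: mc; exact: cmeasurable_on_cell.
move=> xi _ /=; rewrite lee_fin !ger0_norm ?sqr_ge0//.
apply: lerXn2r; rewrite ?nnegrE ?normc_ge0// /on_cell normcM ler_piMl ?normc_ge0//.
by case: (_ \in _); rewrite ?normc0 ?normc1.
Qed.

Lemma sum_integral_on_cell :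
  (\sum_c \int[nu]_xi (normc (on_cell c xi) ^+ 2)%:E =
   \int[nu]_(xi in S) (normc (g xi) ^+ 2)%:E)%E.
Proof.
rewrite -integral_on_sphere -ge0_integral_sum//; last 2 first.
- move=> c; apply/measurable_EFinP; apply: measurable_funX.
  by apply: cmeasurable_normc => //; exact: cmeasurable_on_cell.
- by move=> c xi _; rewrite lee_fin sqr_ge0.
apply: eq_integral => xi _; rewrite sumEFin; congr EFin.
have [xS|xS] := pselect (S xi); last first.
  rewrite /on_sphere memNset// big1 ?normc0 ?expr0n// => c _.
  by rewrite /on_cell /on_sphere [xi \in S]memNset// mulr0 normc0 expr0n.
rewrite (bigD1 (cell_of l K xi))//= big1 => [|c cx].
  by rewrite addr0 /on_cell mem_set// mul1r.
rewrite on_cell_out ?normc0 ?expr0n// => -[_ /esym/eqP]; exact/negP.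
Qed.

End cell_decomposition.

Section square_estimate.
Variables (R : realType) (n : nat).
Local Notation V := 'rV[R]_n.+1.
Local Notation S := (sphere n.+1).
Local Notation nu := (@surface R n.+1).
Local Notation leb := (@lebesgue_rV R n.+1).

Lemma poisson_normr (mu s u : R) : poisson mu s u = poisson mu `|s| u.
Proof. by rewrite /poisson !exprMn real_normK ?num_real. Qed.

(** [Q] stands for the Schur bound up to a constant, through either [schur_near] or [schur_far].
    Leaving it free separates the choice of regime from the analysis and keeps the case [lambda = 0]
    available. *)
Lemma square_estimate : exists2 C : R, 0 < C &
  forall (lambda : R[i]) (r delta Q : R) (N : nat) (a : V -> V -> R[i]) (g : V -> R[i]),
  0 < r -> 0 < delta <= 1 -> (n.+1 <= N)%N ->
  amplitude a -> (\forall x \ae leb, (CN_norm N (a x) <= 1)%E) ->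
  cmeasurable_fun S g -> (\int[nu]_(xi in S) (normc (g xi) ^+ 2)%:E < +oo)%E ->
  let mu := decay n lambda r delta in
  (delta / (6 * n.+1%:R)) ^+ n / mu ^+ n.+1 <= Q \/
    (complex.Re lambda != 0 /\ `|complex.Re lambda| ^- n / mu <= Q) ->
  (\int[leb]_(x in eball r)
     (weight delta lambda x ^+ 2 * normc (extension a lambda g x) ^+ 2)%:E <=
   (C * (delta ^- n * Q))%:E * \int[nu]_(xi in S) (normc (g xi) ^+ 2)%:E)%E.
Proof.
have [C1 C10 H1] := @schur_near R n.
have [C2 C20 H2] := @schur_far R n.
pose K0 : R := (2 * (2 * n.+1%:R) ^+ n.+1 * 2 ^+ n.+1) ^+ 2.
(* There are [2 n.+1 K.+1 ^ n] cells, and [K.+1 <= 2 / l + 1 <= 3 / l = 18 n.+1 ^ 3 / delta]. *)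
pose cI : R := 2 * n.+1%:R * (18 * n.+1%:R ^+ 3) ^+ n.
have d0 : (0 : R) < n.+1%:R by [].
have d1 : (1 : R) <= n.+1%:R by rewrite ler1n.
have d3 : (0 : R) < n.+1%:R ^+ 3 by rewrite exprn_gt0.
have K00 : 0 < K0 by rewrite !(exprn_gt0, mulr_gt0).
have cI0 : 0 < cI by rewrite !(exprn_gt0, mulr_gt0).
exists (cI * expR n.+1%:R * K0 * (C1 + C2)).
  by rewrite !mulr_gt0 ?expR_gt0 ?addr_gt0.
move=> lambda r delta Q N a g r0 dl nN amp aN mg gi mu HQ.
have mu0 : 0 < mu by exact: decay_gt0.
have /andP[de0 de1] := dl.
(* Chosen so that the diameter bound [n.+1 ^ 2 * l] of [cell_diam] is [kap]. In turn [kap |t|] is a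
   quarter of the second term of [decay], hence at most [mu / 4]. *)
pose l := delta / (6 * n.+1%:R ^+ 3).
pose kap := delta / (6 * n.+1%:R).
have l0 : 0 < l by rewrite divr_gt0 ?mulr_gt0.
have kap0 : 0 < kap by rewrite divr_gt0 ?mulr_gt0.
pose K := Num.truncn (2 / l).
have lK : 2 / l < K.+1%:R by exact: truncnS_gt.
have kapE : n.+1%:R ^+ 2 * l = kap.
  by rewrite /l /kap; field; rewrite gt_eqF.
have kap1 : kap <= (4 * n.+1%:R)^-1.
  rewrite /kap ler_pdivrMr ?mulr_gt0//.
  have -> : (4 * n.+1%:R)^-1 * (6 * n.+1%:R) = 3 / 2 :> R by field; rewrite gt_eqF.
  lra.
have kmu : kap * `|complex.Im lambda| <= mu / 4.
  have -> : mu / 4 = r^-1 / 4 + kap * `|complex.Im lambda|.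
    by rewrite /mu /decay /kap; field; rewrite !gt_eqF.
  by rewrite lerDr divr_ge0// invr_ge0 ltW.
have Q0 : 0 <= Q.
  case: HQ => [|[_]]; apply: le_trans.
    by rewrite divr_ge0 ?exprn_ge0 ?ltW.
  by rewrite divr_ge0 ?invr_ge0 ?exprn_ge0// ltW.
pose B := (C1 + C2) * Q.
have B0 : 0 <= B by rewrite mulr_ge0// addr_ge0// ltW.
pose gc := on_cell (K := K) l g.
pose W (x : V) := weight delta lambda x.
have W0 x : 0 <= W x by exact: expR_ge0.
have mW : measurable_fun setT W.
  rewrite (_ : W = fun x =>
      expR (- (Num.sqrt (1 + delta) * `|complex.Im lambda|) * enorm x)); last first.
    by apply/funext => x; rewrite mulNr.
  apply: measurableT_comp; first exact: measurable_expR.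
  by apply: measurable_funM => //; exact: measurable_enorm.
pose cop (c : cell_index n K) := cell_operator lambda a (gc c).
have mball := @measurable_eball R n.+1 r.
have cell_bound c : [/\ cmeasurable_fun setT (cop c),
    forall x, cintegrable nu (fun xi => cexp (phase lambda x xi) * (a x xi * gc c xi)) &
    (\int[leb]_(x in eball r) (W x ^+ 2 * normc (cop c x) ^+ 2)%:E <=
     (expR n.+1%:R * (K0 * B))%:E * \int[nu]_xi (normc (gc c xi) ^+ 2)%:E)%E].
  (* The centre [x0] of the tilt must be a point of the cell; an empty cell contributes the zero
     operator. *)
  have [c0|/set0P[x0 cx0]] := eqVneq (cell l c) set0.
    have gc0 xi : gc c xi = 0 by apply: on_cell_out; rewrite c0.
    have E x : (fun xi => cexp (phase lambda x xi) * (a x xi * gc c xi)) = fun=> 0.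
      by apply/funext => xi; rewrite gc0 !mulr0.
    have cop0 x : cop c x = 0.
      by rewrite /cop /cell_operator E /cintegral /Rintegral !integral0.
    split.
    - by rewrite (_ : cop c = fun=> 0); [split; exact: measurable_cst|exact/funext].
    - by move=> x; rewrite E; split; exact: integrable0.
    rewrite integral0_eq; last by move=> x _; rewrite cop0 normc0 expr0n mulr0.
    apply: mule_ge0; last by apply: integral_ge0 => xi _; rewrite lee_fin sqr_ge0.
    by rewrite lee_fin mulr_ge0 ?expR_ge0// mulr_ge0// ltW.
  have x0S : S x0 by case: cx0.
  have mD := measurable_cell l c.
  have Dk xi : cell l c xi -> forall i, `|xi ord0 i - x0 ord0 i| <= kap.
    by move=> cxi i; rewrite -kapE; apply: (cell_diam l0 lK); [exact: cxi|exact: cx0].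
  have DS : cell l c `<=` S by move=> xi [].
  have schurB xi : cell l c xi ->
    (\int[nu]_(eta in cell l c) (prod_poisson mu (complex.Re lambda) xi eta)%:E <= B%:E)%E.
    move=> cxi; case: HQ => [HQ|[s0 HQ]].
      apply: (le_trans (@H1 mu _ kap x0 xi _ mD mu0 kap0 _)).
        by move=> eta ce; split; [exact: DS|move=> i; exact: Dk].
      rewrite lee_fin; apply: ler_pM => //; first exact: ltW.
        by rewrite divr_ge0 ?exprn_ge0 ?(ltW kap0) ?(ltW mu0).
      by rewrite lerDl ltW.
    have s0' : 0 < `|complex.Re lambda| by rewrite normr_gt0.
    have pE eta : prod_poisson mu (complex.Re lambda) xi eta =
        prod_poisson mu `|complex.Re lambda| xi eta.
      by apply: eq_bigr => i _; rewrite poisson_normr.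
    under eq_integral do rewrite pE.
    apply: (le_trans (@H2 mu _ xi _ mD mu0 s0' DS (DS _ cxi))).
    rewrite lee_fin; apply: ler_pM => //; first exact: ltW.
      by rewrite divr_ge0 ?invr_ge0 ?exprn_ge0 ?(ltW mu0).
    by rewrite lerDr ltW.
  have gcD xi : ~ cell l c xi -> gc c xi = 0 by exact: on_cell_out.
  have mgc : cmeasurable_fun setT (gc c) by exact: cmeasurable_on_cell.
  have gci := integrable_on_cell l mg gi c.
  have mcop : cmeasurable_fun setT (cop c).
    exact: (cmeasurable_cell_operator lambda Dk DS x0S kap0 kap1 amp mgc gcD gci).
  split => //.
    move=> x.
    by have [] := approx_cvg lambda Dk DS x0S kap0 kap1 amp mgc gcD gci x.
  have CE := cell_estimate mD mu0 B0 Dk kmu schurB DS x0S kap0 kap1 amp nN aN mgc gcD gci.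
  pose T (x : V) := expR (tilt lambda mu x0 x).
  have T0 x : 0 <= T x by exact: expR_ge0.
  have T1 x : 0 <= T x * normc (cop c x) ^+ 2 by rewrite mulr_ge0 ?sqr_ge0.
  have T2 x : 0 <= expR n.+1%:R * (T x * normc (cop c x) ^+ 2).
    by rewrite mulr_ge0 ?expR_ge0.
  have mT : measurable_fun setT T.
    by apply: measurableT_comp; [exact: measurable_expR|exact: measurable_tilt].
  have mnc : measurable_fun setT (fun x => normc (cop c x) ^+ 2).
    by apply: measurable_funX; exact: cmeasurable_normc.
  apply: (@le_trans _ _ (\int[leb]_(x in eball r)
      (expR n.+1%:R * (T x * normc (cop c x) ^+ 2))%:E)%E).
    apply: ge0_le_integral => //.
    - by move=> x _; rewrite lee_fin mulr_ge0 ?sqr_ge0.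
    - apply/measurable_EFinP; apply: measurable_funTS; apply: measurable_funM => //.
      exact: measurable_funX.
    - apply/measurable_EFinP; apply: measurable_funTS; apply: measurable_funM => //.
      exact: measurable_funM.
    move=> x xr; rewrite lee_fin mulrA ler_wpM2r ?sqr_ge0//.
    exact: weight_le_tilt.
  apply: (@le_trans _ _ (\int[leb]_x
      (expR n.+1%:R * (T x * normc (cop c x) ^+ 2))%:E)%E).
    apply: ge0_subset_integral => //.
    - by apply/measurable_EFinP; apply: measurable_funM => //; exact: measurable_funM.
    - by move=> x _; rewrite lee_fin; exact: T2.
  under eq_integral do rewrite EFinM.
  rewrite ge0_integralZl_EFin ?expR_ge0//; last 2 first.
  - by move=> x _; rewrite lee_fin; exact: T1.
  - by apply/measurable_EFinP; exact: measurable_funM.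
  by rewrite EFinM -muleA; apply: lee_wpmul2l; rewrite ?lee_fin ?expR_ge0.
have extE x : extension a lambda g x = \sum_c cop c x.
  have icop c := let: And3 _ h _ := cell_bound c in h x.
  rewrite /cop /cell_operator -(cintegral_sum _ icop).2.
  rewrite /extension /cintegral /Rintegral.
  have E xi : \sum_c cexp (phase lambda x xi) * (a x xi * gc c xi) =
      cexp (phase lambda x xi) * (a x xi * on_sphere g xi).
    by rewrite -mulr_sumr -mulr_sumr (sum_on_cell l K g (k := id)).
  congr (fine _ +i* fine _); rewrite integral_mkcond; apply: eq_integral => xi _;
    rewrite E patchE /on_sphere; case: ifP => _; rewrite ?mulr0//= -mulrA//.
have card_le : #|{: cell_index n K}|%:R <= cI * delta ^- n.
  rewrite card_cell_index /cI -mulrA -exprVn -exprMn natrM mulnC natrM natrX.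
  rewrite ler_pM2l ?mulr_gt0//; apply: lerXn2r; rewrite ?nnegrE//.
    by rewrite mulr_ge0 ?invr_ge0 ?(ltW de0)// mulr_ge0// ltW.
  have -> : 18 * n.+1%:R ^+ 3 * delta^-1 = 3 / l.
    by rewrite /l; field; rewrite !gt_eqF.
  have l1 : l <= 1.
    rewrite ler_pdivrMr ?mulr_gt0// mul1r; apply: (le_trans de1).
    by apply: mulr_ege1; [rewrite ler1n|exact: exprn_ege1].
  have : (K%:R : R) <= 2 / l by rewrite truncn_le divr_ge0// ltW.
  have : 1 <= l^-1 by rewrite invf_ge1.
  rewrite -natr1; lra.
have mcop c : measurable_fun setT (fun x => W x ^+ 2 * normc (cop c x) ^+ 2).
  have [mc _ _] := cell_bound c.
  apply: measurable_funM; first exact: measurable_funX.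
  by apply: measurable_funX; exact: cmeasurable_normc.
(* Cauchy-Schwarz over the cells with unit weights: the number of cells is the price, and it
   accounts for [delta ^- n]. *)
apply: (@le_trans _ _ (\int[leb]_(x in eball r)
    (#|{: cell_index n K}|%:R%:E * \sum_c (W x ^+ 2 * normc (cop c x) ^+ 2)%:E))%E).
  have mext : cmeasurable_fun setT (extension a lambda g).
    rewrite (_ : extension a lambda g = fun x => \sum_c cop c x); last exact/funext.
    by apply: cmeasurable_sum => c; have [] := cell_bound c.
  apply: ge0_le_integral => //.
  - by move=> x _; rewrite lee_fin mulr_ge0 ?sqr_ge0.
  - apply/measurable_EFinP; apply: measurable_funTS; apply: measurable_funM.
      exact: measurable_funX.
    by apply: measurable_funX; exact: cmeasurable_normc.
  - apply: measurable_funeM; apply: emeasurable_sum => c.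
    by apply/measurable_EFinP; exact: measurable_funTS.
  move=> x _; rewrite sumEFin -EFinM lee_fin -mulr_sumr [leRHS]mulrCA.
  rewrite ler_wpM2l ?sqr_ge0//.
  rewrite extE.
  have := @weighted_cauchy_schwarz R (cell_index n K) (fun=> 1) (fun c => normc (cop c x))
    (fun=> ler01).
  rewrite sumr_const [in X in X ^+ 2](eq_bigr _ (fun c _ => mul1r _)).
  rewrite [in leRHS](eq_bigr _ (fun c _ => mul1r _)); apply: le_trans.
  apply: lerXn2r; rewrite ?nnegrE ?normc_ge0 ?sumr_ge0// ?normc_sum// => c _.
  exact: normc_ge0.
rewrite ge0_integralZl_EFin//; last 2 first.
- by move=> x _; rewrite sume_ge0// => c _; rewrite lee_fin mulr_ge0 ?sqr_ge0.
- by apply: emeasurable_sum => c; apply/measurable_EFinP; exact: measurable_funTS.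
rewrite ge0_integral_sum//; last 2 first.
- by move=> c; apply/measurable_EFinP; exact: measurable_funTS.
- by move=> c x _; rewrite lee_fin mulr_ge0 ?sqr_ge0.
set G := (\int[nu]_(xi in S) _)%E.
have G0 : (0 <= G)%E by apply: integral_ge0 => xi _; rewrite lee_fin sqr_ge0.
apply: (@le_trans _ _ (#|{: cell_index n K}|%:R%:E * ((expR n.+1%:R * (K0 * B))%:E * G))%E).
  apply: lee_wpmul2l; first by rewrite lee_fin.
  rewrite /G -(sum_integral_on_cell l K mg) ge0_sume_distrr; last first.
    by move=> c _; apply: integral_ge0 => xi _; rewrite lee_fin sqr_ge0.
  by apply: lee_sum => c _; have [] := cell_bound c.
rewrite muleA -EFinM; apply: lee_wpmul2r => //; rewrite lee_fin.
apply: (@le_trans _ _ (cI * delta ^- n * (expR n.+1%:R * (K0 * B)))).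
  by rewrite ler_wpM2r// mulr_ge0 ?expR_ge0// mulr_ge0// ltW.
by rewrite le_eqVlt; apply/orP; left; apply/eqP; rewrite /B; ring.
Qed.

End square_estimate.

Lemma L2normE (R : realType) d (T : measurableType d) (mu : {measure set T -> \bar R})
    (D : set T) (f : T -> R[i]) :
  (L2norm mu D f = (\int[mu]_(x in D) (normc (f x) ^+ 2)%:E) `^ 2^-1)%E.
Proof.
rewrite /L2norm Lnorm.unlock; congr (_ `^ _)%E.
rewrite [RHS]integral_mkcond; apply: eq_integral => x _; rewrite !patchE.
case: ifP => _; last by rewrite abse0 poweR0r// pnatr_eq0.
by rewrite gee0_abs ?lee_fin ?normc_ge0// poweR_EFin powR_mulrn ?normc_ge0.
Qed.

(** The larger of [|s|] and [|t|] is at least half of [|lambda|], and [mu ^-1 <= r]. If [|s|] is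
    larger, [1 / |s| <= 2 / |lambda|]; otherwise the second term of [decay] gives
    [kap / mu <= 1 / (4 |t|)], again below [2 / |lambda|]. *)
Lemma decay_bound (R : realType) n (lambda : R[i]) (r delta : R) :
  0 < r -> 0 < delta <= 1 -> lambda != 0 ->
  let mu := decay n lambda r delta in let Q := r * (2 / normc lambda) ^+ n in
  (delta / (6 * n.+1%:R)) ^+ n / mu ^+ n.+1 <= Q \/
    (complex.Re lambda != 0 /\ `|complex.Re lambda| ^- n / mu <= Q).
Proof.
move=> r0 dl l0 mu Q.
have mu0 : 0 < mu by exact: decay_gt0.
have /andP[de0 de1] := dl.
have d0 : (0 : R) < n.+1%:R by [].
have L0 : 0 < normc lambda.
  by rewrite lt_def normc_ge0 andbT; apply: contraNneq l0 => /eq0_normc ->.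
have mur : mu^-1 <= r.
  rewrite -[leRHS]invrK lef_pV2 ?posrE ?invr_gt0//.
  by rewrite /mu /decay lerDl divr_ge0// !mulr_ge0// ltW.
have LE := normc_le_ReIm lambda.
have Hn (t : R) : 0 <= t -> t <= 2 / normc lambda -> t ^+ n / mu <= Q.
  move=> t0 tL; rewrite /Q mulrC; apply: ler_pM => //.
  - by rewrite invr_ge0 ltW.
  - exact: exprn_ge0.
  by apply: lerXn2r; rewrite ?nnegrE// divr_ge0// ltW.
have [h|h] := leP `|complex.Im lambda| `|complex.Re lambda|.
  right; have s0 : 0 < `|complex.Re lambda| by lra.
  split; first by rewrite -normr_gt0.
  rewrite -exprVn; apply: Hn; first by rewrite invr_ge0.
  by rewrite -[leRHS]invrK invf_div lef_pV2 ?posrE ?divr_gt0// ler_pdivrMr//; lra.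
left.
have -> : (delta / (6 * n.+1%:R)) ^+ n / mu ^+ n.+1 =
    (delta / (6 * n.+1%:R) / mu) ^+ n / mu.
  move: (delta / _) => k.
  by rewrite expr_div_n exprSr [(_ * mu)^-1]invfM mulrA.
have t0 : 0 < `|complex.Im lambda| by apply: le_lt_trans h.
apply: Hn; first by rewrite mulr_ge0// ?invr_ge0 ?divr_ge0 ?mulr_ge0// ltW.
rewrite ler_pdivrMr// mulrAC ler_pdivlMr//.
have -> : delta / (6 * n.+1%:R) * normc lambda = delta * normc lambda / (6 * n.+1%:R).
  by rewrite mulrAC.
rewrite ler_pdivrMr ?mulr_gt0//.
have : 2 * delta * `|complex.Im lambda| / (3 * n.+1%:R) <= mu.
  by rewrite /mu /decay lerDr invr_ge0 ltW.
rewrite ler_pdivrMr ?mulr_gt0// => H.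
have : delta * normc lambda <= delta * (2 * `|complex.Im lambda|).
  by rewrite ler_pM2l//; lra.
have : 0 <= mu * n.+1%:R by rewrite mulr_ge0// ltW.
lra.
Qed.

Theorem proposition3p1 (R : realType) (d : nat) (hd : (2 <= d)%N) :
  exists N0 : nat, forall N : nat, (N0 <= N)%N ->
  exists2 C : R, 0 < C &
  forall (lambda : R[i]) (r delta : R), 0 < r -> 0 < delta <= 1 ->
  forall a : 'rV[R]_d -> 'rV[R]_d -> R[i],
    amplitude a -> (LinfCN_norm N a <= 1)%E ->
  forall g : 'rV[R]_d -> R[i], L2fun (surface d) (sphere d) g ->
  (L2norm (lebesgue_rV d) (eball r)
     (fun x => (weight delta lambda x)%:C%C * extension a lambda g x)%R
   <= (C * r `^ 2^-1)%:E
      * powRNy (normc (delta%:C%C * lambda)%R) (d.-1%:R / 2)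
      * L2norm (surface d) (sphere d) g)%E.
Proof.
(* [d] derivatives suffice: a mixed difference takes at most one derivative per coordinate. *)
case: d hd => // n _; exists n.+1 => N nN.
have [C0 C00 H] := @square_estimate R n.
(* The square root undoes the squared estimate; [2 ^+ n] comes from [Q] in [decay_bound]. *)
pose C := (C0 * 2 ^+ n) `^ 2^-1.
have C20 : 0 < C0 * 2 ^+ n by rewrite mulr_gt0 ?exprn_gt0.
exists C => [|lambda r delta r0 dl a amp aN g [mg gfin]]; first exact: powR_gt0.
have /ess_supP aN' := aN.
have /andP[de0 de1] := dl.
set G := (\int[surface n.+1]_(xi in sphere n.+1) (normc (g xi) ^+ 2)%:E)%E.
have G0 : (0 <= G)%E by apply: integral_ge0 => xi _; rewrite lee_fin sqr_ge0.
have Gfin : (G < +oo)%E.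
  rewrite ltey; apply/eqP => Goo; move: gfin; rewrite L2normE -/G Goo.
  by rewrite poweRE/= invr_eq0 pnatr_eq0/= ltxx.
rewrite !L2normE -/G.
set I1 := (\int[_]_(x in _) _)%E.
have I1E : I1 = (\int[lebesgue_rV n.+1]_(x in eball r)
     (weight delta lambda x ^+ 2 * normc (extension a lambda g x) ^+ 2)%:E)%E.
  apply: eq_integral => x _; rewrite normcM exprMn; congr (_ * _)%:E.
  by rewrite /= expr0n/= addr0 sqr_sqrtr ?sqr_ge0.
have I10 : (0 <= I1)%E by apply: integral_ge0 => x _; rewrite lee_fin sqr_ge0.
have HQ Q := H lambda r delta Q N a g r0 dl nN amp aN' mg Gfin.
have half : (0 : R) <= 2^-1 by rewrite invr_ge0.
have mono (x y : \bar R) : (0 <= x)%E -> (x <= y)%E -> (x `^ 2^-1 <= y `^ 2^-1)%E.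
  move=> x0 xy; apply: gt0_ler_poweR => //; rewrite in_itv/= leey andbT//.
  exact: le_trans xy.
have nE : normc (delta%:C%C * lambda) = delta * normc lambda.
  by rewrite normcM /= expr0n/= addr0 sqrtr_sqr gtr0_norm.
rewrite /powRNy nE.
have [l0|l0] := eqVneq lambda 0.
  rewrite l0 normc0 mulr0 eqxx.
  have c0 : 0 < C * r `^ 2^-1 by rewrite mulr_gt0 ?powR_gt0.
  rewrite gt0_muley ?lte_fin//.
  (* For [lambda = 0] and [g] zero almost everywhere the right-hand side is [+oo * 0 = 0], so the
     left-hand side has to vanish; the squared estimate with any finite [Q] shows this. *)
  have [GE|GN] := eqVneq G 0%E.
    have := HQ _ (or_introl (lexx ((delta / (6 * n.+1%:R)) ^+ n /
      decay n lambda r delta ^+ n.+1))).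
    rewrite -/G GE mule0 -I1E => I1le.
    have -> : I1 = 0%E by apply/eqP; rewrite eq_le I1le.
    by rewrite poweR0r ?invr_eq0 ?pnatr_eq0// mule0.
  rewrite gt0_mulye ?leey//.
  by rewrite poweR_gt0// lt_def GN.
have L0 : 0 < normc lambda.
  by rewrite lt_def normc_ge0 andbT; apply: contraNneq l0 => /eq0_normc ->.
have dL0 : 0 < delta * normc lambda by rewrite mulr_gt0.
rewrite (gt_eqF dL0).
have := HQ _ (decay_bound n r0 dl l0).
rewrite -/G -I1E => /(mono _ _ I10)/le_trans; apply.
rewrite poweRM//; last first.
  rewrite lee_fin; apply: mulr_ge0; first exact: ltW.
  apply: mulr_ge0; first by rewrite invr_ge0 exprn_ge0// ltW.
  by apply: mulr_ge0; [exact: ltW|rewrite exprn_ge0// divr_ge0// ltW].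
rewrite poweR_EFin -EFinM; apply: lee_wpmul2r; first exact: poweR_ge0.
rewrite lee_fin le_eqVlt; apply/orP; left; apply/eqP.
have -> : C0 * (delta ^- n * (r * (2 / normc lambda) ^+ n)) =
  (C0 * 2 ^+ n) * r * (delta * normc lambda) ^- n.
  by rewrite expr_div_n exprMn; field; rewrite !expf_neq0// gt_eqF.
have dn : 0 <= (delta * normc lambda) ^- n by rewrite invr_ge0 exprn_ge0// ltW.
have Cr : 0 <= C0 * 2 ^+ n * r by apply: mulr_ge0; exact: ltW.
rewrite (powRM _ Cr dn) (powRM _ (ltW C20) (ltW r0)).
congr (_ * _ * _).
rewrite -powR_mulrn ?(ltW dL0)// -powRN -powRrM; congr (_ `^ _).
by rewrite mulNr.
Qed.
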